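(* Let $X+iY\in\mathbb R^n+i\mathbb R^n=\mathbb C^n$ be a non-zero vector, and put $$\alpha(X,Y):=\sqrt{\tfrac12\sqrt{4\langle X,Y\rangle^2+(\|X\|^2-\|Y\|^2)^2}+\tfrac12(\|X\|^2+\|Y\|^2)},$$ $$\beta(X,Y):=\sqrt{-\tfrac12\sqrt{4\langle X,Y\rangle^2+(\|X\|^2-\|Y\|^2)^2}+\tfrac12(\|X\|^2+\|Y\|^2)}.$$ Then the equation $$r f_\theta'(0)=(\alpha(X,Y),\,i\beta(X,Y))$$ in $\mathbb C^2$, where for $\theta\in(0,\pi/4)$ $$f_\theta'(0)=\frac{4\tan\theta}{\pi\sqrt{1-\tan^2\theta}}\left(K'\!\left(\sqrt{1-\tan^2\theta}\right)\tan\theta,\,-iE'\!\left(\sqrt{1-\tan^2\theta}\right)\right),$$ $f_0'(0)=(4/\pi,0)$ and $f_{\pi/4}'(0)=(1,i)$, has exactly one solution $(r,\theta)\in(0,\infty)\times[0,\pi/4]$, and $$\kappa_{T_{\mathbb B_n}}(0;X+iY)=r .$$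
   Context: $\mathbb D$ is the open unit disc in $\mathbb C$; $\mathbb B_n$ is the open unit Euclidean ball in $\mathbb R^n$; $\langle\cdot,\cdot\rangle$, $\|\cdot\|$ are the standard scalar product and norm in $\mathbb R^n$. For a domain $\Omega\subset\mathbb R^n$ the tube domain over $\Omega$ is $T_\Omega:=\Omega+i\mathbb R^n\subset\mathbb C^n$. For a domain $G\subset\mathbb C^n$, $z\in G$, $X\in\mathbb C^n$, the Kobayashi-Royden pseudometric is $$\kappa_G(z;X):=\inf\{t>0:\ \exists f:\mathbb D\to G \text{ holomorphic},\ f(0)=z,\ tf'(0)=X\}.$$ $K$ and $E$ are the complete elliptic integrals of the first and second kind, as functions of the modulus $k$: $$K(k)=\int_0^1\frac{dx}{\sqrt{1-x^2}\sqrt{1-k^2x^2}},\qquad E(k)=\int_0^1\frac{\sqrt{1-k^2x^2}}{\sqrt{1-x^2}}\,dx,$$ and $K'$, $E'$ are their derivatives with respect to $k$. The notation $f_\theta'(0)$ denotes the derivative at $0$ of the mapping $$f_\theta(\lambda)=\frac1{2\pi}\int_0^{2\pi}\frac{e^{it}+\lambda}{e^{it}-\lambda}\,\frac{\operatorname{Re}(e^{it}a)}{\|\operatorname{Re}(e^{it}a)\|}\,dt,\qquad a=(\cos\theta,i\sin\theta)\in\mathbb C^2,\ \lambda\in\mathbb D,$$ where $\operatorname{Re}$ is taken coordinatewise; that is, $$f_\theta'(0)=\frac4\pi\int_0^{\pi/2}\frac{(\cos\theta\cos^2t,\ i\sin\theta\sin^2t)}{\sqrt{\cos^2\theta\cos^2t+\sin^2\theta\sin^2t}}\,dt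 .$$ *)

(* Defs.v *)
From HB Require Import structures.
From mathcomp Require Import all_boot all_order all_algebra.
From mathcomp Require Import all_classical all_reals all_analysis.
From mathcomp Require Export complex.

Set Implicit Arguments.
Unset Strict Implicit.
Unset Printing Implicit Defensive.

Import Order.TTheory GRing.Theory Num.Theory.
Import numFieldNormedType.Exports.

Local Open Scope classical_set_scope.
Local Open Scope complex_scope.
Local Open Scope ring_scope.

(* Complex numbers are R[i] = complex R; the imaginary unit is 'i%C, i.e.
   Complex 0 1 (not the abstract Num.imaginary). *)

Section Euclidean.
Context {R : realType} {n : nat}.
Implicit Types x y : 'rV[R]_n.

Definition dot x y : R := \sum_(j < n) x 0 j * y 0 j.

(* The library norm `|x| on 'rV[R]_n is the sup norm; this one is Euclidean. *)
Definition enorm x : R := Num.sqrt (dot x x).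

Definition unit_ball : set 'rV[R]_n := [set x | enorm x < 1].

Definition cvec x y : 'rV[R[i]]_n := \row_j (x 0 j +i* y 0 j).

Definition re_vec (z : 'rV[R[i]]_n) : 'rV[R]_n := map_mx (@complex.Re R) z.

Definition tube (Omega : set 'rV[R]_n) : set 'rV[R[i]]_n :=
  [set z | Omega (re_vec z)].

End Euclidean.

Section Kobayashi.
Context {R : realType} {n : nat}.

Definition unit_disc : set R[i] := [set z | `|z| < 1].

(* R[i]^o is R[i] as a normed space over itself, so [derivable] and 'D_1 take
   the limit of (f (h + z) - f z) / h as the complex number h tends to 0. *)
Definition cderive (f : R[i] -> 'rV[R[i]]_n) (z : R[i]) : 'rV[R[i]]_n :=
  'D_1 (f : R[i]^o -> 'rV[R[i]]_n) z.

(* Complex differentiability at every point of the open set D; the values of f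
   outside D play no role.  The norm on 'rV[R[i]]_n used by [derivable] induces
   the usual topology of C^n. *)
Definition holomorphic_on (D : set R[i]) (f : R[i] -> 'rV[R[i]]_n) : Prop :=
  forall z, D z -> derivable (f : R[i]^o -> 'rV[R[i]]_n) z 1.

(* Extended-real valued, so that the infimum of the empty set is +oo. *)
Definition kobayashi (G : set 'rV[R[i]]_n) (z v : 'rV[R[i]]_n) : \bar R :=
  ereal_inf [set t%:E | t in [set t : R | 0 < t /\
    exists f : R[i] -> 'rV[R[i]]_n,
      [/\ holomorphic_on unit_disc f,
          forall w, unit_disc w -> G (f w),
          f 0 = z
        & t%:C *: cderive f 0 = v]]].

End Kobayashi.

Section Elliptic.
Context {R : realType}.

(* Lebesgue integrals; the integrand takes the junk value 0 at the null set
   {1} where the denominator vanishes. *)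
Definition ellK (k : R) : R :=
  \int[lebesgue_measure]_(x in `[0, 1])
    (Num.sqrt (1 - x ^+ 2) * Num.sqrt (1 - k ^+ 2 * x ^+ 2))^-1.

Definition ellE (k : R) : R :=
  \int[lebesgue_measure]_(x in `[0, 1])
    (Num.sqrt (1 - k ^+ 2 * x ^+ 2) / Num.sqrt (1 - x ^+ 2)).

End Elliptic.

Section Extremal.
Context {R : realType}.

Definition cintegral (A : set R) (g : R -> R[i]) : R[i] :=
  (\int[lebesgue_measure]_(t in A) complex.Re (g t)) +i*
  (\int[lebesgue_measure]_(t in A) complex.Im (g t)).

Definition cis (t : R) : R[i] := cos t +i* sin t.

Definition cpair (z w : R[i]) : 'rV[R[i]]_2 :=
  \row_j (if j == 0 then z else w).

Definition dir (theta : R) : 'rV[R[i]]_2 :=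
  cpair (cos theta)%:C ('i%C * (sin theta)%:C).

(* At theta = 0 the norm in the denominator vanishes for t = pi/2 and 3pi/2
   only, a null set on which the integrand takes the junk value 0. *)
Definition fext (theta : R) (lambda : R[i]) : 'rV[R[i]]_2 :=
  \row_j (((2 * pi)^-1)%:C * cintegral `[0, 2 * pi] (fun t =>
    (cis t + lambda) / (cis t - lambda) *
    (re_vec (cis t *: dir theta) 0 j / enorm (re_vec (cis t *: dir theta)))%:C)).

End Extremal.

Section AlphaBeta.
Context {R : realType} {n : nat}.
Implicit Types X Y : 'rV[R]_n.

Definition alpha X Y : R :=
  Num.sqrt (2^-1 * Num.sqrt (4 * dot X Y ^+ 2 +
                             (enorm X ^+ 2 - enorm Y ^+ 2) ^+ 2)
            + 2^-1 * (enorm X ^+ 2 + enorm Y ^+ 2)).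

Definition beta X Y : R :=
  Num.sqrt (- (2^-1 * Num.sqrt (4 * dot X Y ^+ 2 +
                                (enorm X ^+ 2 - enorm Y ^+ 2) ^+ 2))
            + 2^-1 * (enorm X ^+ 2 + enorm Y ^+ 2)).

End AlphaBeta.

(* Main.v *)
(* Multiplying X + iY by a unimodular number u makes its real and imaginary
   parts orthogonal, of lengths alpha >= beta; hence up to u and an orthonormal
   pair p, q the direction is (alpha, i beta) = r f_theta'(0), read in the plane
   spanned by p and q.

   Upper bound: f_theta is the Schwarz integral of the boundary values
   N(t) / |N(t)|, where N(t) = Re (e^it a), so its real part is a Poisson average
   of unit vectors and f_theta is a competitor for kappa.

   Lower bound: let f be a competitor with s f'(0) = X + iY.  With the components
   b_j of cos theta p - i sin theta q, the function
   sum_j f_j(z) (b_j rho / z + conj(b_j) z / rho) extends holomorphically to 0,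
   and on |z| = rho its real part is 2 <Re f, N>, which is at most 2 |N| by
   Cauchy-Schwarz, with equality for f_theta as rho tends to 1.  Comparing the
   means over the circle gives s >= r.

   With m = tan theta, the two components of f_theta'(0) are 4/pi times integrals
   over [0, pi/2] of which the first decreases strictly and the second increases
   in m; their ratio runs through [0, 1], which gives the unique solution. *)
Require Import Defs.
From mathcomp Require Import all_boot all_order all_algebra.
From mathcomp Require Import all_classical all_reals all_analysis.
From mathcomp Require Import measurable_realfun.
From mathcomp Require Import ring lra.
Import Order.TTheory GRing.Theory Num.Theory.
Import numFieldNormedType.Exports.
Local Open Scope classical_set_scope.
Local Open Scope complex_scope.
Local Open Scope ring_scope.
Set Implicit Arguments.
Unset Strict Implicit.
Unset Printing Implicit Defensive.

(** * Integrals over segments *)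

Section Integrals.
Context {R : realType}.
Notation mu := (@lebesgue_measure R).
Implicit Types (f g F : R -> R) (a b c : R).

(** A competitor is holomorphic on the open disc only, and the test function of the lower bound has
    a removable singularity at 0. What is needed is thus a mean value property on circles of radius
    below 1, for a function holomorphic on a punctured disc with a limit at 0. It comes from
    Goursat's bisection on rectangles: the exponential maps a rectangle of height 2 pi onto an
    annulus, and the inner radius is sent to 0. The factor [b_j rho / z + conj(b_j) z / rho] is real
    on |z| = rho, so real parts pass through it, and its only pole picks out f'(0). Integrating |N|
    amounts to pairing N with the boundary values of f_theta, so the two bounds carry the same
    constant. Two degenerate cases shape the statements. If beta = 0 there may be no unit vector
    orthogonal to p (as for n = 1), so q may be 0 and is only required to satisfy |q| <= 1. At theta
    = 0 the boundary values of f_theta are the sign of cos, which jumps: Schwarz integrals are taken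
    of measurable functions, and parity arguments are replaced there by explicit integrals. *)

Lemma itv_integrable f a b : {within `[a, b], continuous f} ->
  mu.-integrable `[a, b] (EFin \o f).
Proof. by move=> cf; apply: continuous_compact_integrable => //; exact: segment_compact. Qed.

Lemma within_continuous f (A : set R) : continuous f -> {within A, continuous f}.
Proof. by move=> cf; apply: continuous_subspaceT. Qed.

Lemma itv_within_continuous f a b :
  (forall x, a <= x <= b -> {for x, continuous f}) ->
  {within `[a, b], continuous f}.
Proof.
move=> cf; apply: continuous_in_subspaceT => x.
by rewrite inE/= in_itv/=; exact: cf.
Qed.

Lemma Rintegral_split f a c b : a <= c <= b ->
  mu.-integrable `[a, b] (EFin \o f) ->
  \int[mu]_(x in `[a, b]) f x =
  \int[mu]_(x in `[a, c]) f x + \int[mu]_(x in `[c, b]) f x.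
Proof.
move=> /andP[ac cb] intf.
have := @Rintegral_itvB R f (BLeft a) (BRight b) c intf.
rewrite !bnd_simp => /(_ ac cb).
rewrite Rintegral_itv_obnd_cbnd; last first.
  by apply: integrableS intf => //; apply: subset_itvr; rewrite bnd_simp.
by move=> <-; rewrite addrC subrK.
Qed.

Lemma normr_Rintegral_le f a b (C : R) : a <= b ->
  mu.-integrable `[a, b] (EFin \o f) ->
  (forall x, a <= x <= b -> `|f x| <= C) ->
  `|\int[mu]_(x in `[a, b]) f x| <= C * (b - a).
Proof.
move=> ab intf fC.
apply: (@le_trans _ _ (\int[mu]_(x in `[a, b]) `|f x|)).
  exact: le_normr_Rintegral.
have -> : C * (b - a) = \int[mu]_(x in `[a, b]) C.
  rewrite Rintegral_cst//= lebesgue_measure_itv/= lte_fin.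
  move: ab; rewrite le_eqVlt => /predU1P[->|->//].
  by rewrite ltxx subrr.
apply: le_Rintegral => //.
- by move/integrable_norm : intf.
- by apply: itv_integrable; apply: within_continuous => x; exact: cvg_cst.
Qed.

Lemma Rintegral_FTC F f a b : a <= b ->
  {within `[a, b], continuous f} ->
  (forall x, a <= x <= b -> is_derive x 1 F (f x)) ->
  \int[mu]_(x in `[a, b]) f x = F b - F a.
Proof.
rewrite le_eqVlt => /predU1P[<- _ _|ab cf dF].
  by rewrite set_itv1 Rintegral_set1 subrr.
have cF x : a <= x <= b -> {for x, continuous F}.
  move=> /dF [dFx _]; exact/differentiable_continuous/derivable1_diffP.
rewrite /Rintegral (@continuous_FTC2 _ f F)//.
- split.
  + by move=> x; rewrite in_itv/= => /andP[/ltW ax /ltW xb]; case: (dF x); rewrite ?ax.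
  + by apply: cvg_at_right_filter; apply: cF; rewrite lexx ltW.
  + by apply: cvg_at_left_filter; apply: cF; rewrite lexx ltW.
- move=> x; rewrite in_itv/= => /andP[/ltW ax /ltW xb].
  by rewrite derive1E; case: (dF x); rewrite ?ax.
Qed.

Lemma Rintegral_subst_reflect f a b c : a <= b -> {within `[c - b, c - a], continuous f} ->
  \int[mu]_(x in `[a, b]) f (c - x) = \int[mu]_(x in `[c - b, c - a]) f x.
Proof.
move=> ab cf.
have dF (x : R) : is_derive x (1 : R) (fun x : R => c - x) (-1 : R).
  by apply: is_derive_eq; rewrite add0r mul1r.
have dF1 : (fun x : R => c - x)^`()%classic = cst (-1 : R).
  by apply/funext => x; rewrite derive1E; case: (dF x).
have := @integration_by_substitution_decreasing R (fun x : R => c - x) f a b ab.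
rewrite dF1 => H.
rewrite /Rintegral H//.
- congr fine; apply: eq_integral => x _ /=; congr EFin.
  by rewrite !fctE opprK mulr1.
- by move=> x y _ _ xy; rewrite ltrD2l ltrN2.
- by move=> ? _; exact: cvg_cst.
- exact: is_cvg_cst.
- exact: is_cvg_cst.
- have cF x : {for x, continuous (fun x : R => c - x)}.
    by case: (dF x) => d _; exact/differentiable_continuous/derivable1_diffP.
  split.
  + by move=> x _; case: (dF x).
  + by apply: cvg_at_right_filter; exact: cF.
  + by apply: cvg_at_left_filter; exact: cF.
Qed.

Lemma Rintegral_reflect f a b : a <= b -> {within `[a, b], continuous f} ->
  \int[mu]_(x in `[a, b]) f (a + b - x) = \int[mu]_(x in `[a, b]) f x.
Proof.
move=> ab cf; have := @Rintegral_subst_reflect f a b (a + b) ab.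
by rewrite addrK [a + b]addrC addrK => ->.
Qed.

End Integrals.

(* [`|z|] is itself a complex number; [normc] is the real-valued modulus. *)
Notation normc := Normc.normc.

(** * Complex differentiability and Goursat's lemma *)

Section ComplexDerivative.
Context {R : realType}.
Implicit Types (f g : R[i] -> R[i]) (z w l : R[i]).

Lemma normcE z : `|z| = (normc z)%:C.
Proof. by case: z. Qed.

Lemma normc_ge0 z : 0 <= normc z.
Proof. by rewrite -lecR -normcE normr_ge0. Qed.

Lemma normc_eq0 z : (normc z == 0) = (z == 0).
Proof.
by apply/eqP/eqP => [/Normc.eq0_normc//|->]; exact: Normc.normc0.
Qed.

Lemma normc_gt0 z : (0 < normc z) = (z != 0).
Proof. by rewrite lt_neqAle normc_ge0 andbT eq_sym normc_eq0. Qed.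

Lemma normcD z w : normc (z + w) <= normc z + normc w.
Proof. by rewrite -lecR rmorphD /= -!normcE ler_normD. Qed.

Lemma normcNE z : normc (- z) = normc z.
Proof. by apply: complexI; rewrite -!normcE normrN. Qed.

Lemma normcM z w : normc (z * w) = normc z * normc w.
Proof. exact: Normc.normcM. Qed.

Lemma normcV z : normc z^-1 = (normc z)^-1.
Proof. exact: Normc.normcV. Qed.

Lemma normc_real (x : R) : normc x%:C = `|x|.
Proof. by rewrite /= expr0n addr0 sqrtr_sqr. Qed.

Lemma Re_le_normc z : `|complex.Re z| <= normc z.
Proof. by rewrite -lecR -normcE normc_ge_Re. Qed.

Lemma Im_le_normc z : `|complex.Im z| <= normc z.
Proof.
case: z => a b /=; rewrite -sqrtr_sqr ler_wsqrtr// lerDr; exact: sqr_ge0.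
Qed.

Lemma normc_le_Re_Im z : normc z <= `|complex.Re z| + `|complex.Im z|.
Proof.
case: z => a b /=; rewrite -[leRHS]ger0_norm ?addr_ge0// -sqrtr_sqr ler_wsqrtr//.
rewrite sqrrD !real_normK ?num_real// -addrA lerD2l lerDr.
by rewrite mulrn_wge0// mulr_ge0.
Qed.

(** Complex differentiability in little-o form with real tolerances: estimates then live in [R]
    through [normc], and [h = 0] needs no exclusion. *)
Definition cder f z l : Prop :=
  forall e : R, 0 < e -> exists2 d : R, 0 < d &
    forall h, normc h < d -> normc (f (z + h) - f z - l * h) <= e * normc h.

Lemma is_derive_cvgP {K : numFieldType} {V W : normedModType K} (f : V -> W) (a v : V) (l : W) :
  is_derive a v f l <->
  (fun h => h^-1 *: ((f \o shift a) (h *: v) - f a)) @ (0 : K)^' --> l.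
Proof.
split=> [[df <-]|fl]; first exact: df.
by split; [apply/cvg_ex; exists l|exact/cvg_lim].
Qed.

Lemma ltc_real (e : R[i]) : 0 < e -> e = (complex.Re e)%:C /\ 0 < complex.Re e.
Proof. by case: e => a b; rewrite ltcE /= => /andP[/eqP -> ->]. Qed.

Lemma normc_quotient h D l : h != 0 ->
  normc (l - h^-1 * D) = normc (D - l * h) / normc h.
Proof.
move=> h0; rewrite -normcV -normcM -normcNE; congr Normc.normc.
by rewrite mulrBl mulrK ?unitfE// opprB [D * _]mulrC.
Qed.

(** Balls of matrices are entrywise, so a vector derivative splits into estimates for the
    coordinates; all work on C^n goes through this equivalence. *)
Lemma is_derive_mxP {m n} (M : R[i] -> 'M[R[i]]_(m, n)) z (L : 'M[R[i]]_(m, n)) :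
  is_derive (z : R[i]^o) (1 : R[i]^o) (M : R[i]^o -> 'M[R[i]]_(m, n)) L <->
  forall i j, cder (fun w => M w i j) z (L i j).
Proof.
apply: (iff_trans (is_derive_cvgP _ _ _ _)); split.
- move=> /cvg_ballP ML i j e e0.
  have /ML : 0 < e%:C by rewrite ltcR.
  move=> [_/posnumP[d]] Md.
  have [dE d0] := ltc_real (gt0 d).
  exists (complex.Re d%:num) => // h hd.
  have [->|h0] := eqVneq h 0; first by rewrite !(mulr0, addr0, subrr) Normc.normc0 mulr0.
  have /(_ _ h0)[] := Md h.
    by rewrite /= sub0r normrN normcE dE ltcR.
  move=> _ /(_ i j); rewrite !mxE /ball/= [_ *: 1]mulr1 (addrC h).
  by rewrite normcE ltcR normc_quotient// ltr_pdivrMr ?normc_gt0// => /ltW.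
- move=> ML; apply/cvg_ballP => e /[dup] e0 /ltc_real[eE re0].
  (* [cder] gives a non-strict bound while a ball asks for a strict one; half of the tolerance makes
     up for it. *)
  have e20 : 0 < complex.Re e / 2 by rewrite divr_gt0.
  near=> h.
  have h0 : h != 0 by near: h; exact: nbhs_dnbhs_neq.
  split=> // i j; rewrite !mxE /ball/= [_ *: 1]mulr1 (addrC h).
  rewrite normcE eE ltcR normc_quotient// ltr_pdivrMr ?normc_gt0//.
  apply: (@le_lt_trans _ _ (complex.Re e / 2 * normc h)); last first.
    by rewrite ltr_pM2r ?normc_gt0// ltr_pdivrMr// ltr_pMr// ltr1n.
  move: i j; near: h; apply: filter_forall => i; apply: filter_forall => j.
  have [d d0 Md] := ML i j _ e20.
  near=> h; apply: Md; rewrite -ltcR -normcE.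
  by near: h; apply: dnbhs0_lt; rewrite ltcR.
Unshelve. all: by end_near. Qed.

Lemma is_derive_cderP f z l :
  is_derive (z : R[i]^o) (1 : R[i]^o) (f : R[i]^o -> R[i]^o) l <-> cder f z l.
Proof.
have := @is_derive_mxP 1 1 (fun w => \matrix_(i, j) f w) z (\matrix_(i, j) l).
move=> H; split=> [/is_derive_cvgP fl|fl].
- have /H/(_ 0 0) : is_derive (z : R[i]^o) 1 ((fun w => \matrix_(i, j) f w) : R[i]^o -> 'M[R[i]]_(1, 1)) (\matrix_(i, j) l).
    apply/is_derive_cvgP/cvg_ballP => e e0.
    move/cvg_ballP : fl => /(_ _ e0); apply: filterS => h fh.
    by split=> // i j; rewrite !mxE.
  by rewrite mxE; congr cder; apply/funext => w; rewrite mxE.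
- apply/is_derive_cvgP/cvg_ballP => e e0.
  have /is_derive_cvgP/cvg_ballP/(_ _ e0) : is_derive (z : R[i]^o) 1 ((fun w => \matrix_(i, j) f w) : R[i]^o -> 'M[R[i]]_(1, 1)) (\matrix_(i, j) l).
    by apply/H => i j; rewrite mxE; move: fl; congr cder; apply/funext => w; rewrite mxE.
  by apply: filterS => h [_ /(_ 0 0)]; rewrite !mxE.
Qed.

End ComplexDerivative.

Section Goursat.
Context {R : realType}.
Notation mu := (@lebesgue_measure R).
Implicit Types (h : R[i] -> R[i]) (z w l : R[i]).

Lemma cder_continuous h z l : cder h z l -> forall e : R, 0 < e ->
  exists2 d : R, 0 < d & forall w, normc w < d -> normc (h (z + w) - h z) <= e.
Proof.
move=> dh e e0; have [d d0 hd] := dh 1 ltr01.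
pose d' := Num.min d (e / (1 + normc l)).
have l0 : 0 < 1 + normc l by rewrite ltr_wpDr// normc_ge0.
exists d'; first by rewrite lt_min d0 divr_gt0.
move=> w; rewrite lt_min => /andP[wd we].
have -> : h (z + w) - h z = (h (z + w) - h z - l * w) + l * w by rewrite subrK.
rewrite (le_trans (normcD _ _))// normcM.
apply: (@le_trans _ _ ((1 + normc l) * normc w)).
  by rewrite mulrDl lerD2r; exact: hd.
by rewrite mulrC -ler_pdivlMr// ltW.
Qed.

Lemma cder_path_continuous h (p : R -> R[i]) (t : R) l : cder h (p t) l ->
  {for t, continuous (fun t => complex.Re (p t))} ->
  {for t, continuous (fun t => complex.Im (p t))} ->
  {for t, continuous (fun t => complex.Re (h (p t)))} /\
  {for t, continuous (fun t => complex.Im (h (p t)))}.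
Proof.
move=> dh cre cim.
suff H e : 0 < e -> \forall t' \near t, normc (h (p t) - h (p t')) <= e.
  split; apply/cvgrPdist_le => e e0; near=> t'.
  - rewrite -raddfB (le_trans (Re_le_normc _))//.
    by near: t'; exact: H.
  - rewrite -raddfB (le_trans (Im_le_normc _))//.
    by near: t'; exact: H.
move=> e0; have [d d0 hd] := cder_continuous dh e0.
have d20 : 0 < d / 2 by rewrite divr_gt0.
move/cvgrPdist_lt : cre => /(_ _ d20) cre.
move/cvgrPdist_lt : cim => /(_ _ d20) cim.
near=> t'.
have -> : p t' = p t + (p t' - p t) by rewrite addrC subrK.
rewrite -normcNE opprB hd//.
rewrite (le_lt_trans (normc_le_Re_Im _))// !raddfB/= (splitr d) ltrD//.
- rewrite distrC; near: t'; exact: cre.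
- rewrite distrC; near: t'; exact: cim.
Unshelve. all: by end_near. Qed.

(* The imaginary part of the contour integral of [h] along the boundary of the
   rectangle. *)
Definition rectangle_int h (x0 x1 y0 y1 : R) : R :=
  \int[mu]_(s in `[x0, x1])
     (complex.Im (h (s +i* y0)) - complex.Im (h (s +i* y1)))
  + \int[mu]_(t in `[y0, y1])
     (complex.Re (h (x1 +i* t)) - complex.Re (h (x0 +i* t))).

Definition holo_rect h (x0 x1 y0 y1 : R) :=
  forall s t, x0 <= s <= x1 -> y0 <= t <= y1 -> exists l, cder h (s +i* t) l.

Lemma horizontal_continuous h x0 x1 y0 y1 y : holo_rect h x0 x1 y0 y1 ->
  y0 <= y <= y1 ->
  {within `[x0, x1], continuous (fun s => complex.Re (h (s +i* y)))} /\
  {within `[x0, x1], continuous (fun s => complex.Im (h (s +i* y)))}.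
Proof.
move=> H yy; split; apply: itv_within_continuous => x xx;
  have [l hl] := H _ _ xx yy;
  have [] := @cder_path_continuous h (fun s => s +i* y) x l hl => //=.
all: exact: cvg_cst.
Qed.

Lemma vertical_continuous h x0 x1 y0 y1 x : holo_rect h x0 x1 y0 y1 ->
  x0 <= x <= x1 ->
  {within `[y0, y1], continuous (fun s => complex.Re (h (x +i* s)))} /\
  {within `[y0, y1], continuous (fun s => complex.Im (h (x +i* s)))}.
Proof.
move=> H xx; split; apply: itv_within_continuous => y yy;
  have [l hl] := H _ _ xx yy;
  have [] := @cder_path_continuous h (fun s => x +i* s) y l hl => //=.
all: exact: cvg_cst.
Qed.

Lemma holo_rectS h x0 x1 y0 y1 a0 a1 b0 b1 : holo_rect h x0 x1 y0 y1 ->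
  x0 <= a0 -> a1 <= x1 -> y0 <= b0 -> b1 <= y1 -> holo_rect h a0 a1 b0 b1.
Proof.
move=> H xa ax yb bY s t /andP[as0 as1] /andP[bt0 bt1].
by apply: H; apply/andP; split; [exact: le_trans as0|exact: le_trans ax|exact: le_trans bt0|exact: le_trans bY].
Qed.

Lemma within_continuousB (f g : R -> R) (A : set R) : {within A, continuous f} ->
  {within A, continuous g} -> {within A, continuous (fun x => f x - g x)}.
Proof.
by move=> cf cg x; apply: (@continuousB _ _ (subspace A) f g); [exact: cf|exact: cg].
Qed.

Lemma itv_integrableB (f g : R -> R) a b : {within `[a, b], continuous f} ->
  {within `[a, b], continuous g} ->
  mu.-integrable `[a, b] (EFin \o (fun x => f x - g x)).
Proof. by move=> cf cg; apply: itv_integrable; exact: within_continuousB. Qed.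

Lemma itv_RintegralB (f g : R -> R) a b : {within `[a, b], continuous f} ->
  {within `[a, b], continuous g} ->
  \int[mu]_(x in `[a, b]) (f x - g x) =
  \int[mu]_(x in `[a, b]) f x - \int[mu]_(x in `[a, b]) g x.
Proof. by move=> cf cg; rewrite RintegralB//; exact: itv_integrable. Qed.

Lemma rectangle_int_splitx h x0 x1 y0 y1 m : holo_rect h x0 x1 y0 y1 ->
  x0 <= m <= x1 -> y0 <= y1 ->
  rectangle_int h x0 x1 y0 y1 = rectangle_int h x0 m y0 y1 + rectangle_int h m x1 y0 y1.
Proof.
move=> H mm yy.
have [_ c0] := @horizontal_continuous _ _ _ _ _ y0 H (introT andP (conj (lexx _) yy)).
have [_ c1] := @horizontal_continuous _ _ _ _ _ y1 H (introT andP (conj yy (lexx _))).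
have xx : x0 <= x1 by case/andP: mm; exact: le_trans.
have [d0 _] := @vertical_continuous _ _ _ _ _ x0 H (introT andP (conj (lexx _) xx)).
have [d1 _] := @vertical_continuous _ _ _ _ _ x1 H (introT andP (conj xx (lexx _))).
have [dm _] := @vertical_continuous _ _ _ _ _ m H mm.
rewrite /rectangle_int (Rintegral_split mm (itv_integrableB c0 c1)).
rewrite (itv_RintegralB d1 d0) (itv_RintegralB dm d0) (itv_RintegralB d1 dm); lra.
Qed.

Lemma rectangle_int_splity h x0 x1 y0 y1 m : holo_rect h x0 x1 y0 y1 ->
  x0 <= x1 -> y0 <= m <= y1 ->
  rectangle_int h x0 x1 y0 y1 = rectangle_int h x0 x1 y0 m + rectangle_int h x0 x1 m y1.
Proof.
move=> H xx mm.
have yy : y0 <= y1 by case/andP: mm; exact: le_trans.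
have [_ c0] := @horizontal_continuous _ _ _ _ _ y0 H (introT andP (conj (lexx _) yy)).
have [_ c1] := @horizontal_continuous _ _ _ _ _ y1 H (introT andP (conj yy (lexx _))).
have [_ cm] := @horizontal_continuous _ _ _ _ _ m H mm.
have [d0 _] := @vertical_continuous _ _ _ _ _ x0 H (introT andP (conj (lexx _) xx)).
have [d1 _] := @vertical_continuous _ _ _ _ _ x1 H (introT andP (conj xx (lexx _))).
rewrite /rectangle_int (Rintegral_split mm (itv_integrableB d1 d0)).
rewrite (itv_RintegralB c0 c1) (itv_RintegralB c0 cm) (itv_RintegralB cm c1); lra.
Qed.

(** The affine part of [h] at [z] has zero contour integral. The remainder is at most [e * D] on the
    boundary, and opposite sides are integrated together, hence the factor 2. *)
Lemma rectangle_int_small h x0 x1 y0 y1 z l (e d : R) : holo_rect h x0 x1 y0 y1 ->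
  x0 <= complex.Re z <= x1 -> y0 <= complex.Im z <= y1 -> 0 <= e ->
  (forall w, normc w < d -> normc (h (z + w) - h z - l * w) <= e * normc w) ->
  (x1 - x0) + (y1 - y0) < d ->
  `|rectangle_int h x0 x1 y0 y1| <= 2 * e * ((x1 - x0) + (y1 - y0)) ^+ 2.
Proof.
move=> H xz yz e0 hd Dd; set D := (x1 - x0) + (y1 - y0) in Dd *.
have xx : x0 <= x1 by case/andP: xz; exact: le_trans.
have yy : y0 <= y1 by case/andP: yz; exact: le_trans.
have D0 : 0 <= D by rewrite /D; lra.
have B s t : x0 <= s <= x1 -> y0 <= t <= y1 ->
    normc (h (s +i* t) - h z - l * (s +i* t - z)) <= e * D.
  move=> sx ty.
  have wD : normc (s +i* t - z) <= D.
    rewrite (le_trans (normc_le_Re_Im _))//; case: (z) xz yz => a b /=.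
    move=> /andP[? ?] /andP[? ?]; move: sx ty => /andP[? ?] /andP[? ?].
    by rewrite /D lerD// ler_norml; apply/andP; split; lra.
  have := hd (s +i* t - z) (le_lt_trans wD Dd).
  have -> : z + (s +i* t - z) = s +i* t by rewrite addrC subrK.
  by move=> /le_trans; apply; exact: ler_wpM2l.
have [_ c0] := @horizontal_continuous _ _ _ _ _ y0 H (introT andP (conj (lexx _) yy)).
have [_ c1] := @horizontal_continuous _ _ _ _ _ y1 H (introT andP (conj yy (lexx _))).
have [d0 _] := @vertical_continuous _ _ _ _ _ x0 H (introT andP (conj (lexx _) xx)).
have [d1 _] := @vertical_continuous _ _ _ _ _ x1 H (introT andP (conj xx (lexx _))).
set p := complex.Re l.
have cc (a b c : R) : {within `[a, b], continuous (fun _ : R => c)}.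
  by apply: within_continuous => x; exact: cvg_cst.
have wE (a b c : R) : a <= b -> \int[mu]_(x in `[a, b]) c = c * (b - a).
  move=> ab; rewrite Rintegral_cst//= lebesgue_measure_itv/= lte_fin.
  by move: ab; rewrite le_eqVlt => /predU1P[->|->//]; rewrite ltxx subrr.
(* The subtracted constants are the differences of the affine part between opposite sides; their two
   integrals cancel. *)
have -> : rectangle_int h x0 x1 y0 y1 =
  \int[mu]_(s in `[x0, x1]) (complex.Im (h (s +i* y0)) - complex.Im (h (s +i* y1)) - (- p * (y1 - y0)))
  + \int[mu]_(t in `[y0, y1]) (complex.Re (h (x1 +i* t)) - complex.Re (h (x0 +i* t)) - p * (x1 - x0)).
  rewrite (itv_RintegralB (within_continuousB c0 c1) (cc _ _ _)).
  rewrite (itv_RintegralB (within_continuousB d1 d0) (cc _ _ _)).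
  by rewrite !wE// /rectangle_int; lra.
rewrite (le_trans (ler_normD _ _))//.
have -> : 2 * e * D ^+ 2 = (2 * (e * D)) * (x1 - x0) + (2 * (e * D)) * (y1 - y0).
  by rewrite /D; ring.
apply: lerD; apply: normr_Rintegral_le => //;
  try (apply: itv_integrableB; last exact: cc); try exact: within_continuousB.
- move=> s sx.
  have y0y : y0 <= y0 <= y1 by rewrite lexx.
  have y1y : y0 <= y1 <= y1 by rewrite lexx andbT.
  have := B _ _ sx y0y; have := B _ _ sx y1y.
  move=> /(le_trans (Im_le_normc _)) + /(le_trans (Im_le_normc _)).
  rewrite !raddfB/= /p; case: (l) => p' q' /=; case: (z) => a b /=.
  rewrite !ler_norml => /andP[? ?] /andP[? ?]; apply/andP; split; lra.
- move=> s sx.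
  have y0y : x0 <= x0 <= x1 by rewrite lexx.
  have y1y : x0 <= x1 <= x1 by rewrite lexx andbT.
  have := B _ _ y0y sx; have := B _ _ y1y sx.
  move=> /(le_trans (Re_le_normc _)) + /(le_trans (Re_le_normc _)).
  rewrite !raddfB/= /p; case: (l) => p' q' /=; case: (z) => a b /=.
  rewrite !ler_norml => /andP[? ?] /andP[? ?]; apply/andP; split; lra.
Qed.

Lemma nested_itv_point (x u : nat -> R) : (forall n, x n <= x n.+1) ->
  (forall n, x n.+1 + u n.+1 <= x n + u n) -> (forall n, 0 <= u n) ->
  exists X, forall n, x n <= X <= x n + u n.
Proof.
move=> xS uS u0.
have xm n m : (n <= m)%N -> x n <= x m.
  elim: m => [|m IH]; first by rewrite leqn0 => /eqP ->.
  rewrite leq_eqVlt => /predU1P[->//|]; rewrite ltnS => /IH /le_trans; exact.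
have um n m : (n <= m)%N -> x m + u m <= x n + u n.
  elim: m => [|m IH]; first by rewrite leqn0 => /eqP ->.
  rewrite leq_eqVlt => /predU1P[->//|]; rewrite ltnS => /IH; exact: le_trans.
have xu n m : x m <= x n + u n.
  have [nm|/ltnW mn] := leqP n m.
    by apply: le_trans (um _ _ nm); rewrite lerDl.
  by apply: le_trans (xm _ _ mn) _; rewrite lerDl.
have hs : has_sup (range x).
  split; first by exists (x 0%N); exists 0%N.
  by exists (x 0%N + u 0%N) => _ [m _ <-].
exists (sup (range x)) => n; apply/andP; split.
  by apply: sup_upper_bound => //; exists n.
by apply: ge_sup; [exists (x 0%N); exists 0%N|move=> _ [m _ <-]].
Qed.

(** One direction is halved at a time, at the cost of a factor 2; a halving in each direction makes
    one step of the bisection. *)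
Lemma rectangle_int_halfx h x y u v : holo_rect h x (x + 2 * u) y (y + v) ->
  0 <= u -> 0 <= v ->
  exists x', [/\ x <= x', x' + u <= x + 2 * u &
   `|rectangle_int h x (x + 2 * u) y (y + v)| <= 2 * `|rectangle_int h x' (x' + u) y (y + v)|].
Proof.
move=> H u0 v0.
have := @rectangle_int_splitx _ _ _ _ _ (x + u) H.
have -> : x + 2 * u = x + u + u by ring.
move=> ->; [|by apply/andP; split; lra|by lra].
have [le|le] := leP `|rectangle_int h (x + u) (x + u + u) y (y + v)| `|rectangle_int h x (x + u) y (y + v)|.
- exists x; split; [lra|lra|].
  by rewrite (le_trans (ler_normD _ _))//; lra.
- exists (x + u); split; [lra|lra|].
  by rewrite (le_trans (ler_normD _ _))//; lra.
Qed.

Lemma rectangle_int_halfy h x y u v : holo_rect h x (x + u) y (y + 2 * v) ->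
  0 <= u -> 0 <= v ->
  exists y', [/\ y <= y', y' + v <= y + 2 * v &
   `|rectangle_int h x (x + u) y (y + 2 * v)| <= 2 * `|rectangle_int h x (x + u) y' (y' + v)|].
Proof.
move=> H u0 v0.
have := @rectangle_int_splity _ _ _ _ _ (y + v) H.
have -> : y + 2 * v = y + v + v by ring.
move=> ->; [|by lra|by apply/andP; split; lra].
have [le|le] := leP `|rectangle_int h x (x + u) (y + v) (y + v + v)| `|rectangle_int h x (x + u) y (y + v)|.
- exists y; split; [lra|lra|].
  by rewrite (le_trans (ler_normD _ _))//; lra.
- exists (y + v); split; [lra|lra|].
  by rewrite (le_trans (ler_normD _ _))//; lra.
Qed.

(** After n quarterings the integral is at most 4^n times that over a small rectangle, and the
    affine approximation at the common point of the nested rectangles bounds the latter by a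
    multiple of (D / 2^n)^2. The powers cancel and leave 2 e D^2 with e arbitrary. *)
Lemma goursat h x0 x1 y0 y1 : holo_rect h x0 x1 y0 y1 -> x0 <= x1 -> y0 <= y1 ->
  rectangle_int h x0 x1 y0 y1 = 0.
Proof.
move=> H xx yy.
pose w n : R := 2^-1 ^+ n.
pose u n := (x1 - x0) * w n; pose v n := (y1 - y0) * w n.
have w0 n : 0 <= w n by rewrite exprn_ge0// invr_ge0.
have u0 n : 0 <= u n by rewrite mulr_ge0// subr_ge0.
have v0 n : 0 <= v n by rewrite mulr_ge0// subr_ge0.
have uS n : u n = 2 * u n.+1 by rewrite /u /w exprS; lra.
have vS n : v n = 2 * v n.+1 by rewrite /v /w exprS; lra.
pose I n (p : R * R) := rectangle_int h p.1 (p.1 + u n) p.2 (p.2 + v n).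
pose inside n (p : R * R) := [/\ x0 <= p.1, p.1 + u n <= x1, y0 <= p.2 & p.2 + v n <= y1].
have insideH n p : inside n p -> holo_rect h p.1 (p.1 + u n) p.2 (p.2 + v n).
  by case=> *; exact: holo_rectS H _ _ _ _.
(* The hypothesis sits under the existential so that [choice] yields a total function to iterate. *)
have step (np : nat * (R * R)) : exists q : R * R, inside np.1 np.2 ->
    [/\ np.2.1 <= q.1, q.1 + u np.1.+1 <= np.2.1 + u np.1,
        np.2.2 <= q.2, q.2 + v np.1.+1 <= np.2.2 + v np.1 &
        `|I np.1 np.2| <= 4 * `|I np.1.+1 q|].
  case: np => n [x y] /=.
  have [ip|nip] := pselect (inside n (x, y)); last by exists 0 => /nip.
  have [i1 i2 i3 i4] := ip; have /= Hp := insideH _ _ ip.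
  have := @rectangle_int_halfx h x y (u n.+1) (v n); rewrite -uS => /(_ Hp (u0 _) (v0 _)).
  move=> [x' [xx' x'u Ix]].
  have := @rectangle_int_halfy h x' y (u n.+1) (v n.+1); rewrite -vS.
  have Hp' : holo_rect h x' (x' + u n.+1) y (y + v n) by exact: holo_rectS Hp _ _ _ _.
  move=> /(_ Hp' (u0 _) (v0 _)) [y' [yy' y'v Iy]].
  exists (x', y') => _; split => //=; rewrite /I/=; lra.
have [f fP] := choice step.
pose p := fix p n := if n is n'.+1 then f (n', p n') else (x0, y0).
have pin n : inside n (p n).
  elim: n => [|n IH]; first by rewrite /inside/= /u /v /w expr0 !mulr1; split; lra.
  have [] := fP (n, p n) IH; rewrite -/(p n.+1) /= => ? ? ? ? _.
  by case: IH => ? ? ? ?; split; lra.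
have pS n := fP (n, p n) (pin n).
have pI n : `|I 0%N (p 0%N)| <= 4 ^+ n * `|I n (p n)|.
  elim: n => [|n IH]; first by rewrite expr0 mul1r.
  rewrite (le_trans IH)// exprSr -mulrA ler_wpM2l ?exprn_ge0//.
  by case: (pS n).
have [X XP] : exists X, forall n, (p n).1 <= X <= (p n).1 + u n.
  by apply: nested_itv_point => // n; case: (pS n).
have [Y YP] : exists Y, forall n, (p n).2 <= Y <= (p n).2 + v n.
  by apply: nested_itv_point => // n; case: (pS n).
have [l hl] : exists l, cder h (X +i* Y) l.
  have := XP 0%N; have := YP 0%N; rewrite /= /u /v /w expr0 !mulr1 => Y0 X0.
  by apply: H; lra.
have -> : rectangle_int h x0 x1 y0 y1 = I 0%N (p 0%N).
  by rewrite /I /= /u /v /w expr0 !mulr1; congr rectangle_int; ring.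
apply/normr0_eq0/eqP; rewrite -[_ == _]negbK; apply/negP => I0.
set D := (x1 - x0) + (y1 - y0).
have D0 : 0 <= D by rewrite /D; lra.
have {}I0 : 0 < `|I 0%N (p 0%N)| by rewrite lt_neqAle eq_sym I0 normr_ge0.
(* This makes 2 e D^2 smaller than the integral itself; the summand 1 covers D = 0. *)
pose e := `|I 0%N (p 0%N)| / (4 * (1 + D ^+ 2)).
have D2 : 0 < 1 + D ^+ 2 by rewrite ltr_wpDr// sqr_ge0.
have e0 : 0 < e by rewrite divr_gt0// mulr_gt0.
have [d d0 hd] := hl e e0.
have [n nd] : exists n, D * w n < d.
  have : (fun n => D * w n) @ \oo --> (0 : R).
    rewrite -[0](mulr0 D); apply: cvgMl_tmp; apply: cvg_expr.
    by rewrite ger0_norm ?invr_ge0// invf_lt1// ltr1n.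
  move/cvgrPdist_lt => /(_ _ d0)[n _ /(_ n (leqnn n))] /=.
  by rewrite sub0r normrN => /(le_lt_trans (ler_norm _)); exists n.
have uvD : (p n).1 + u n - (p n).1 + ((p n).2 + v n - (p n).2) = D * w n.
  by rewrite /u /v /D; ring.
have := @rectangle_int_small _ _ _ _ _ (X +i* Y) l e d (insideH _ _ (pin n)) (XP n) (YP n) (ltW e0) hd.
rewrite uvD => /(_ nd) In.
have : `|I 0%N (p 0%N)| <= 4 ^+ n * (2 * e * (D * w n) ^+ 2).
  by rewrite (le_trans (pI n))// ler_wpM2l// exprn_ge0.
have -> : 4 ^+ n * (2 * e * (D * w n) ^+ 2) = 2 * e * D ^+ 2.
  have : 4 ^+ n * w n ^+ 2 = 1.
    rewrite /w -exprM mulnC exprM -exprMn.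
    have -> : 4 * 2^-1 ^+ 2 = 1 :> R by field.
    by rewrite expr1n.
  move: (4 ^+ n) (w n) => a b W.
  have -> : a * (2 * e * (D * b) ^+ 2) = 2 * e * D ^+ 2 * (a * b ^+ 2) by ring.
  by rewrite W mulr1.
have -> : 2 * e * D ^+ 2 = `|I 0%N (p 0%N)| * (D ^+ 2 / (2 * (1 + D ^+ 2))).
  by rewrite /e; field; lra.
apply/negP; rewrite -ltNge gtr_pMr// ltr_pdivrMr; last by lra.
by have := sqr_ge0 D; lra.
Qed.

End Goursat.

(** * Mean values over circles *)

Section CircleMean.
Context {R : realType}.
Notation mu := (@lebesgue_measure R).
Implicit Types (h f g phi : R[i] -> R[i]) (z w l : R[i]).

Lemma cder_diffP f z : (exists l, cder f z l) <->
  differentiable (f : R[i]^o -> R[i]^o) (z : R[i]^o).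
Proof.
split=> [[l /is_derive_cderP[df _]]|/derivable1_diffP/derivableP df].
  exact/derivable1_diffP.
by exists ('D_1 (f : R[i]^o -> R[i]^o) z); exact/is_derive_cderP.
Qed.

Lemma is_derive_real_bound (f : R -> R) (x l : R) : is_derive x 1 f l ->
  forall e : R, 0 < e -> exists2 d : R, 0 < d &
    forall s, `|s| < d -> `|f (x + s) - f x - l * s| <= e * `|s|.
Proof.
move=> /is_derive_cvgP/cvgrPdist_le df e e0.
have [_/posnumP[d] dP] := df e e0.
exists d%:num => // s sd.
have [->|s0] := eqVneq s 0; first by rewrite !(mulr0, addr0, subrr, normr0).
have /= := dP s; rewrite sub0r normrN => /(_ sd s0).
have n0 : 0 < `|s| by rewrite normr_gt0.
rewrite [_ *: 1]mulr1 (addrC s) -(ler_pM2r n0) -normrM.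
rewrite -normrN; congr (`|_| <= _).
by rewrite mulrBl [s^-1 *: _ * _]mulrAC mulVf// mul1r opprB.
Qed.

Lemma cisD (s t : R) : cis (s + t) = cis s * cis t.
Proof. by rewrite /cis cosD sinD; simpc; rewrite [sin s * cos t + _]addrC. Qed.

Lemma normc_cis (t : R) : normc (cis t) = 1.
Proof. by rewrite /= cos2Dsin2 sqrtr1. Qed.

Lemma cis_neq0 (t : R) : cis t != 0.
Proof. by rewrite -normc_gt0 normc_cis. Qed.

Lemma cis_conj (t : R) : cis t * conjc (cis t) = 1.
Proof.
apply/eqP; rewrite eq_complex /= !mulrN opprK -!expr2 cos2Dsin2 eqxx.
by rewrite mulrC addNr eqxx.
Qed.

(** It serves as logarithmic polar coordinates: the vertical segment of height 2 pi over [ln rho] is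
    wrapped around the circle of radius [rho]. *)
Definition cexp (w : R[i]) : R[i] := (expR (complex.Re w))%:C * cis (complex.Im w).

Lemma cexpD z w : cexp (z + w) = cexp z * cexp w.
Proof. by rewrite /cexp !raddfD/= expRD cisD rmorphM /= mulrACA. Qed.

Lemma normc_cexp z : normc (cexp z) = expR (complex.Re z).
Proof.
by rewrite normcM normc_real normc_cis mulr1 ger0_norm// expR_ge0.
Qed.

Lemma cexp_bound (e : R) : 0 < e -> exists2 d : R, 0 < d &
  forall h : R[i], normc h < d -> normc (cexp h - 1 - h) <= e * normc h.
Proof.
(* The real and imaginary parts of the remainder will cost 4 e' and 5 e' times the modulus of [h];
   the bound e' <= 1 keeps the real exponential below 3. *)
move=> e0; pose e' := Num.min (e / 9) 1.
have e'0 : 0 < e' by rewrite lt_min divr_gt0//=.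
have e'1 : e' <= 1 by rewrite ge_min lexx orbT.
have e'e : 9 * e' <= e.
  by rewrite mulrC -ler_pdivlMr// ge_min lexx.
clearbody e'.
have [d1 d10 H1] := is_derive_real_bound (is_derive_expR (0 : R)) e'0.
have [d2 d20 H2] := is_derive_real_bound (is_derive_cos (0 : R)) e'0.
have [d3 d30 H3] := is_derive_real_bound (is_derive_sin (0 : R)) e'0.
exists (Num.min (Num.min d1 d2) (Num.min d3 e')).
  by rewrite !lt_min d10 d20 d30.
move=> h; rewrite !lt_min => /andP[/andP[hd1 hd2] /andP[hd3 he]].
rewrite (le_trans (normc_le_Re_Im _))//.
have := Re_le_normc h; have := Im_le_normc h.
move: (normc h) hd1 hd2 hd3 he => N hd1 hd2 hd3 he.
case: h => s t /= tN sN.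
have := H1 _ (le_lt_trans sN hd1); have := H2 _ (le_lt_trans tN hd2).
have := H3 _ (le_lt_trans tN hd3).
rewrite !add0r sin0 cos0 expR0 oppr0 mul0r !subr0 addr0 !mul1r => Hs Hc He.
set E := expR s in He *.
have N0 : 0 <= N := le_trans (normr_ge0 _) tN.
have E0 : 0 < E by exact: expR_gt0.
have a1 : e' * `|s| <= e' * N by rewrite ler_pM2l.
have a2 : e' * `|t| <= e' * N by rewrite ler_pM2l.
have a3 : e' * N <= N by rewrite -[leRHS]mul1r ler_wpM2r.
have a4 : N * N <= e' * N by rewrite ler_wpM2r// ltW.
have E3 : E <= 3.
  have := ler_norm (E - 1 - s); have := ler_norm s; lra.
have E1 : `|E - 1| <= 2 * N.
  have -> : E - 1 = (E - 1 - s) + s by ring.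
  rewrite (le_trans (ler_normD _ _))//; lra.
have b1 : `|E * cos t - 1 - s| <= 4 * (e' * N).
  have -> : E * cos t - 1 - s = (E - 1 - s) + E * (cos t - 1) by ring.
  rewrite (le_trans (ler_normD _ _))// normrM (gtr0_norm E0).
  have : E * `|cos t - 1| <= 3 * (e' * N) by apply: ler_pM => //; [exact: ltW|lra].
  lra.
have b2 : `|E * sin t - t| <= 5 * (e' * N).
  have -> : E * sin t - t = E * (sin t - t) + (E - 1) * t by ring.
  rewrite (le_trans (ler_normD _ _))// !normrM (gtr0_norm E0).
  have : E * `|sin t - t| <= 3 * (e' * N) by apply: ler_pM => //; [exact: ltW|lra].
  have : `|E - 1| * `|t| <= 2 * N * N by apply: ler_pM.
  lra.
have : 9 * e' * N <= e * N by rewrite ler_wpM2r.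
rewrite ?(mulr0, mul0r, subr0, addr0, add0r) in b1 b2 *; lra.
Qed.

Lemma cexp_cder z : cder cexp z (cexp z).
Proof.
move=> e e0; have E0 : 0 < normc (cexp z) by rewrite normc_cexp expR_gt0.
have [d d0 hd] := cexp_bound (divr_gt0 e0 E0).
exists d => // h /hd H.
rewrite cexpD; have -> : cexp z * cexp h - cexp z - cexp z * h = cexp z * (cexp h - 1 - h) by ring.
by rewrite normcM mulrC -ler_pdivlMr// mulrAC.
Qed.

(* Goursat's lemma for [phi \o cexp] on the rectangle [ln r, ln rho] x [0, 2 pi],
   where the contributions of the two horizontal sides cancel by periodicity. *)
Lemma circle_int_eq phi (r rho : R) : 0 < r <= rho ->
  (forall z, r <= normc z <= rho -> exists l, cder phi z l) ->
  \int[mu]_(t in `[0, 2 * pi]) complex.Re (phi (r%:C * cis t)) =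
  \int[mu]_(t in `[0, 2 * pi]) complex.Re (phi (rho%:C * cis t)).
Proof.
move=> /andP[r0 rr] dphi.
have rho0 : 0 < rho := lt_le_trans r0 rr.
pose h w := phi (cexp w).
have H : holo_rect h (ln r) (ln rho) 0 (2 * pi).
  move=> s t /andP[s0 s1] _; apply/cder_diffP.
  apply: (@differentiable_comp _ R[i]^o R[i]^o R[i]^o cexp phi).
    by apply/cder_diffP; exists (cexp (s +i* t)); exact: cexp_cder.
  apply/cder_diffP/dphi; rewrite normc_cexp /=.
  by rewrite -[r]lnK ?posrE// -[rho]lnK ?posrE// !ler_expR s0.
have pi0 : 0 <= 2 * pi :> R by rewrite mulr_ge0// pi_ge0.
have lr : ln r <= ln rho by rewrite ler_ln.
have := goursat H lr pi0; rewrite /rectangle_int.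
have [c1 _] := @vertical_continuous _ _ _ _ _ _ (ln r) H (introT andP (conj (lexx _) lr)).
have [c2 _] := @vertical_continuous _ _ _ _ _ _ (ln rho) H (introT andP (conj lr (lexx _))).
rewrite (itv_RintegralB c2 c1).
under eq_Rintegral => s _.
  rewrite /h /cexp /= /cis cos0 sin0 [2 * pi]mulr_natl cos2pi sin2pi subrr.
  over.
rewrite Rintegral_cst// mul0r add0r => /eqP; rewrite subr_eq0 => /eqP E.
transitivity (\int[mu]_(x in `[0, 2 * pi]) complex.Re (h (ln r +i* x))).
  by apply: eq_Rintegral => t _; rewrite /h /cexp /= lnK.
rewrite -E; apply: eq_Rintegral => t _; rewrite /h /cexp /= lnK//.
Qed.

(** The circle integral does not depend on the radius, and on a tiny circle [phi] is close to [l].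
    Nothing is assumed at 0 but a limit, because the function it is meant for contains a term in
    1/z. *)
Lemma circle_mean phi (rho : R) l : 0 < rho ->
  (forall z, 0 < normc z <= rho -> exists l', cder phi z l') ->
  (forall e : R, 0 < e -> exists2 d : R, 0 < d &
     forall z, 0 < normc z < d -> normc (phi z - l) <= e) ->
  \int[mu]_(t in `[0, 2 * pi]) complex.Re (phi (rho%:C * cis t)) = 2 * pi * complex.Re l.
Proof.
move=> rho0 dphi phil.
have pi0 : 0 <= 2 * pi :> R by rewrite mulr_ge0// pi_ge0.
apply/eqP; rewrite -subr_eq0 -normr_le0; apply/ler_addgt0Pl => e e0.
have pi1 : 0 < 1 + 2 * pi :> R by lra.
have [d d0 hd] := phil _ (divr_gt0 e0 pi1).
pose r := Num.min (d / 2) rho.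
have r0 : 0 < r by rewrite lt_min rho0 divr_gt0.
have rd : r < d by rewrite gt_min ltr_pdivrMr// ltr_pMr// ltr1n.
have rrho : r <= rho by rewrite ge_min lexx orbT.
rewrite -(@circle_int_eq phi r rho) ?r0//; last first.
  by move=> z /andP[rz zr]; apply: dphi; rewrite (lt_le_trans r0 rz).
have nr t : normc (r%:C * cis t) = r.
  by rewrite normcM normc_real normc_cis mulr1 gtr0_norm.
have cst_c (c : R) : {within `[0, 2 * pi], continuous (fun _ : R => c)}.
  by apply: within_continuous => x; exact: cvg_cst.
have c1 : {within `[0, 2 * pi], continuous (fun t => complex.Re (phi (r%:C * cis t)))}.
  apply: itv_within_continuous => t _.
  have [l' dl'] : exists l', cder phi (r%:C * cis t) l' by apply: dphi; rewrite nr r0.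
  have [] // := cder_path_continuous (p := fun t => r%:C * cis t) dl'.
  - rewrite (_ : (fun _ => _) = (fun t => r * cos t)).
      by apply: cvgMl_tmp; exact: continuous_cos.
    by apply/funext => x; rewrite /cis /= mul0r subr0.
  - rewrite (_ : (fun _ => _) = (fun t => r * sin t)).
      by apply: cvgMl_tmp; exact: continuous_sin.
    by apply/funext => x; rewrite /cis /= mul0r addr0.
have -> : 2 * pi * complex.Re l = \int[mu]_(t in `[0, 2 * pi]) complex.Re l.
  rewrite Rintegral_cst//= lebesgue_measure_itv/= lte_fin.
  move: pi0; rewrite le_eqVlt => /predU1P[<-|->]; first by rewrite ltxx mulr0 mul0r.
  by rewrite /= subr0 mulrC.
rewrite -(itv_RintegralB c1 (cst_c _)) addr0.
apply: (@le_trans _ _ (e / (1 + 2 * pi) * (2 * pi - 0))).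
  apply: normr_Rintegral_le => //; first exact: itv_integrableB.
  move=> t _; rewrite -raddfB (le_trans (Re_le_normc _))// hd// nr r0 rd//.
by rewrite subr0 mulrAC ler_pdivrMr// ler_pM2l//; lra.
Qed.

End CircleMean.

(** * Algebraic operations on holomorphic functions *)

Section ComplexAlgebra.
Context {R : realType}.
Implicit Types (h f g phi : R[i] -> R[i]) (z w l : R[i]).

Definition holo f z := exists l, cder f z l.

Lemma holo_derivableP f z :
  holo f z <-> derivable (f : R[i]^o -> R[i]^o) (z : R[i]^o) 1.
Proof.
split=> [[l /is_derive_cderP[]]//|/derivableP df].
by eexists; exact/is_derive_cderP.
Qed.

Lemma holo_cst c z : holo (fun=> c) z.
Proof. by apply/holo_derivableP; exact: derivable_cst. Qed.

Lemma holo_id z : holo id z.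
Proof. by apply/holo_derivableP; exact: derivable_id. Qed.

Lemma holoD f g z : holo f z -> holo g z -> holo (fun w => f w + g w) z.
Proof.
by move=> /holo_derivableP df /holo_derivableP dg; apply/holo_derivableP; exact: derivableD.
Qed.

Lemma holoB f g z : holo f z -> holo g z -> holo (fun w => f w - g w) z.
Proof.
by move=> /holo_derivableP df /holo_derivableP dg; apply/holo_derivableP; exact: derivableB.
Qed.

Lemma holoM f g z : holo f z -> holo g z -> holo (fun w => f w * g w) z.
Proof.
by move=> /holo_derivableP df /holo_derivableP dg; apply/holo_derivableP; exact: (derivableM df dg).
Qed.

Lemma holoV f z : f z != 0 -> holo f z -> holo (fun w => (f w)^-1) z.
Proof.
by move=> f0 /holo_derivableP df; apply/holo_derivableP; exact: derivableV.
Qed.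

Lemma holo_sum (I : Type) (s : seq I) (F : I -> R[i] -> R[i]) z :
  (forall i, holo (F i) z) -> holo (fun w => \sum_(i <- s) F i w) z.
Proof.
move=> dF; elim: s => [|i s IH].
  by rewrite (_ : (fun _ => _) = fun=> 0); [exact: holo_cst|apply/funext => w; rewrite big_nil].
rewrite (_ : (fun _ => _) = fun w => F i w + \sum_(i <- s) F i w).
  exact: holoD.
by apply/funext => w; rewrite big_cons.
Qed.

Lemma circle_mean0 phi (rho : R) : 0 < rho ->
  (forall z, normc z <= rho -> holo phi z) ->
  \int[lebesgue_measure]_(t in `[0, 2 * pi]) complex.Re (phi (rho%:C * cis t))
  = 2 * pi * complex.Re (phi 0).
Proof.
move=> rho0 H; apply: circle_mean => //.
  by move=> z /andP[_]; exact: H.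
move=> e e0; have [l dl] : holo phi 0 by apply: H; rewrite Normc.normc0 ltW.
have [d d0 hd] := cder_continuous dl e0.
by exists d => // z /andP[_ /hd]; rewrite add0r.
Qed.

End ComplexAlgebra.

(** * Complex-valued integrals over real segments *)

Section Cintegral.
Context {R : realType}.
Notation mu := (@lebesgue_measure R).
Implicit Types (f g : R -> R[i]) (a b : R).

Definition cintegrable (A : set R) f :=
  mu.-integrable A (EFin \o (fun t => complex.Re (f t))) /\
  mu.-integrable A (EFin \o (fun t => complex.Im (f t))).

Lemma cintegrableB A f g : measurable A -> cintegrable A f -> cintegrable A g ->
  cintegrable A (fun t => f t - g t).
Proof.
move=> mA [f1 f2] [g1 g2]; split.
- rewrite (_ : _ \o _ = (fun t => (complex.Re (f t))%:E - (complex.Re (g t))%:E)%E).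
    exact: integrableB.
  by apply/funext => t /=; rewrite raddfB EFinB.
- rewrite (_ : _ \o _ = (fun t => (complex.Im (f t))%:E - (complex.Im (g t))%:E)%E).
    exact: integrableB.
  by apply/funext => t /=; rewrite raddfB EFinB.
Qed.

Lemma cintegralB A f g : measurable A -> cintegrable A f -> cintegrable A g ->
  cintegral A (fun t => f t - g t) = cintegral A f - cintegral A g.
Proof.
move=> mA [f1 f2] [g1 g2]; rewrite /cintegral; simpc; congr (_ +i* _).
- by rewrite -RintegralB//; apply: eq_Rintegral => t _; rewrite raddfB.
- by rewrite -RintegralB//; apply: eq_Rintegral => t _; rewrite raddfB.
Qed.

Lemma cintegrableZ A f (c : R[i]) : measurable A -> cintegrable A f ->
  cintegrable A (fun t => f t * c).
Proof.
move=> mA [f1 f2]; split.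
- rewrite (_ : _ \o _ = (fun t => (complex.Re c)%:E * (complex.Re (f t))%:E - (complex.Im c)%:E * (complex.Im (f t))%:E)%E).
    by apply: integrableB => //; exact: integrableZl.
  by apply/funext => t /=; rewrite -!EFinM -EFinB; case: (f t) c => p q [u v] /=; rewrite mulrC (mulrC q).
- rewrite (_ : _ \o _ = (fun t => (complex.Re c)%:E * (complex.Im (f t))%:E + (complex.Im c)%:E * (complex.Re (f t))%:E)%E).
    by apply: integrableD => //; exact: integrableZl.
  by apply/funext => t /=; rewrite -!EFinM -EFinD; case: (f t) c => p q [u v] /=; rewrite addrC mulrC (mulrC p).
Qed.

Lemma cintegralZ A f (c : R[i]) : measurable A -> cintegrable A f ->
  cintegral A (fun t => f t * c) = cintegral A f * c.
Proof.
move=> mA [f1 f2]; rewrite /cintegral; case: c => u v; simpc; congr (_ +i* _).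
- rewrite -!RintegralZr// -RintegralB//.
  + by apply: eq_Rintegral => t _; case: (f t).
  + by rewrite /comp; under eq_fun do rewrite EFinM; exact: integrableZr.
  + by rewrite /comp; under eq_fun do rewrite EFinM; exact: integrableZr.
- rewrite -!RintegralZr// -RintegralD//.
  + by apply: eq_Rintegral => t _; case: (f t).
  + by rewrite /comp; under eq_fun do rewrite EFinM; exact: integrableZr.
  + by rewrite /comp; under eq_fun do rewrite EFinM; exact: integrableZr.
Qed.

Lemma eq_cintegral A f g : (forall t, A t -> f t = g t) ->
  cintegral A f = cintegral A g.
Proof.
move=> fg; rewrite /cintegral; congr (_ +i* _);
  by apply: eq_Rintegral => t /[!inE] At; rewrite fg.
Qed.

(** The two parts are bounded separately; the lost factor 2 is harmless, since the bound only has to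
    show that an error term is quadratic. *)
Lemma normc_cintegral_le f a b (C : R) : a <= b -> cintegrable `[a, b] f ->
  (forall t, a <= t <= b -> normc (f t) <= C) ->
  normc (cintegral `[a, b] f) <= 2 * C * (b - a).
Proof.
move=> ab [f1 f2] fC; rewrite (le_trans (normc_le_Re_Im _))//=.
have -> : 2 * C * (b - a) = C * (b - a) + C * (b - a) by ring.
by apply: lerD; apply: normr_Rintegral_le => // t /fC; apply: le_trans;
  [exact: Re_le_normc|exact: Im_le_normc].
Qed.

(** Continuity of [u] would be too much to ask: the boundary values of f_0 are discontinuous. *)
Lemma integrable_mul_bounded (f u : R -> R) a b :
  {within `[a, b], continuous f} -> measurable_fun setT u ->
  (forall t, `|u t| <= 1) -> mu.-integrable `[a, b] (EFin \o (fun t => f t * u t)).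
Proof.
move=> cf mu_ u1; apply: le_integrable (itv_integrable cf) => //.
  apply/measurable_EFinP; apply: measurable_funM.
    by apply/measurable_EFinP; case/integrableP : (itv_integrable cf).
  exact: measurable_funTS.
move=> t _ /=; rewrite lee_fin normrM -[leRHS]mulr1 ler_wpM2l//.
Qed.

End Cintegral.

(** * The Schwarz integral and the extremal map *)

Section SchwarzIntegral.
Context {R : realType}.
Notation mu := (@lebesgue_measure R).
Variable u : R -> R.
Hypothesis mu_u : measurable_fun setT u.
Hypothesis u1 : forall t, `|u t| <= 1.

Definition schwarz (lambda : R[i]) := cintegral `[0, 2 * pi] (fun t =>
  (cis t + lambda) / (cis t - lambda) * (u t)%:C).

(** The kernel of [schwarz], differentiated in [lambda] under the integral sign. Neither integral
    carries the factor 1/(2 pi). *)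
Definition dschwarz (lambda : R[i]) := cintegral `[0, 2 * pi] (fun t =>
  2 * cis t / (cis t - lambda) ^+ 2 * (u t)%:C).

Lemma circle_continuous (h : R[i] -> R[i]) (t : R) : holo h (cis t) ->
  {for t, continuous (fun t => complex.Re (h (cis t)))} /\
  {for t, continuous (fun t => complex.Im (h (cis t)))}.
Proof.
move=> [l dl]; have [] // := cder_path_continuous (p := cis) dl.
- exact: continuous_cos.
- exact: continuous_sin.
Qed.

Lemma circle_cintegrable (h : R[i] -> R[i]) : (forall t, holo h (cis t)) ->
  cintegrable `[0, 2 * pi] (fun t => h (cis t) * (u t)%:C).
Proof.
move=> dh; split.
- rewrite (_ : _ \o _ = EFin \o (fun t => complex.Re (h (cis t)) * u t)).
    apply: integrable_mul_bounded => //; apply: itv_within_continuous => t _.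
    by case: (circle_continuous (dh t)).
  by apply/funext => t /=; case: (h _) => p q /=; rewrite mulr0 subr0.
- rewrite (_ : _ \o _ = EFin \o (fun t => complex.Im (h (cis t)) * u t)).
    apply: integrable_mul_bounded => //; apply: itv_within_continuous => t _.
    by case: (circle_continuous (dh t)).
  by apply/funext => t /=; case: (h _) => p q /=; rewrite mulr0 add0r.
Qed.

Lemma cis_sub_ge (lambda : R[i]) (t : R) : 1 - normc lambda <= normc (cis t - lambda).
Proof.
by rewrite lerBlDr -(normc_cis t) (le_trans _ (normcD _ _))// subrK.
Qed.

Lemma cis_sub_neq0 (lambda : R[i]) (t : R) : normc lambda < 1 -> cis t - lambda != 0.
Proof. by move=> l1; rewrite -normc_gt0 (lt_le_trans _ (cis_sub_ge _ _))// subr_gt0. Qed.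

Lemma schwarz_kernel_holo (lambda : R[i]) (t : R) : normc lambda < 1 ->
  holo (fun z => (z + lambda) / (z - lambda)) (cis t).
Proof.
move=> l1; apply: holoM; first by apply: holoD; [exact: holo_id|exact: holo_cst].
apply: holoV; first exact: cis_sub_neq0.
by apply: holoB; [exact: holo_id|exact: holo_cst].
Qed.

Lemma dschwarz_kernel_holo (lambda : R[i]) (t : R) : normc lambda < 1 ->
  holo (fun z => 2 * z / (z - lambda) ^+ 2) (cis t).
Proof.
move=> l1; apply: holoM; first by apply: holoM; [exact: holo_cst|exact: holo_id].
apply: holoV; first by rewrite expf_neq0//; exact: cis_sub_neq0.
by apply: holoM; apply: holoB; solve [exact: holo_id|exact: holo_cst].
Qed.

(** With c = e^(it), the first-order remainder of the kernel is exactly 2 c h^2 / ((c - lambda)^2 (c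
    - lambda - h)), which is quadratic in h uniformly in t. *)
Lemma schwarz_cder lambda : normc lambda < 1 ->
  cder schwarz lambda (dschwarz lambda).
Proof.
move=> l1 e e0; set d := 1 - normc lambda.
have d0 : 0 < d by rewrite subr_gt0.
have pi0 : 0 < pi :> R := pi_gt0 R.
(* The remainder of the kernel is at most 4 |h|^2 / d^3 once |h| < d / 2; the interval contributes 2
   pi and [normc_cintegral_le] a factor 2. *)
pose B := 16 * pi / d ^+ 3.
have B0 : 0 < B by rewrite divr_gt0 ?mulr_gt0 ?exprn_gt0.
exists (Num.min (d / 2) (e / B)); first by rewrite lt_min (divr_gt0 e0 B0) divr_gt0.
move=> h; rewrite lt_min => /andP[hd he].
have lh1 : normc (lambda + h) < 1 by rewrite (le_lt_trans (normcD _ _))//; move: hd d0; rewrite /d; lra.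
have k1 := circle_cintegrable (fun t => schwarz_kernel_holo t l1).
have k2 := circle_cintegrable (fun t => schwarz_kernel_holo t lh1).
have k3 := cintegrableZ h (measurable_itv _) (circle_cintegrable (fun t => dschwarz_kernel_holo t l1)).
have k21 := cintegrableB (measurable_itv _) k2 k1.
rewrite /schwarz /dschwarz -cintegralZ//; last exact: circle_cintegrable (fun t => dschwarz_kernel_holo t l1).
rewrite -cintegralB// -cintegralB//.
apply: (@le_trans _ _ (2 * (4 * normc h ^+ 2 / d ^+ 3) * (2 * pi - 0))); last first.
  have -> : 2 * (4 * normc h ^+ 2 / d ^+ 3) * (2 * pi - 0) = (normc h * B) * normc h.
    by rewrite /B; ring.
  by rewrite ler_wpM2r ?normc_ge0// -ler_pdivlMr// ltW.
apply: normc_cintegral_le; [by rewrite mulr_ge0// ltW|exact: cintegrableB|].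
move=> t _.
have a0 := cis_sub_neq0 t l1; have b0 := cis_sub_neq0 t lh1.
have -> : (cis t + (lambda + h)) / (cis t - (lambda + h)) * (u t)%:C -
   (cis t + lambda) / (cis t - lambda) * (u t)%:C -
   2 * cis t / (cis t - lambda) ^+ 2 * (u t)%:C * h =
   2 * cis t * h ^+ 2 / ((cis t - lambda) ^+ 2 * (cis t - (lambda + h))) * (u t)%:C.
  by field; rewrite ?a0 ?b0.
rewrite normcM normcM normcV !normcM normc_real normc_cis mulr1.
have -> : normc (2 : R[i]) = 2 by rewrite -[2 in LHS](rmorph_nat (real_complex R)) normc_real ger0_norm.
have A : d <= normc (cis t - lambda) by exact: cis_sub_ge.
have Bb : d / 2 <= normc (cis t - (lambda + h)).
  apply: le_trans (cis_sub_ge _ _).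
  by have := normcD lambda h; rewrite /d in hd *; lra.
apply: (@le_trans _ _ (2 * (normc h * normc h) / (normc (cis t - lambda) * normc (cis t - lambda) * normc (cis t - (lambda + h))))).
  by rewrite -[leRHS]mulr1 ler_wpM2l// mulr_ge0 ?invr_ge0 ?mulr_ge0 ?normc_ge0.
have -> : 4 * normc h ^+ 2 / d ^+ 3 = 2 * (normc h * normc h) / (d * d * (d / 2)).
  by field; rewrite gt_eqF.
rewrite ler_wpM2l// ?mulr_ge0 ?normc_ge0//.
rewrite lef_pV2 ?posrE; last 2 first.
- by rewrite !mulr_gt0 ?normc_gt0.
- by rewrite !mulr_gt0.
by rewrite !ler_pM// ?mulr_ge0// ltW.
Qed.

End SchwarzIntegral.

(** * The Poisson kernel and averages of vectors of the unit disc *)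

Section Poisson.
Context {R : realType}.
Notation mu := (@lebesgue_measure R).

Definition poisson (lambda : R[i]) (t : R) : R :=
  complex.Re ((cis t + lambda) / (cis t - lambda)).

Lemma poissonE lambda t : poisson lambda t =
  (1 - normc lambda ^+ 2) / normc (cis t - lambda) ^+ 2.
Proof.
have := cos2Dsin2 t; rewrite /poisson /cis; case: lambda => a b.
simpc => /=; rewrite !sqr_sqrtr ?addr_ge0 ?sqr_ge0// => E.
rewrite !mulrA -!mulrDl -?mulrBl; congr (_ / _).
by rewrite -E; ring.
Qed.

Lemma poisson_ge0 lambda t : normc lambda < 1 -> 0 <= poisson lambda t.
Proof.
move=> l1; rewrite poissonE divr_ge0 ?sqr_ge0// subr_ge0.
by rewrite expr_le1// ?normc_ge0// ltW.
Qed.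

Lemma poisson_continuous lambda : normc lambda < 1 -> continuous (poisson lambda).
Proof.
move=> l1 t; exact: (circle_continuous (schwarz_kernel_holo t l1)).1.
Qed.

(** On the unit circle the Schwarz kernel is the conjugate of [phi], which is holomorphic on the
    closed disc and equals 1 at 0; the mean value property applies to [phi]. *)
Lemma poisson_mean lambda : normc lambda < 1 ->
  \int[mu]_(t in `[0, 2 * pi]) poisson lambda t = 2 * pi.
Proof.
move=> l1; pose phi z := (1 + conjc lambda * z) / (1 - conjc lambda * z).
have nJ : normc (conjc lambda) = normc lambda.
  by case: (lambda) => a b /=; rewrite sqrrN.
have := @circle_mean0 R phi 1 ltr01.
rewrite {3}/phi !mulr0 addr0 subr0 divr1 mulr1 => H.
transitivity (\int[mu]_(t in `[0, 2 * pi]) complex.Re (phi (1%:C * cis t))).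
  apply: eq_Rintegral => t _; rewrite mul1r /poisson /phi.
  have -> : (1 + conjc lambda * cis t) / (1 - conjc lambda * cis t) =
     conjc ((cis t + lambda) / (cis t - lambda)).
    have cc := cis_conj t.
    have c0 := cis_neq0 t.
    have b0 := cis_sub_neq0 t l1.
    rewrite rmorphM fmorphV rmorphD rmorphB /=.
    have -> : 1 + conjc lambda * cis t = cis t * (conjc (cis t) + conjc lambda).
      by rewrite mulrDr cc mulrC.
    have -> : 1 - conjc lambda * cis t = cis t * (conjc (cis t) - conjc lambda).
      by rewrite mulrBr cc mulrC.
    by rewrite invfM mulrACA divff// mul1r.
  by case: (_ / _).
apply: H => z z1; have n0 : 1 - conjc lambda * z != 0.
  rewrite subr_eq0; apply/eqP => /(congr1 (@Normc.normc R)).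
  rewrite Normc.normc1 normcM nJ => E.
  have : normc lambda * normc z < 1.
    by rewrite (le_lt_trans _ l1)// -[leRHS]mulr1 ler_wpM2l// normc_ge0.
  by rewrite -E ltxx.
have H : holo (fun z => conjc lambda * z) z by apply: holoM; [exact: holo_cst|exact: holo_id].
by apply: holoM; [apply: holoD => //; exact: holo_cst|apply: holoV => //; apply: holoB => //; exact: holo_cst].
Qed.

Lemma Re_schwarz (u : R -> R) lambda : complex.Re (schwarz u lambda) =
  \int[mu]_(t in `[0, 2 * pi]) (poisson lambda t * u t).
Proof.
rewrite /schwarz /cintegral /=; apply: eq_Rintegral => t _.
by rewrite /poisson; case: (_ / _) => a b /=; rewrite mulr0 subr0.
Qed.

(** Duality: if (a, b) is the pair of real parts, then a^2 + b^2 is the Poisson integral of <(u, v),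
    (a, b)>, hence at most 2 pi |(a, b)|. The radius is 2 pi because [schwarz] is not normalised. *)
Lemma schwarz_unit_disc (u v : R -> R) (lambda : R[i]) :
  measurable_fun setT u -> measurable_fun setT v ->
  (forall t, u t ^+ 2 + v t ^+ 2 <= 1) -> normc lambda < 1 ->
  complex.Re (schwarz u lambda) ^+ 2 + complex.Re (schwarz v lambda) ^+ 2 <= (2 * pi) ^+ 2.
Proof.
move=> mu_u mu_v uv l1; rewrite !Re_schwarz.
have u1 t : `|u t| <= 1.
  by rewrite -(@expr_le1 _ 2)// real_normK ?num_real//; have := uv t; have := sqr_ge0 (v t); lra.
have v1 t : `|v t| <= 1.
  by rewrite -(@expr_le1 _ 2)// real_normK ?num_real//; have := uv t; have := sqr_ge0 (u t); lra.
set a := (X in X ^+ 2 + _); set b := (X in _ + X ^+ 2).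
set s := Num.sqrt (a ^+ 2 + b ^+ 2).
have s2 : s ^+ 2 = a ^+ 2 + b ^+ 2 by rewrite sqr_sqrtr// addr_ge0// sqr_ge0.
have s0 : 0 <= s by exact: sqrtr_ge0.
have pi0 : 0 < pi :> R := pi_gt0 R.
have cP : {within `[0, 2 * pi], continuous (poisson lambda)}.
  by apply: within_continuous; exact: poisson_continuous.
have iu := integrable_mul_bounded cP mu_u u1.
have iv := integrable_mul_bounded cP mu_v v1.
have ZM (c : R) (w : R -> R) : mu.-integrable `[0, 2 * pi] (EFin \o w) ->
    mu.-integrable `[0, 2 * pi] (EFin \o (fun t => w t * c)).
  move=> iw; rewrite (_ : _ \o _ = (fun t => (w t)%:E * c%:E)%E)//; exact: integrableZr.
have E : a * a + b * b <= s * (2 * pi).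
  rewrite -(poisson_mean l1) {2}/a {2}/b -RintegralZl// -RintegralZl// -RintegralZl//; last exact: itv_integrable.
  have ia := ZM a _ iu; have ib := ZM b _ iv.
  have is_ := ZM s _ (itv_integrable cP).
  under [X in X + _ <= _]eq_Rintegral do rewrite mulrC.
  under [X in _ + X <= _]eq_Rintegral do rewrite mulrC.
  under [X in _ <= X]eq_Rintegral do rewrite mulrC.
  rewrite -RintegralD//; apply: le_Rintegral => //.
    by apply: integrableD ia ib.
  move=> t _; rewrite -!mulrA -mulrDr ler_wpM2l ?poisson_ge0//.
  rewrite (le_trans (ler_norm _))// -(@ler_sqr _ `|_|) ?nnegrE// real_normK ?num_real// s2.
  have : (u t * a + v t * b) ^+ 2 = (u t ^+ 2 + v t ^+ 2) * (a ^+ 2 + b ^+ 2) - (u t * b - v t * a) ^+ 2 by ring.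
  move=> ->; rewrite lerBlDr -[leLHS]mul1r.
  apply: (@le_trans _ _ (1 * (a ^+ 2 + b ^+ 2))); last by rewrite mul1r lerDl sqr_ge0.
  by rewrite !mul1r ler_piMl// addr_ge0// sqr_ge0.
rewrite -s2; have [->|sn0] := eqVneq s 0; first by rewrite expr0n sqr_ge0.
have {}s0 : 0 < s by rewrite lt_neqAle eq_sym sn0.
rewrite ler_sqr ?nnegrE ?(ltW s0)//; last by rewrite mulr_ge0// ltW.
by rewrite -(ler_pM2l s0) -expr2 s2 !expr2.
Qed.

End Poisson.

(** * The extremal map and its derivative at 0 *)

Section ExtremalMap.
Context {R : realType}.
Notation mu := (@lebesgue_measure R).
Implicit Types (theta t : R).

(** This is |N(t)|, where N runs over the ellipse with semi-axes cos theta and sin theta. *)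
Definition ellipse_norm theta t : R :=
  Num.sqrt ((cos theta * cos t) ^+ 2 + (sin theta * sin t) ^+ 2).

Definition ext_dir theta (j : 'I_2) t : R :=
  re_vec (cis t *: dir theta) 0 j / enorm (re_vec (cis t *: dir theta)).

Lemma fextE theta lambda (j : 'I_2) : fext theta lambda 0 j =
  ((2 * pi)^-1)%:C * schwarz (ext_dir theta j) lambda.
Proof. by rewrite mxE. Qed.

Lemma re_vec_cis_dir theta t (j : 'I_2) : re_vec (cis t *: dir theta) 0 j =
  if j == 0 then cos theta * cos t else - (sin theta * sin t).
Proof.
rewrite !mxE; case: ifP => _ /=.
  by rewrite mulr0 subr0 mulrC.
ring.
Qed.

Lemma enorm_cis_dir theta t : enorm (re_vec (cis t *: dir theta)) = ellipse_norm theta t.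
Proof.
rewrite /enorm /dot !big_ord_recl big_ord0 !re_vec_cis_dir /= addr0.
by rewrite mulrNN -!expr2.
Qed.

Lemma ext_dirE theta (j : 'I_2) t : ext_dir theta j t =
  (if j == 0 then cos theta * cos t else - (sin theta * sin t)) / ellipse_norm theta t.
Proof. by rewrite /ext_dir re_vec_cis_dir enorm_cis_dir. Qed.

Lemma ellipse_norm_sqr theta t :
  ellipse_norm theta t ^+ 2 = (cos theta * cos t) ^+ 2 + (sin theta * sin t) ^+ 2.
Proof. by rewrite sqr_sqrtr// addr_ge0// sqr_ge0. Qed.

Lemma ext_dir_le1 theta t : ext_dir theta 0 t ^+ 2 + ext_dir theta 1 t ^+ 2 <= 1.
Proof.
rewrite !ext_dirE /= !expr_div_n sqrrN -mulrDl -ellipse_norm_sqr.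
(* Where the norm vanishes both components take the default value 0; elsewhere the sum of squares is
   exactly 1. *)
have [->|n0] := eqVneq (ellipse_norm theta t) 0.
  by rewrite expr0n mul0r.
by rewrite divff// expf_neq0.
Qed.

Lemma ellipse_norm_gt0 theta t : 0 < sin theta -> 0 < cos theta ->
  0 < ellipse_norm theta t.
Proof.
move=> s0 c0; rewrite sqrtr_gt0 !exprMn.
have := sqr_ge0 (cos t); have := cos2Dsin2 t; have := sqr_ge0 (sin t).
have : 0 < sin theta ^+ 2 by rewrite exprn_gt0.
have : 0 < cos theta ^+ 2 by rewrite exprn_gt0.
set a := cos theta ^+ 2; set b := sin theta ^+ 2.
set c := cos t ^+ 2; set d := sin t ^+ 2 => a0 b0 d0 cd c1.
have [d00|dn0] := eqVneq d 0.
  have -> : c = 1 by lra.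
  by rewrite d00; lra.
have : 0 < b * d by rewrite mulr_gt0// lt_neqAle eq_sym dn0.
by have := mulr_ge0 (ltW a0) c1; lra.
Qed.

Lemma ellipse_norm_continuous theta : continuous (ellipse_norm theta).
Proof.
move=> t; apply: (@continuous_comp _ _ _ (fun t => (cos theta * cos t) ^+ 2 + (sin theta * sin t) ^+ 2) (@Num.sqrt R)).
  apply: cvgD; apply: cvgM; apply: cvgMl_tmp; try exact: continuous_cos; exact: continuous_sin.
exact: sqrt_continuous.
Qed.

Lemma ellipse_norm0 t : ellipse_norm 0 t = `|cos t|.
Proof. by rewrite /ellipse_norm cos0 sin0 mul1r mul0r expr0n addr0 sqrtr_sqr. Qed.

Lemma ellipse_ratio_continuous theta (f : R -> R) : 0 < sin theta -> 0 < cos theta ->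
  continuous f -> continuous (fun t => f t / ellipse_norm theta t).
Proof.
move=> s0 c0 cf t; apply: cvgM; first exact: cf.
by apply: cvgV; [rewrite gt_eqF// ellipse_norm_gt0|exact: ellipse_norm_continuous].
Qed.

Lemma quarter_trig theta : 0 < theta <= pi / 4 -> 0 < sin theta /\ 0 < cos theta.
Proof.
have pi0 := pi_gt0 R; move=> /andP[t0 t1]; split.
  by apply: sin_gt0_pihalf; apply/andP; split; lra.
by apply: cos_gt0_pihalf; apply/andP; split; lra.
Qed.

(** For theta > 0 the norm has no zero and the function is continuous. At theta = 0 it is the sign
    of cos or the constant 0. *)
Lemma ext_dir_measurable theta (j : 'I_2) : 0 <= theta <= pi / 4 ->
  measurable_fun setT (ext_dir theta j).
Proof.
move=> /andP[]; rewrite le_eqVlt => /predU1P[<- _|t0 t1].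
- rewrite (_ : ext_dir 0 j = fun t => if j == 0 then (if 0 < cos t then 1 else if cos t < 0 then -1 else 0) else 0).
    case: (j == 0); last exact: measurable_cst.
    apply: measurable_fun_ifT => //.
      apply: measurable_fun_ltr => //; apply: continuous_measurable_fun; exact: continuous_cos.
    apply: measurable_fun_ifT => //.
    apply: measurable_fun_ltr => //; apply: continuous_measurable_fun; exact: continuous_cos.
  apply/funext => t; rewrite ext_dirE ellipse_norm0 cos0 sin0 mul1r mul0r oppr0.
  case: ifP => _; last by rewrite mul0r.
  have [c0|c0|<-] := ltgtP 0 (cos t).
  + by rewrite ger0_norm ?ltW// divff// gt_eqF.
  + by rewrite ler0_norm ?ltW// invrN mulrN divff// lt_eqF.
  + by rewrite mul0r.
- have [s0 c0] := quarter_trig (introT andP (conj t0 t1)).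
  rewrite (_ : ext_dir theta j = (fun t => (if j == 0 then cos theta * cos t else - (sin theta * sin t)) / ellipse_norm theta t)); last first.
    by apply/funext => t; rewrite ext_dirE.
  apply: continuous_measurable_fun; apply: ellipse_ratio_continuous => //.
  case: (j == 0) => t.
    by apply: cvgMl_tmp; exact: continuous_cos.
  by apply: cvgN; apply: cvgMl_tmp; exact: continuous_sin.
Qed.

Lemma ord2_cases (j : 'I_2) : j = 0 \/ j = 1.
Proof. by case: j => -[|[|//]] ji; [left|right]; exact/val_inj. Qed.

Lemma ext_dir_norm_le1 theta (j : 'I_2) t : `|ext_dir theta j t| <= 1.
Proof.
rewrite -(@expr_le1 _ 2)// real_normK ?num_real//.
have := ext_dir_le1 theta t.
have := sqr_ge0 (ext_dir theta 0 t); have := sqr_ge0 (ext_dir theta 1 t).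
by case: (ord2_cases j) => ->; lra.
Qed.

(** At lambda = 0 the differentiated kernel is 2 e^(-it). *)
Lemma dschwarz0 (u : R -> R) :
  dschwarz u 0 = (\int[mu]_(t in `[0, 2 * pi]) (2 * cos t * u t)) +i*
                 (\int[mu]_(t in `[0, 2 * pi]) (- (2 * sin t * u t))).
Proof.
rewrite /dschwarz /cintegral.
have E t : 2 * cis t / (cis t - 0) ^+ 2 * (u t)%:C = (2 * cos t * u t) -i* (2 * sin t * u t).
  have -> : 2 * cis t / (cis t - 0) ^+ 2 = 2 * conjc (cis t).
    have c0 := cis_neq0 t.
    have cc := cis_conj t.
    by rewrite subr0 expr2 invfM mulrA mulfK// -[conjc _]mul1r -(mulVf c0) -mulrA cc mulr1.
  rewrite -[2](rmorph_nat (real_complex R)) /cis; simpc; congr (_ +i* _); ring.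
by congr (_ +i* _); apply: eq_Rintegral => t _; rewrite E.
Qed.

(* The nonzero real and imaginary parts of the components of [f_theta'(0)]. *)
Definition ext_re theta : R :=
  pi^-1 * \int[mu]_(t in `[0, 2 * pi]) (cos theta * cos t ^+ 2 / ellipse_norm theta t).
Definition ext_im theta : R :=
  pi^-1 * \int[mu]_(t in `[0, 2 * pi]) (sin theta * sin t ^+ 2 / ellipse_norm theta t).

Lemma odd_circle_int0 (f : R -> R) : continuous f -> (forall t, f (2 * pi - t) = - f t) ->
  \int[mu]_(t in `[0, 2 * pi]) f t = 0.
Proof.
move=> cf fodd.
have pi0 : 0 <= 2 * pi :> R by rewrite mulr_ge0// pi_ge0.
have := Rintegral_reflect pi0 (within_continuous cf).
under eq_Rintegral do rewrite add0r fodd.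
under eq_Rintegral do rewrite -mulN1r.
rewrite RintegralZl//; last by apply: itv_integrable; exact: within_continuous.
lra.
Qed.

(** Agreement on the open interval is all that can be had when [f] involves the sign of cos, which
    takes the default value 0 at the zeros of cos. *)
Lemma eq_Rintegral_oo (f g : R -> R) (a b : R) : {within `[a, b], continuous g} ->
  mu.-integrable `[a, b] (EFin \o f) ->
  (forall x, a < x < b -> f x = g x) ->
  \int[mu]_(x in `[a, b]) f x = \int[mu]_(x in `[a, b]) g x.
Proof.
move=> cg intf fg.
have H (h : R -> R) : mu.-integrable `[a, b] (EFin \o h) ->
    \int[mu]_(x in `[a, b]) h x = \int[mu]_(x in `]a, b[) h x.
  move=> ih; rewrite -Rintegral_itv_obnd_cbnd; last first.
    by apply: integrableS ih => //; apply: subset_itvr; rewrite bnd_simp.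
  rewrite -Rintegral_itv_bndo_bndc//.
  by apply: integrableS ih => //; exact: subset_itv_oo_cc.
rewrite !H//; last exact: itv_integrable.
by apply: eq_Rintegral => x; rewrite inE/= in_itv/=; exact: fg.
Qed.

(** The weight is the sign of cos: 1, -1, 1 on the three arcs cut off by pi/2 and 3 pi/2. *)
Lemma Rintegral_ext_dir0 (w : R -> R) : continuous w ->
  \int[mu]_(t in `[0, 2 * pi]) (w t * ext_dir 0 0 t) =
  \int[mu]_(t in `[0, pi / 2]) w t - \int[mu]_(t in `[pi / 2, pi / 2 + pi]) w t
  + \int[mu]_(t in `[pi / 2 + pi, 2 * pi]) w t.
Proof.
move=> cw; have pi0 := pi_gt0 R.
have m0 : measurable_fun setT (ext_dir 0 0) by apply: ext_dir_measurable; rewrite lexx/= divr_ge0// ltW.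
have cwA (A : set R) : {within A, continuous w} by exact: within_continuous.
have cwN (A : set R) : {within A, continuous (fun t => - w t)}.
  by apply: within_continuous => t; apply: cvgN; exact: cw.
have I a b : mu.-integrable `[a, b] (EFin \o (fun t => w t * ext_dir 0 0 t)).
  by apply: integrable_mul_bounded => // t; exact: ext_dir_norm_le1.
have E t : ext_dir 0 0 t = cos t / `|cos t|.
  by rewrite ext_dirE /= ellipse_norm0 cos0 mul1r.
have P t : 0 < cos t -> w t * ext_dir 0 0 t = w t.
  by move=> c0; rewrite E ger0_norm ?ltW// divff ?mulr1// gt_eqF.
have M t : cos t < 0 -> w t * ext_dir 0 0 t = - w t.
  by move=> c0; rewrite E ler0_norm ?ltW// invrN mulrN divff ?mulrN1// lt_eqF.
rewrite (@Rintegral_split _ _ 0 (pi / 2) (2 * pi))//; last by apply/andP; split; lra.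
rewrite (@Rintegral_split _ _ (pi / 2) (pi / 2 + pi) (2 * pi))//; last by apply/andP; split; lra.
rewrite (@eq_Rintegral_oo _ w 0)//; last first.
  by move=> x /andP[x0 x1]; apply: P; apply: cos_gt0_pihalf; apply/andP; split; lra.
rewrite (@eq_Rintegral_oo _ (fun t => - w t) (pi / 2))//; last first.
  move=> x /andP[x0 x1]; apply: M; rewrite -(subrK pi x) cosDpi oppr_lt0.
  by apply: cos_gt0_pihalf; apply/andP; split; lra.
rewrite (@eq_Rintegral_oo _ w (pi / 2 + pi))//; last first.
  move=> x /andP[x0 x1]; apply: P; rewrite -(subrK (pi *+ 2) x) cosD2pi.
  by apply: cos_gt0_pihalf; rewrite -[pi *+ 2]mulr_natl; apply/andP; split; lra.
have -> : \int[mu]_(x in `[pi / 2, pi / 2 + pi]) - w x = - \int[mu]_(x in `[pi / 2, pi / 2 + pi]) w x.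
  by rewrite -mulN1r -RintegralZl//; [under [RHS]eq_Rintegral do rewrite mulN1r|exact: itv_integrable].
by rewrite addrA.
Qed.

Lemma sgn_cos_sin_int0 : \int[mu]_(t in `[0, 2 * pi]) (sin t * ext_dir 0 0 t) = 0.
Proof.
have pi0 := pi_gt0 R.
have csin (A : set R) : {within A, continuous (@sin R)} by apply: within_continuous; exact: continuous_sin.
have dcN (t : R) : is_derive t 1 (fun t => - cos t : R) (sin t).
  by apply: is_derive_eq; rewrite opprK.
rewrite Rintegral_ext_dir0; last exact: continuous_sin.
rewrite (@Rintegral_FTC _ (fun t => - cos t))//; last by lra.
rewrite (@Rintegral_FTC _ (fun t => - cos t))//; last by lra.
rewrite (@Rintegral_FTC _ (fun t => - cos t))//; last by lra.
rewrite [2 * pi]mulr_natl cos2pi cosDpi cos_pihalf cos0; lra.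
Qed.

Lemma itv_Rintegral_cst (a b c : R) : a <= b -> \int[mu]_(x in `[a, b]) c = c * (b - a).
Proof.
move=> ab; rewrite Rintegral_cst//= lebesgue_measure_itv/= lte_fin.
by move: ab; rewrite le_eqVlt => /predU1P[->|->//]; rewrite ltxx subrr.
Qed.

Lemma sgn_cos_int0 : \int[mu]_(t in `[0, 2 * pi]) ext_dir 0 0 t = 0.
Proof.
have pi0 := pi_gt0 R.
have := @Rintegral_ext_dir0 (fun=> 1) (fun x => cvg_cst _).
under eq_Rintegral do rewrite mul1r.
by move=> ->; rewrite !itv_Rintegral_cst; lra.
Qed.

Lemma cderZ (c : R[i]) f z l : cder f z l -> cder (fun w => c * f w) z (c * l).
Proof.
move=> df e e0.
have c0 : 0 < 1 + normc c by rewrite ltr_wpDr// normc_ge0.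
have [d d0 hd] := df _ (divr_gt0 e0 c0); exists d => // h /hd H.
rewrite -mulrBr -mulrA -mulrBr normcM.
apply: le_trans (ler_wpM2l (normc_ge0 c) H) _.
have -> : normc c * (e / (1 + normc c) * normc h) = (normc c / (1 + normc c)) * (e * normc h) by ring.
by rewrite ler_piMl ?mulr_ge0 ?normc_ge0 ?(ltW e0)// ler_pdivrMr// mul1r lerDr.
Qed.

Lemma cos_2piB t : cos (2 * pi - t) = cos t.
Proof. by rewrite addrC [2 * pi]mulr_natl cosD2pi cosN. Qed.

Lemma sin_2piB t : sin (2 * pi - t) = - sin t.
Proof. by rewrite addrC [2 * pi]mulr_natl sinD2pi sinN. Qed.

Lemma ellipse_norm_refl theta t : ellipse_norm theta (2 * pi - t) = ellipse_norm theta t.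
Proof.
by rewrite /ellipse_norm cos_2piB sin_2piB mulrN sqrrN.
Qed.

(** Together with [ext_dir_cross1] this makes the first component of f_theta'(0) real and the second
    imaginary. For theta > 0 the integrand is odd under t -> 2 pi - t. *)
Lemma ext_dir_cross0 theta : 0 <= theta <= pi / 4 ->
  \int[mu]_(t in `[0, 2 * pi]) (sin t * ext_dir theta 0 t) = 0.
Proof.
move=> /andP[]; rewrite le_eqVlt => /predU1P[<- _|t0 t1].
  exact: sgn_cos_sin_int0.
have [s0 c0] := quarter_trig (introT andP (conj t0 t1)).
under eq_Rintegral do rewrite ext_dirE /= mulrA.
apply: odd_circle_int0.
  apply: ellipse_ratio_continuous => // t.
  apply: cvgM; first exact: continuous_sin.
  by apply: cvgMl_tmp; exact: continuous_cos.
move=> t; rewrite ellipse_norm_refl cos_2piB sin_2piB.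
by rewrite !mulNr.
Qed.

Lemma ext_dir_cross1 theta : 0 <= theta <= pi / 4 ->
  \int[mu]_(t in `[0, 2 * pi]) (cos t * ext_dir theta 1 t) = 0.
Proof.
move=> /andP[]; rewrite le_eqVlt => /predU1P[<- _|t0 t1].
  under eq_Rintegral do rewrite ext_dirE /= sin0 mul0r oppr0 mul0r mulr0.
  by rewrite Rintegral_cst// mul0r.
have [s0 c0] := quarter_trig (introT andP (conj t0 t1)).
under eq_Rintegral do rewrite ext_dirE /= mulrA.
apply: odd_circle_int0.
  apply: ellipse_ratio_continuous => // t.
  apply: cvgM; first exact: continuous_cos.
  by apply: cvgN; apply: cvgMl_tmp; exact: continuous_sin.
move=> t; rewrite ellipse_norm_refl cos_2piB sin_2piB.
by rewrite !mulrN !mulNr.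
Qed.

(** This gives f_theta(0) = 0. For theta > 0 the second component is odd under t -> 2 pi - t; for
    the first one the two half-circles contribute equally, and each contribution vanishes by t -> pi
    - t. *)
Lemma ext_dir_mean0 theta (j : 'I_2) : 0 <= theta <= pi / 4 ->
  \int[mu]_(t in `[0, 2 * pi]) ext_dir theta j t = 0.
Proof.
move=> /andP[]; rewrite le_eqVlt => /predU1P[<- _|t0 t1].
  case: (ord2_cases j) => ->; first exact: sgn_cos_int0.
  under eq_Rintegral do rewrite ext_dirE /= sin0 mul0r oppr0 mul0r.
  by rewrite Rintegral_cst// mul0r.
have [s0 c0] := quarter_trig (introT andP (conj t0 t1)); have pi0 := pi_gt0 R.
case: (ord2_cases j) => ->; under eq_Rintegral do rewrite ext_dirE /=; last first.
  apply: odd_circle_int0.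
    apply: ellipse_ratio_continuous => // t.
    by apply: cvgN; apply: cvgMl_tmp; exact: continuous_sin.
  by move=> t; rewrite ellipse_norm_refl sin_2piB !(mulrN, mulNr).
set f := fun t => cos theta * cos t / ellipse_norm theta t.
have cf : continuous f.
  by apply: ellipse_ratio_continuous => // t; apply: cvgMl_tmp; exact: continuous_cos.
have I a b : mu.-integrable `[a, b] (EFin \o f) by apply: itv_integrable; exact: within_continuous.
rewrite (@Rintegral_split _ _ 0 pi (2 * pi))//; last by apply/andP; split; lra.
have := @Rintegral_subst_reflect R f 0 pi (2 * pi) (ltW pi0) (within_continuous cf).
rewrite subr0 (_ : 2 * pi - pi = pi); last by ring.
move=> <-.
under [X in _ + X]eq_Rintegral do rewrite /f ellipse_norm_refl cos_2piB -/(f _).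
have fpi t : f (pi - t) = -1 * f t.
  rewrite /f /ellipse_norm [pi - t]addrC cosDpi sinDpi cosN sinN opprK.
  by rewrite mulN1r !mulrN sqrrN mulNr.
have := @Rintegral_subst_reflect R f 0 pi pi (ltW pi0) (within_continuous cf).
rewrite subr0 subrr; under eq_Rintegral do rewrite fpi.
rewrite RintegralZl// -/f; lra.
Qed.

Lemma ext_dir_integrable theta (j : 'I_2) (f : R -> R) : 0 <= theta <= pi / 4 ->
  continuous f ->
  mu.-integrable `[0, 2 * pi] (EFin \o (fun t => f t * ext_dir theta j t)).
Proof.
move=> th cf; apply: integrable_mul_bounded; first exact: within_continuous.
  exact: ext_dir_measurable.
exact: ext_dir_norm_le1.
Qed.

Lemma fext_is_derive theta : 0 <= theta <= pi / 4 ->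
  is_derive (0 : R[i]^o) 1 (fext theta : R[i]^o -> 'rV[R[i]]_2)
    (cpair (ext_re theta)%:C ('i%C * (ext_im theta)%:C)).
Proof.
move=> th; apply/(is_derive_mxP (fext theta) 0) => i j.
rewrite ord1 {i}.
have n01 : normc (0 : R[i]) < 1 by rewrite Normc.normc0.
have pi0 := pi_gt0 R.
have -> : (fun w => fext theta w 0 j) = (fun w => ((2 * pi)^-1)%:C * schwarz (ext_dir theta j) w).
  by apply/funext => w; rewrite fextE.
have D := schwarz_cder (ext_dir_measurable j th) (ext_dir_norm_le1 theta j) n01.
suff -> : cpair (ext_re theta)%:C ('i%C * (ext_im theta)%:C) 0 j =
    ((2 * pi)^-1)%:C * dschwarz (ext_dir theta j) 0 by exact: cderZ.
have ic k := ext_dir_integrable k th (@continuous_cos R).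
have is_ k := ext_dir_integrable k th (@continuous_sin R).
rewrite dschwarz0.
under [X in _ = _ * (X +i* _)]eq_Rintegral do rewrite -mulrA.
under [X in _ = _ * (_ +i* X)]eq_Rintegral do rewrite -mulrA -mulNr.
rewrite !RintegralZl// mxE.
have -> : 'i%C * (ext_im theta)%:C = 0 +i* ext_im theta.
  by simpc.
case: (ord2_cases j) => ->; rewrite /= ?ext_dir_cross0 ?ext_dir_cross1// !mulr0.
- have -> : \int[mu]_(x in `[0, 2 * pi]) (cos x * ext_dir theta 0 x) = pi * ext_re theta.
    rewrite /ext_re mulVKf ?gt_eqF//; apply: eq_Rintegral => t _.
    by rewrite ext_dirE /=; ring.
  move: (lt0r_neq0 pi0); move: (pi : R) => p p0.
  by apply/eqP; rewrite eq_complex; apply/andP; split; apply/eqP => /=; field.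
- have -> : \int[mu]_(x in `[0, 2 * pi]) (sin x * ext_dir theta 1 x) = - (pi * ext_im theta).
    rewrite /ext_im mulVKf ?gt_eqF//; apply/eqP; rewrite -eqr_oppLR; apply/eqP.
    rewrite -mulN1r -RintegralZl//.
    by apply: eq_Rintegral => t _; rewrite ext_dirE /=; ring.
  move: (lt0r_neq0 pi0); move: (pi : R) => p p0.
  by apply/eqP; rewrite eq_complex; apply/andP; split; apply/eqP => /=; field.
Qed.

End ExtremalMap.

(** * The equation for r and theta *)

Section QuarterIntegrals.
Context {R : realType}.
Notation mu := (@lebesgue_measure R).
Implicit Types (theta t m : R).

Lemma eq_itv_Rintegral (f g : R -> R) (a b : R) :
  (forall x, a <= x <= b -> f x = g x) ->
  \int[mu]_(x in `[a, b]) f x = \int[mu]_(x in `[a, b]) g x.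
Proof.
by move=> fg; apply: eq_Rintegral => x; rewrite inE/= in_itv/=; exact: fg.
Qed.

Lemma four_quarters (f : R -> R) : continuous f -> (forall t, f (2 * pi - t) = f t) ->
  (forall t, f (pi - t) = f t) ->
  \int[mu]_(t in `[0, 2 * pi]) f t = 4 * \int[mu]_(t in `[0, pi / 2]) f t.
Proof.
move=> cf f2 f1; have pi0 := pi_gt0 R.
have I a b : mu.-integrable `[a, b] (EFin \o f).
  by apply: itv_integrable; exact: within_continuous.
rewrite (@Rintegral_split _ _ 0 pi (2 * pi))//; last by apply/andP; split; lra.
have := @Rintegral_subst_reflect R f 0 pi (2 * pi) (ltW pi0) (within_continuous cf).
under eq_Rintegral do rewrite f2.
rewrite subr0 (_ : 2 * pi - pi = pi); last by ring.
move=> <-.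
rewrite (@Rintegral_split _ _ 0 (pi / 2) pi)//; last by apply/andP; split; lra.
have h0 : 0 <= pi / 2 :> R by lra.
have := @Rintegral_subst_reflect R f 0 (pi / 2) pi h0 (within_continuous cf).
under eq_Rintegral do rewrite f1.
rewrite subr0 (_ : pi - pi / 2 = pi / 2); last by field.
by move=> <-; ring.
Qed.

(** Legendre's Delta for the modulus sqrt(1 - m^2), written in the complementary modulus m, which
    will be tan theta. The integral [quarter_len] is then the complete integral of the second
    kind. *)
Definition delta m t : R := Num.sqrt (cos t ^+ 2 + m ^+ 2 * sin t ^+ 2).
Definition quarter_cos m : R := \int[mu]_(t in `[0, pi / 2]) (cos t ^+ 2 / delta m t).
Definition quarter_sin m : R := \int[mu]_(t in `[0, pi / 2]) (m * sin t ^+ 2 / delta m t).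
Definition quarter_len m : R := \int[mu]_(t in `[0, pi / 2]) delta m t.

Lemma delta_sqr m t : delta m t ^+ 2 = cos t ^+ 2 + m ^+ 2 * sin t ^+ 2.
Proof. by rewrite sqr_sqrtr// addr_ge0 ?sqr_ge0// mulr_ge0 ?sqr_ge0. Qed.

Lemma delta_ge0 m t : 0 <= delta m t. Proof. exact: sqrtr_ge0. Qed.

Lemma delta0 t : delta 0 t = `|cos t|.
Proof. by rewrite /delta expr0n mul0r addr0 sqrtr_sqr. Qed.

Lemma delta1 t : delta 1 t = 1.
Proof. by rewrite /delta expr1n mul1r cos2Dsin2 sqrtr1. Qed.

Lemma delta_ge_cos m t : `|cos t| <= delta m t.
Proof.
rewrite -(@ler_pXn2r _ 2) ?nnegrE ?delta_ge0// delta_sqr real_normK ?num_real//.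
by rewrite lerDl mulr_ge0 ?sqr_ge0.
Qed.

Lemma delta_ge_sin m t : `|m * sin t| <= delta m t.
Proof.
rewrite -(@ler_pXn2r _ 2) ?nnegrE ?delta_ge0// delta_sqr real_normK ?num_real//.
by rewrite exprMn lerDr sqr_ge0.
Qed.

Lemma delta_gt0 m t : m != 0 -> 0 < delta m t.
Proof.
move=> m0; rewrite lt_neqAle delta_ge0 andbT eq_sym; apply/eqP => d0.
have := delta_ge_cos m t; have := delta_ge_sin m t.
rewrite d0 !normr_le0 mulf_eq0 (negbTE m0) /= => /eqP s0 /eqP c0.
by have := cos2Dsin2 t; rewrite s0 c0 !expr0n addr0 => /esym/eqP; rewrite oner_eq0.
Qed.

Lemma delta_le1 m t : 0 <= m <= 1 -> delta m t <= 1.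
Proof.
move=> /andP[m0 m1]; rewrite -(@ler_pXn2r _ 2) ?nnegrE ?delta_ge0// delta_sqr expr1n.
rewrite -(cos2Dsin2 t) lerD2l ler_piMl ?sqr_ge0//.
by rewrite expr_le1.
Qed.

Lemma le_delta m m' t : 0 <= m -> m <= m' -> delta m t <= delta m' t.
Proof.
move=> m0 mm; rewrite -(@ler_pXn2r _ 2) ?nnegrE ?delta_ge0// !delta_sqr lerD2l.
by rewrite ler_wpM2r ?sqr_ge0// ler_sqr ?nnegrE// (le_trans m0).
Qed.

(** Reverse triangle inequality for the plane vectors (cos t, m sin t) and (cos t, m' sin t); [H] is
    the Cauchy-Schwarz inequality for them. *)
Lemma delta_lip m m' t : `|delta m t - delta m' t| <= `|m - m'|.
Proof.
wlog mm : m m' / `|m'| <= `|m|.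
  by move=> H; have [/H//|/ltW/H] := leP `|m'| `|m|; rewrite distrC (distrC m').
have d := delta_ge0 m t; have d' := delta_ge0 m' t.
rewrite -(@ler_pXn2r _ 2) ?nnegrE// !real_normK ?num_real//.
have := delta_sqr m t; have := delta_sqr m' t.
have c0 := sqr_ge0 (cos t).
have s1 : sin t ^+ 2 <= 1 by have := cos2Dsin2 t; lra.
have s0 := sqr_ge0 (sin t).
have H : cos t ^+ 2 + m * m' * sin t ^+ 2 <= delta m t * delta m' t.
  apply: (le_trans (ler_norm _)).
  rewrite -(@ler_pXn2r _ 2) ?nnegrE ?mulr_ge0// real_normK ?num_real// exprMn !delta_sqr.
  have := mulr_ge0 (mulr_ge0 c0 s0) (sqr_ge0 (m - m')).
  set c := cos t ^+ 2; set s := sin t ^+ 2; lra.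
have : (m - m') ^+ 2 * sin t ^+ 2 <= (m - m') ^+ 2 by rewrite ler_piMr ?sqr_ge0.
move=> K E' E; rewrite sqrrB E E'; lra.
Qed.

Lemma delta_continuous m : continuous (delta m).
Proof.
move=> t; apply: (@continuous_comp _ _ _ (fun t => cos t ^+ 2 + m ^+ 2 * sin t ^+ 2) (@Num.sqrt R)).
  apply: cvgD; first by apply: cvgM; exact: continuous_cos.
  by apply: cvgMl_tmp; apply: cvgM; exact: continuous_sin.
exact: sqrt_continuous.
Qed.

Lemma delta_pihalfB m t : delta m (pi - t) = delta m t.
Proof.
by rewrite /delta [pi - t]addrC cosDpi sinDpi cosN sinN opprK sqrrN.
Qed.

Lemma cos2_delta_continuous m : continuous (fun t => cos t ^+ 2 / delta m t).
Proof.
(* For m = 0 the quotient is |cos t|, also at the zeros of cos, where the default value 0 is the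
   right one. *)
have [->|m0] := eqVneq m 0.
  rewrite (_ : (fun _ => _) = fun t => `|cos t|).
    move=> t; apply: (@continuous_comp _ _ _ (@cos R) (fun x : R => `|x|)); first exact: continuous_cos.
    exact: norm_continuous.
  apply/funext => t; rewrite delta0 -(real_normK (num_real (cos t))).
  have [->|c0] := eqVneq `|cos t| 0; first by rewrite expr0n mul0r.
  by rewrite expr2 mulfK.
move=> t; apply: cvgM; first by apply: cvgM; exact: continuous_cos.
by apply: cvgV; [rewrite gt_eqF// delta_gt0|exact: delta_continuous].
Qed.

Lemma sin2_delta_continuous m : continuous (fun t => m * sin t ^+ 2 / delta m t).
Proof.
have [->|m0] := eqVneq m 0.
  rewrite (_ : (fun _ => _) = fun t => 0); first by move=> t; exact: cvg_cst.
  by apply/funext => t; rewrite !mul0r.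
move=> t; apply: cvgM; first by apply: cvgMl_tmp; apply: cvgM; exact: continuous_sin.
by apply: cvgV; [rewrite gt_eqF// delta_gt0|exact: delta_continuous].
Qed.

Lemma ellipse_norm_delta theta t : 0 < cos theta ->
  ellipse_norm theta t = cos theta * delta (tan theta) t.
Proof.
move=> c0; rewrite /ellipse_norm /delta -{2}(gtr0_norm c0) -sqrtr_sqr -sqrtrM ?sqr_ge0//.
by congr Num.sqrt; rewrite /tan; field; rewrite gt_eqF.
Qed.

Lemma cos_quarter_gt0 theta : 0 <= theta <= pi / 4 -> 0 < cos theta.
Proof.
by have pi0 := pi_gt0 R; move=> /andP[? ?]; apply: cos_gt0_pihalf; apply/andP; split; lra.
Qed.

Lemma ext_reE theta : 0 <= theta <= pi / 4 ->
  ext_re theta = 4 / pi * quarter_cos (tan theta).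
Proof.
move=> /cos_quarter_gt0 c0; rewrite /ext_re.
rewrite (eq_itv_Rintegral (g := fun t => cos t ^+ 2 / delta (tan theta) t)); last first.
  by move=> t _; rewrite ellipse_norm_delta// invfM mulrACA divff ?mul1r// gt_eqF.
rewrite four_quarters; first by rewrite /quarter_cos mulrA (mulrC _ 4).
- exact: cos2_delta_continuous.
- by move=> t; rewrite cos_2piB /delta cos_2piB sin_2piB sqrrN.
- by move=> t; rewrite delta_pihalfB addrC cosDpi cosN sqrrN.
Qed.

Lemma ext_imE theta : 0 <= theta <= pi / 4 ->
  ext_im theta = 4 / pi * quarter_sin (tan theta).
Proof.
move=> /cos_quarter_gt0 c0; rewrite /ext_im.
rewrite (eq_itv_Rintegral (g := fun t => tan theta * sin t ^+ 2 / delta (tan theta) t)); last first.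
  move=> t _; rewrite ellipse_norm_delta// invfM /tan.
  by move: (delta _ t)^-1 => X; ring.
rewrite four_quarters; first by rewrite /quarter_sin mulrA (mulrC _ 4).
- exact: sin2_delta_continuous.
- by move=> t; rewrite sin_2piB /delta cos_2piB sin_2piB !sqrrN.
- by move=> t; rewrite delta_pihalfB addrC sinDpi sinN opprK.
Qed.

Lemma quarter_itv t : 0 <= t <= pi / 2 -> 0 <= cos t /\ 0 <= sin t.
Proof.
have pi0 := pi_gt0 R; move=> /andP[t0 t1]; split.
  by apply: cos_ge0_pihalf; apply/andP; split; lra.
by apply: sin_ge0_pi; apply/andP; split; lra.
Qed.

Lemma quarter_cos0 : quarter_cos 0 = 1.
Proof.
have pi0 := pi_gt0 R.
rewrite /quarter_cos (eq_itv_Rintegral (g := cos)); last first.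
  move=> t /quarter_itv[c0 _]; rewrite delta0 ger0_norm//.
  have [->|cn0] := eqVneq (cos t) 0; first by rewrite expr0n mul0r.
  by rewrite expr2 mulfK.
rewrite (@Rintegral_FTC _ sin)//; [by rewrite sin_pihalf sin0 subr0|lra|].
by apply: within_continuous; exact: continuous_cos.
Qed.

Lemma quarter_sin0 : quarter_sin 0 = 0.
Proof.
rewrite /quarter_sin; under eq_Rintegral do rewrite !mul0r.
by rewrite Rintegral_cst// mul0r.
Qed.

Lemma quarter_cos1 : quarter_cos 1 = pi / 4.
Proof.
have pi0 := pi_gt0 R.
rewrite /quarter_cos; under eq_Rintegral do rewrite delta1 divr1.
have dF (t : R) : is_derive t 1 (fun t : R => 2^-1 * (t + sin t * cos t) : R) (cos t ^+ 2).
  have d1 := is_deriveD (is_derive_id t (1 : R)) (is_deriveM (is_derive_sin t) (is_derive_cos t)).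
  have := is_deriveM (is_derive_cst (2^-1 : R) t 1) d1; move/is_derive_eq; apply.
  rewrite scaler0 addr0 /GRing.scale /=.
  have := cos2Dsin2 t; lra.
rewrite (@Rintegral_FTC _ (fun t => 2^-1 * (t + sin t * cos t)))//.
- by rewrite sin_pihalf cos_pihalf sin0 mulr0 mul0r !addr0 mulr0 subr0; lra.
- lra.
- by apply: within_continuous => t; apply: cvgM; exact: continuous_cos.
Qed.

Lemma quarter_integrable (f : R -> R) : continuous f ->
  mu.-integrable `[0, pi / 2] (EFin \o f).
Proof. by move=> cf; apply: itv_integrable; exact: within_continuous. Qed.

(** Pointwise m^2 sin^2 / Delta = Delta - cos^2 / Delta. It expresses [m * quarter_sin m] through
    two integrals that are continuous in m up to m = 0. *)
Lemma quarter_sin_len m : m * quarter_sin m = quarter_len m - quarter_cos m.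
Proof.
rewrite /quarter_sin /quarter_len /quarter_cos -RintegralB//; last 2 first.
- by apply: quarter_integrable; exact: delta_continuous.
- by apply: quarter_integrable; exact: cos2_delta_continuous.
rewrite -RintegralZl//; last by apply: quarter_integrable; exact: sin2_delta_continuous.
apply: eq_Rintegral => t _.
have [d0|d0] := eqVneq (delta m t) 0; first by rewrite d0 !invr0 !mulr0 subr0.
apply: (mulIf d0); rewrite mulrBl mulfVK// -expr2 delta_sqr mulrA mulfVK//; ring.
Qed.

Lemma quarter_sin1 : quarter_sin 1 = pi / 4.
Proof.
rewrite -[LHS]mul1r quarter_sin_len quarter_cos1 /quarter_len.
under eq_Rintegral do rewrite delta1.
rewrite Rintegral_cst//= lebesgue_measure_itv/= lte_fin divr_gt0 ?pi_gt0//=; lra.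
Qed.

Lemma ext_re0 : ext_re 0 = 4 / pi :> R.
Proof.
rewrite ext_reE; first by rewrite tan0 quarter_cos0 mulr1.
by rewrite lexx divr_ge0// pi_ge0.
Qed.

Lemma ext_im0 : ext_im 0 = 0 :> R.
Proof.
rewrite ext_imE; first by rewrite tan0 quarter_sin0 mulr0.
by rewrite lexx divr_ge0// pi_ge0.
Qed.

Lemma ext_re_piquarter : ext_re (pi / 4) = 1 :> R.
Proof.
have pi0 := pi_gt0 R.
rewrite ext_reE; last by rewrite lexx andbT divr_ge0// ltW.
rewrite tan_piquarter quarter_cos1; move: (lt0r_neq0 pi0); move: (pi : R) => p p0.
by field.
Qed.

Lemma ext_im_piquarter : ext_im (pi / 4) = 1 :> R.
Proof.
have pi0 := pi_gt0 R.
rewrite ext_imE; last by rewrite lexx andbT divr_ge0// ltW.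
rewrite tan_piquarter quarter_sin1; move: (lt0r_neq0 pi0); move: (pi : R) => p p0.
by field.
Qed.

(** A pointwise comparison of the integrands would give only a weak inequality. Their difference is
    therefore bounded below by [c * (sin t * cos t) ^+ 3], which has a polynomial primitive in sin t
    and the positive integral c / 12. *)
Lemma quarter_cos_lt m m' : 0 <= m -> m < m' -> m' <= 1 -> quarter_cos m' < quarter_cos m.
Proof.
move=> m0 mm m1; have pi0 := pi_gt0 R; rewrite -subr_gt0 /quarter_cos.
rewrite -RintegralB//; try by apply: quarter_integrable; exact: cos2_delta_continuous.
(* With d, d' the values of Delta at m and m', d'^2 - d^2 = 2 c sin^2 t and d + d' <= 2, so d' - d
   >= c sin^2 t; dividing by d d' <= 1 only helps. *)
pose c := (m' ^+ 2 - m ^+ 2) / 2.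
have c0 : 0 < c by rewrite divr_gt0// subr_gt0 ltr_pXn2r ?nnegrE// ?(le_trans m0)// ltW.
have dF (t : R) : is_derive t 1 (fun t => c * (4^-1 * sin t ^+ 4 - 6^-1 * sin t ^+ 6) : R)
    (c * (sin t * cos t) ^+ 3).
  have dX n := is_deriveX n (is_derive_sin t).
  have d1 := is_deriveB (is_deriveM (is_derive_cst (4^-1 : R) t 1) (dX 4%N))
                        (is_deriveM (is_derive_cst (6^-1 : R) t 1) (dX 6%N)).
  have := is_deriveM (is_derive_cst c t 1) d1; move/is_derive_eq; apply.
  rewrite !scaler0 !addr0 /GRing.scale /=.
  have -> : (sin t * cos t) ^+ 3 = sin t ^+ 3 * cos t * cos t ^+ 2 by ring.
  by rewrite cos2sin2; field.
have cf : continuous (fun t => c * (sin t * cos t) ^+ 3 : R).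
  move=> t; apply: cvgMl_tmp; rewrite /=.
  have sc : {for t, continuous (fun t => sin t * cos t : R)}.
    by apply: cvgM; [exact: continuous_sin|exact: continuous_cos].
  by apply: cvgM => //; apply: cvgM.
apply: (@lt_le_trans _ _ (\int[mu]_(t in `[0, pi / 2]) (c * (sin t * cos t) ^+ 3))).
  rewrite (@Rintegral_FTC _ (fun t => c * (4^-1 * sin t ^+ 4 - 6^-1 * sin t ^+ 6)))//.
  - rewrite sin_pihalf sin0 !expr1n !expr0n /= !mulr0 subrr mulr0 subr0; lra.
  - lra.
  - exact: within_continuous.
apply: le_Rintegral => //.
- exact: quarter_integrable.
- by apply: itv_integrableB; apply: within_continuous; exact: cos2_delta_continuous.
move=> t /=; rewrite in_itv/= => /quarter_itv[ct st].
have m'0 : 0 < m' by exact: le_lt_trans mm.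
have [c00|cn0] := eqVneq (cos t) 0; first by rewrite c00 mulr0 !expr0n/= mulr0 !mul0r subrr.
have {cn0}ct0 : 0 < cos t by rewrite lt_neqAle eq_sym cn0.
have d0 k : 0 < delta k t by rewrite (lt_le_trans _ (delta_ge_cos k t))// normr_gt0 gt_eqF.
have d1 : delta m t <= 1 by apply: delta_le1; lra.
have d1' : delta m' t <= 1 by apply: delta_le1; lra.
have d2 := delta_sqr m t; have d2' := delta_sqr m' t.
have := d0 m; have := d0 m'; move: d1 d1' d2 d2'.
set d := delta m t; set d' := delta m' t => d1 d1' d2 d2' d'0 d00.
have -> : cos t ^+ 2 / d - cos t ^+ 2 / d' = cos t ^+ 2 * ((d' - d) / (d * d')).
  by field; rewrite !gt_eqF.
have dd : d <= d' by apply: le_delta => //; exact: ltW.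
have H1 : c * sin t ^+ 2 <= d' - d.
  have E : (d' - d) * (d' + d) = 2 * (c * sin t ^+ 2).
    rewrite (_ : _ * _ = d' ^+ 2 - d ^+ 2); last by ring.
    by rewrite d2 d2' /c; field.
  have : (d' - d) * (d' + d) <= (d' - d) * 2 by rewrite ler_wpM2l; lra.
  by rewrite E; lra.
have H2 : d' - d <= (d' - d) / (d * d').
  rewrite ler_pdivlMr ?mulr_gt0// ler_piMr; first by [].
    by lra.
  by rewrite mulr_ile1// ltW.
have s1 : sin t <= 1 by rewrite (le_trans (ler_norm _))// sin_max.
have c1 : cos t <= 1 by rewrite (le_trans (ler_norm _))// cos_max.
apply: (@le_trans _ _ (cos t ^+ 2 * (c * sin t ^+ 2))).
  rewrite (_ : cos t ^+ 2 * (c * sin t ^+ 2) = c * (sin t * cos t) ^+ 2); last by ring.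
  rewrite ler_pM2l// exprS ler_piMl ?sqr_ge0// mulr_ile1//.
by rewrite ler_wpM2l ?sqr_ge0// (le_trans H1).
Qed.

(** The quotient m / Delta does not decrease in m: after cross-multiplying and squaring, the sine
    terms agree and the cosine terms compare m^2 with m'^2. *)
Lemma quarter_sin_le m m' : 0 <= m -> m <= m' -> quarter_sin m <= quarter_sin m'.
Proof.
move=> m0 mm; apply: le_Rintegral => //;
  try by apply: quarter_integrable; exact: sin2_delta_continuous.
move=> t _; have [d0|d0] := eqVneq (delta m t) 0.
  rewrite d0 invr0 mulr0 divr_ge0 ?delta_ge0// mulr_ge0 ?sqr_ge0// (le_trans m0)//.
have {}d0 : 0 < delta m t by rewrite lt_neqAle eq_sym d0 delta_ge0.
have d0' : 0 < delta m' t by rewrite (lt_le_trans d0)// le_delta.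
rewrite mulrAC [leRHS]mulrAC ler_wpM2r ?sqr_ge0// ler_pdivrMr// mulrAC ler_pdivlMr//.
rewrite -(@ler_pXn2r _ 2) ?nnegrE ?mulr_ge0 ?(ltW d0) ?(ltW d0') ?(le_trans m0)//.
rewrite !exprMn !delta_sqr !mulrDr; apply: lerD.
  by rewrite ler_wpM2r ?sqr_ge0// ler_sqr ?nnegrE// (le_trans m0).
by rewrite mulrCA.
Qed.

Lemma quarter_lip (F : R -> R -> R) : (forall m, continuous (F m)) ->
  (forall m m' t, `|F m t - F m' t| <= `|m - m'|) ->
  continuous (fun m => \int[mu]_(t in `[0, pi / 2]) F m t).
Proof.
move=> cF lF m; have pi0 := pi_gt0 R; apply/cvgrPdist_le => e e0; near=> m'.
rewrite -RintegralB//; try exact: quarter_integrable.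
apply: (@le_trans _ _ (`|m - m'| * (pi / 2 - 0))).
  apply: normr_Rintegral_le; [lra| |by move=> t _; exact: lF].
  by apply: itv_integrableB; exact: within_continuous.
rewrite subr0 -ler_pdivlMr ?divr_gt0//.
near: m'; apply: cvgr_dist_le; first exact: cvg_id.
by rewrite !divr_gt0.
Unshelve. all: by end_near. Qed.

Lemma quarter_len_continuous : continuous quarter_len.
Proof. exact: quarter_lip delta_continuous delta_lip. Qed.

Lemma quarter_cos_continuous : continuous quarter_cos.
Proof.
apply: quarter_lip cos2_delta_continuous _ => m m' t.
have [c0|c0] := eqVneq (cos t) 0; first by rewrite c0 expr0n /= !mul0r subrr normr0.
have d0 k : 0 < delta k t by rewrite (lt_le_trans _ (delta_ge_cos k t))// normr_gt0.
(* Both quotients cos / Delta are at most 1 in modulus, so the Lipschitz bound of Delta is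
   inherited, including at m = 0. *)
have -> : cos t ^+ 2 / delta m t - cos t ^+ 2 / delta m' t =
    (cos t / delta m t) * (cos t / delta m' t) * (delta m' t - delta m t).
  by field; rewrite !gt_eqF.
have q1 k : `|cos t / delta k t| <= 1.
  by rewrite normrM normfV (gtr0_norm (d0 k)) ler_pdivrMr// mul1r delta_ge_cos.
rewrite normrM distrC; apply: le_trans (delta_lip m m' t).
by rewrite ler_piMl// normrM mulr_ile1.
Qed.

(** The integrand does not tend to 0 uniformly as m does, for it equals 1 at t = pi/2. It is at most
    1 on a short interval ending there, and at most m / s on the rest, where cos t >= s. *)
Lemma quarter_sin_small (e : R) : 0 < e -> exists2 m, 0 < m <= 1 & quarter_sin m <= e.
Proof.
move=> e0; have pi0 := pi_gt0 R; have pi2 := pi_ge2 R.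
pose d := Num.min (e / 2) 1.
have d0 : 0 < d by rewrite lt_min divr_gt0//=.
have de : d <= e / 2 by rewrite ge_min lexx.
have d1 : d <= 1 by rewrite ge_min lexx orbT.
clearbody d.
pose s := cos (pi / 2 - d).
have s0 : 0 < s by apply: cos_gt0_pihalf; apply/andP; split; lra.
(* This makes the long piece at most e / 4; the short one is at most d <= e / 2. *)
pose m := Num.min 1 (s * e / (2 * pi)).
have m0 : 0 < m by rewrite lt_min ltr01/= !divr_gt0 ?mulr_gt0.
have me : m <= s * e / (2 * pi) by rewrite ge_min lexx orbT.
have m1 : m <= 1 by rewrite ge_min lexx.
clearbody m.
exists m; first by rewrite m0.
rewrite /quarter_sin (@Rintegral_split _ _ 0 (pi / 2 - d)); last 2 first.
- by apply/andP; split; lra.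
- by apply: quarter_integrable; exact: sin2_delta_continuous.
have I a b : mu.-integrable `[a, b] (EFin \o (fun t => m * sin t ^+ 2 / delta m t)).
  by apply: itv_integrable; apply: within_continuous; exact: sin2_delta_continuous.
have dp t : 0 < delta m t by rewrite delta_gt0// gt_eqF.
have f0 t : 0 <= m * sin t ^+ 2 / delta m t.
  by rewrite divr_ge0 ?delta_ge0// mulr_ge0 ?sqr_ge0// ltW.
have s1 (t : R) : sin t ^+ 2 <= 1 by have := cos2Dsin2 t; have := sqr_ge0 (cos t); lra.
have B1 : `|\int[mu]_(t in `[0, pi / 2 - d]) (m * sin t ^+ 2 / delta m t)| <= m / s * (pi / 2 - d - 0).
  apply: normr_Rintegral_le => //; first by lra.
  move=> t /andP[t0 t1]; rewrite ger0_norm//.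
  have st : s <= delta m t.
    apply: le_trans (delta_ge_cos m t); apply: le_trans (ler_norm _).
    rewrite /s leNgt ltr_cos ?in_itv/=; [rewrite -leNgt//|apply/andP; split; lra|apply/andP; split; lra].
  apply: ler_pM.
  - by rewrite mulr_ge0 ?sqr_ge0// ltW.
  - by rewrite invr_ge0 delta_ge0.
  - by rewrite ler_piMr// ltW.
  - by rewrite lef_pV2 ?posrE.
have B2 : `|\int[mu]_(t in `[pi / 2 - d, pi / 2]) (m * sin t ^+ 2 / delta m t)| <= 1 * (pi / 2 - (pi / 2 - d)).
  apply: normr_Rintegral_le => //; first by lra.
  move=> t _; rewrite ger0_norm// ler_pdivrMr// mul1r.
  apply: le_trans (delta_ge_sin m t); rewrite normrM (gtr0_norm m0) ler_pM2l//.
  by rewrite -real_normK ?num_real// expr2 ler_piMl// sin_max.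
have := ler_norm (\int[mu]_(t in `[0, pi / 2 - d]) (m * sin t ^+ 2 / delta m t)).
have := ler_norm (\int[mu]_(t in `[pi / 2 - d, pi / 2]) (m * sin t ^+ 2 / delta m t)).
have B3 : m / s * (pi / 2 - d - 0) <= e / 4.
  apply: (@le_trans _ _ (s * e / (2 * pi) / s * (pi / 2))).
    apply: ler_pM; [by rewrite divr_ge0// ltW|by lra| |by lra].
    by rewrite ler_pM2r// invr_gt0.
  rewrite le_eqVlt; apply/orP; left; apply/eqP.
  move: (lt0r_neq0 pi0) (lt0r_neq0 s0); move: (s) (pi : R) => q p p0 q0; field.
  by rewrite p0 q0.
lra.
Qed.

End QuarterIntegrals.

(** * Existence and uniqueness of the solution *)

Section Solution.
Context {R : realType}.
Notation mu := (@lebesgue_measure R).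
Implicit Types (theta t m a b r : R).

Lemma quarter_cos_ge m : 0 <= m <= 1 -> pi / 4 <= quarter_cos m.
Proof.
rewrite -quarter_cos1 => /andP[m0]; rewrite le_eqVlt => /predU1P[->//|m1].
by apply: ltW; exact: quarter_cos_lt.
Qed.

Lemma quarter_cos_gt0 m : 0 <= m <= 1 -> 0 < quarter_cos m.
Proof. by move=> /quarter_cos_ge; apply: lt_le_trans; rewrite divr_gt0// pi_gt0. Qed.

(** As Delta <= 1, dropping the denominator lowers the integrand to m sin^2 t. *)
Lemma quarter_sin_gt0 m : 0 < m <= 1 -> 0 < quarter_sin m.
Proof.
move=> /andP[m0 m1].
suff : m * quarter_sin 1 <= quarter_sin m.
  by apply: lt_le_trans; rewrite quarter_sin1 mulr_gt0// divr_gt0// pi_gt0.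
rewrite /quarter_sin -RintegralZl//; last by apply: quarter_integrable; exact: sin2_delta_continuous.
apply: le_Rintegral => //.
- apply: quarter_integrable => t; apply: cvgMl_tmp; exact: sin2_delta_continuous.
- by apply: quarter_integrable; exact: sin2_delta_continuous.
move=> t _; rewrite delta1 divr1 mul1r ler_pdivlMr ?delta_gt0 ?gt_eqF//.
apply: ler_piMr; first by rewrite mulr_ge0 ?sqr_ge0 ?ltW.
by apply: delta_le1; rewrite m1 ltW.
Qed.

Lemma quarter_ratio a b : 0 < a -> 0 <= b <= a ->
  exists2 m, 0 <= m <= 1 & a * quarter_sin m = b * quarter_cos m.
Proof.
move=> a0 /andP[]; rewrite le_eqVlt => /predU1P[<- _|b0 ba].
  by exists 0; rewrite ?lexx ?ler01// quarter_sin0 mulr0 mul0r.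
have pi0 := pi_gt0 R.
(* Since [quarter_cos] is at least pi/4 on [0, 1], this threshold makes the function to which the
   intermediate value theorem is applied nonpositive at [m0]. *)
have [|m0 /andP[m00 m01] Qm0] := @quarter_sin_small R (b * (pi / 4) / a).
  by rewrite divr_gt0// mulr_gt0// divr_gt0.
(* Multiplying the equation by [m] avoids a discussion of the continuity of
   [quarter_sin] at 0. *)
pose G m := a * (quarter_len m - quarter_cos m) - b * (m * quarter_cos m).
have GE m : G m = m * (a * quarter_sin m - b * quarter_cos m).
  by rewrite /G -quarter_sin_len; ring.
have cG : continuous G.
  move=> m; apply: cvgB.
    by apply: cvgMl_tmp; apply: cvgB; [exact: quarter_len_continuous|exact: quarter_cos_continuous].
  by apply: cvgMl_tmp; apply: cvgM; [exact: cvg_id|exact: quarter_cos_continuous].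
have G0 : G m0 <= 0.
  rewrite GE pmulr_rle0// subr_le0.
  apply: (@le_trans _ _ (a * (b * (pi / 4) / a))); first by rewrite ler_pM2l.
  by rewrite mulrC mulfVK ?gt_eqF// ler_pM2l// quarter_cos_ge// m01 (ltW m00).
have G1 : 0 <= G 1.
  rewrite GE mul1r quarter_sin1 quarter_cos1 -mulrBl mulr_ge0 ?subr_ge0//.
  by rewrite divr_ge0// ltW.
have [|m] := @IVT R G m0 1 0 m01 (within_continuous cG).
  by rewrite ge_min G0 /= le_max G1 orbT.
rewrite in_itv/= => /andP[mm0 mm1] /eqP.
have m_gt0 : 0 < m by exact: lt_le_trans mm0.
rewrite GE mulf_eq0 gt_eqF//= subr_eq0 => /eqP E.
by exists m; rewrite ?mm1 ?ltW.
Qed.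

Lemma tan_quarter_bound theta : 0 <= theta <= pi / 4 -> 0 <= tan theta <= 1.
Proof.
have pi0 := pi_gt0 R; move=> /andP[t0 t1].
have I (x : R) : 0 <= x -> x <= pi / 4 -> x \in `](- (pi / 2)), (pi / 2)[.
  by move=> x0 x1; rewrite in_itv/=; apply/andP; split; lra.
apply/andP; split.
  rewrite -tan0 leNgt ltr_tan ?I// -?leNgt//; lra.
rewrite -tan_piquarter leNgt ltr_tan ?I// -?leNgt//; lra.
Qed.

Lemma ext_solution_exists a b : 0 < a -> 0 <= b <= a ->
  exists r theta, [/\ 0 < r, 0 <= theta <= pi / 4,
    r * ext_re theta = a & r * ext_im theta = b].
Proof.
move=> a0 ba; have pi0 := pi_gt0 R.
have [m m01 E] := quarter_ratio a0 ba; have [m0 m1] := andP m01.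
have th : 0 <= atan m <= pi / 4.
  by rewrite -atan0 -atan1 !le_atan.
have P0 := quarter_cos_gt0 m01.
exists (a * pi / (4 * quarter_cos m)), (atan m).
rewrite ext_reE// ext_imE// !atanK; split => //.
- by rewrite divr_gt0 ?mulr_gt0.
- move: (lt0r_neq0 pi0) (lt0r_neq0 P0); move: (pi : R) (quarter_cos m) => p P p0 PP; field.
  by rewrite PP p0.
- move: (lt0r_neq0 pi0) (lt0r_neq0 P0) E; move: (pi : R) (quarter_cos m) (quarter_sin m) => p P Q p0 PP E.
  have -> : b = a * Q / P by rewrite E mulfK.
  by field; rewrite PP p0.
Qed.

(** Both solutions give the same ratio b / a of [quarter_sin] to [quarter_cos]. If tan theta < tan
    theta', the numerator does not decrease and the denominator drops strictly, which is absurd. *)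
Lemma ext_solution_le a b r r' theta theta' : 0 < a -> 0 < r -> 0 < r' ->
  0 <= theta <= pi / 4 -> 0 <= theta' <= pi / 4 ->
  r * ext_re theta = a -> r * ext_im theta = b ->
  r' * ext_re theta' = a -> r' * ext_im theta' = b -> tan theta' <= tan theta.
Proof.
move=> a0 r0 r0' th th'.
have pi0 := pi_gt0 R.
have /andP[m0 m1] := tan_quarter_bound th; have /andP[m0' m1'] := tan_quarter_bound th'.
rewrite !ext_reE// !ext_imE//.
have P0 : 0 < quarter_cos (tan theta) by apply: quarter_cos_gt0; rewrite m0.
have P0' : 0 < quarter_cos (tan theta') by apply: quarter_cos_gt0; rewrite m0'.
move=> E1 E2 E1' E2'; rewrite leNgt; apply/negP => mm.
have Q' := @quarter_sin_gt0 (tan theta') (introT andP (conj (le_lt_trans m0 mm) m1')).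
have PP := quarter_cos_lt m0 mm m1'.
have QQ := quarter_sin_le m0 (ltW mm).
have c0 : 0 < 4 / pi :> R by rewrite divr_gt0.
(* All strictness comes from [quarter_cos], which b multiplies; b is positive because the larger
   tangent is. *)
have b0 : 0 < b by rewrite -E2' (mulr_gt0 r0' (mulr_gt0 c0 Q')).
move: P0 P0' Q' PP QQ E1 E2 E1' E2'.
move: (quarter_cos (tan theta)) (quarter_cos (tan theta')) (quarter_sin (tan theta)) (quarter_sin (tan theta')) (4 / pi) c0.
move=> P P' Q Q' c c0 P0 P0' Q0' PP QQ E1 E2 E1' E2'.
have F : a * Q = b * P by rewrite -E1 -E2; ring.
have F' : a * Q' = b * P' by rewrite -E1' -E2'; ring.
have : a * Q <= a * Q' by rewrite ler_pM2l.
by rewrite F F' ler_pM2l// leNgt PP.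
Qed.

Lemma ext_solution_unique a b r r' theta theta' : 0 < a -> 0 < r -> 0 < r' ->
  0 <= theta <= pi / 4 -> 0 <= theta' <= pi / 4 ->
  r * ext_re theta = a -> r * ext_im theta = b ->
  r' * ext_re theta' = a -> r' * ext_im theta' = b -> r = r' /\ theta = theta'.
Proof.
move=> a0 r0 r0' th th' E1 E2 E1' E2'; have pi0 := pi_gt0 R.
have I (x : R) : 0 <= x <= pi / 4 -> x \in `](- (pi / 2)), (pi / 2)[.
  by move=> /andP[x0 x1]; rewrite in_itv/=; apply/andP; split; lra.
have tE : theta = theta'.
  apply: tan_inj; [exact: I|exact: I|apply/eqP].
  by rewrite eq_le (ext_solution_le a0 r0' r0 th' th E1' E2' E1 E2) (ext_solution_le a0 r0 r0' th th' E1 E2 E1' E2').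
split => //; move: E1'; rewrite -tE -E1 => /mulIf -> //.
by apply/eqP => e0; move: a0; rewrite -E1 e0 mulr0 ltxx.
Qed.

End Solution.

(** * Elliptic integrals *)

Section Elliptic.
Context {R : realType}.
Notation mu := (@lebesgue_measure R).
Implicit Types (theta t m k x : R).

(** The substitution x = sin t away from the singularity at x = 1. The integrals stay extended-real,
    ready for monotone convergence. *)
Lemma sin_subst_lt (g : R -> R) (b : R) : 0 <= b < pi / 2 ->
  (forall x, 0 <= x <= 1 -> {for x, continuous g}) ->
  (\int[mu]_(x in `[0%R, (sin b)%R]) (g x / Num.sqrt (1 - x ^+ 2))%:E =
   \int[mu]_(t in `[0%R, b]) (g (sin t))%:E)%E.
Proof.
move=> /andP[b0 bpi] cg; have pi0 := pi_gt0 R.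
have dsin : (@sin R)^`()%classic = @cos R.
  by apply/funext => t; rewrite derive1E; case: (is_derive_sin t).
have sin_mono (x y : R) : 0 <= x -> y <= b -> x < y -> sin x < sin y.
  move=> x0 yb xy; rewrite ltr_sin// in_itv/=; apply/andP; split; lra.
have sb1 : sin b < 1.
  rewrite -sin_pihalf ltr_sin ?in_itv/=; [by []|apply/andP; split; lra|apply/andP; split; lra].
have sb0 : 0 <= sin b by apply: sin_ge0_pi; apply/andP; split; lra.
rewrite -{1}(@sin0 R) (@integration_by_substitution_increasing _ sin)//.
- rewrite dsin; apply: eq_integral => t; rewrite inE/= in_itv/= => /andP[t0 t1].
  congr EFin; rewrite !fctE.
  have c0 : 0 < cos t by apply: cos_gt0_pihalf; apply/andP; split; lra.
  by rewrite -cos2sin2 sqrtr_sqr gtr0_norm// mulfVK// gt_eqF.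
- move=> x y; rewrite !in_itv/= => /andP[x0 _] /andP[_ yb]; exact: sin_mono.
- by rewrite dsin => x _; exact: continuous_cos.
- rewrite dsin; apply/cvg_ex; exists (cos 0); apply: cvg_at_right_filter; exact: continuous_cos.
- rewrite dsin; apply/cvg_ex; exists (cos b); apply: cvg_at_left_filter; exact: continuous_cos.
- split.
  + by move=> x _; exact: derivable_sin.
  + by apply: cvg_at_right_filter; exact: continuous_sin.
  + by apply: cvg_at_left_filter; exact: continuous_sin.
- rewrite sin0; apply: itv_within_continuous => x /andP[x0 xb].
  have x1 : x < 1 by exact: le_lt_trans sb1.
  apply: cvgM; first by apply: cg; rewrite x0 ltW.
  have x2 : 0 < 1 - x ^+ 2 by rewrite subr_gt0 expr_lt1.
  apply: cvgV; first by rewrite gt_eqF// sqrtr_gt0.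
  apply: (@continuous_comp _ _ _ (fun x => 1 - x ^+ 2) (@Num.sqrt R)); last exact: sqrt_continuous.
  by apply: cvgB; [exact: cvg_cst|apply: cvgM; exact: cvg_id].
Qed.

(** Exhaustion of [0, pi/2[ by segments on which the substitution is regular; [g >= 0] makes both
    sides limits by monotone convergence. *)
Lemma sin_subst (g : R -> R) :
  (forall x, 0 <= x <= 1 -> {for x, continuous g}) ->
  (forall x, 0 <= x <= 1 -> 0 <= g x) ->
  \int[mu]_(x in `[0, 1]) (g x / Num.sqrt (1 - x ^+ 2)) =
  \int[mu]_(t in `[0, pi / 2]) g (sin t).
Proof.
move=> cg g0; have pi0 := pi_gt0 R; rewrite /Rintegral; congr fine.
(* The shift to [n.+1] keeps [b n] nonnegative from the start, since pi/2 >= 1. *)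
pose b n : R := pi / 2 - n.+1%:R^-1.
have b0 n : 0 <= b n.
  by rewrite subr_ge0 (le_trans _ (pihalf_ge1 R))// invf_le1// ler1n.
have b1 n : b n < pi / 2 by rewrite ltrBlDr ltrDl invr_gt0.
have bn (n m : nat) : (n <= m)%N -> b n <= b m.
  by move=> nm; rewrite lerD2l lerN2 lef_pV2 ?posrE// ler_nat.
have sI x : 0 <= x -> x <= pi / 2 -> x \in `[- (pi / 2), pi / 2].
  by move=> x0 x1; rewrite in_itv/=; apply/andP; split; lra.
have ssin x y : 0 <= x -> x <= y -> y <= pi / 2 -> sin x <= sin y.
  by move=> x0 xy y1; rewrite leNgt ltr_sin ?sI// -?leNgt//; lra.
have sb1 n : sin (b n) < 1.
  by rewrite -sin_pihalf ltr_sin ?sI// ?ltW//; lra.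
have U1 : `[0, pi / 2[%classic = \bigcup_n `[0, b n]%classic by exact: itv_bnd_open_bigcup.
have U2 : `[0, 1[%classic = \bigcup_n `[0, sin (b n)]%classic.
  apply/seteqP; split => x /=; rewrite in_itv/=.
    move=> /andP[x0 x1].
    have xI : -1 <= x <= 1 by apply/andP; split; lra.
    have ax0 : 0 <= asin x.
      rewrite leNgt; apply/negP => ax.
      have : sin (asin x) < sin 0.
        rewrite ltr_sin// in_itv/= ?asin_geNpi2 ?asin_lepi2//; apply/andP; split; lra.
      by rewrite sin0 asinK ?in_itv// => /lt_geF; rewrite x0.
    have ax1 : asin x < pi / 2 by apply: asin_ltpi2; apply/andP; split; lra.
    have : `[0, pi / 2[%classic (asin x) by rewrite /= in_itv/= ax0.
    rewrite U1 => -[n _ /=]; rewrite in_itv/= => /andP[_ axb].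
    exists n => //=; rewrite in_itv/= x0 -[leLHS]asinK ?in_itv//=.
    by apply: ssin => //; exact: ltW.
  move=> [n _ /=]; rewrite in_itv/= => /andP[-> /le_lt_trans]; exact.
pose G x := (g x / Num.sqrt (1 - x ^+ 2))%:E.
pose H t := (g (sin t))%:E.
have GF : {homo (fun n => `[0, sin (b n)]%classic : set R) : n m / (n <= m)%N >-> (n <= m)%O}.
  move=> n m nm; apply/subsetPset; apply: subset_itvl; rewrite bnd_simp.
  by apply: ssin => //; [exact: bn|exact: ltW].
have HF : {homo (fun n => `[0, b n]%classic : set R) : n m / (n <= m)%N >-> (n <= m)%O}.
  by move=> n m nm; apply/subsetPset; apply: subset_itvl; rewrite bnd_simp; exact: bn.
have mG n : measurable_fun `[0, sin (b n)]%classic G.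
  apply/measurable_EFinP; apply: subspace_continuous_measurable_fun => //.
  apply: itv_within_continuous => x /andP[x0 xb].
  have x1 : x < 1 by exact: le_lt_trans (sb1 n).
  apply: cvgM; first by apply: cg; rewrite x0 ltW.
  have x2 : 0 < 1 - x ^+ 2 by rewrite subr_gt0 expr_lt1.
  apply: cvgV; first by rewrite gt_eqF// sqrtr_gt0.
  apply: (@continuous_comp _ _ _ (fun x => 1 - x ^+ 2) (@Num.sqrt R)); last exact: sqrt_continuous.
  by apply: cvgB; [exact: cvg_cst|apply: cvgM; exact: cvg_id].
have mH n : measurable_fun `[0, b n]%classic H.
  apply/measurable_EFinP; apply: subspace_continuous_measurable_fun => //.
  apply: itv_within_continuous => x /andP[x0 xb].
  apply: (@continuous_comp _ _ _ (@sin R) g); first exact: continuous_sin.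
  apply: cg; rewrite -{1}(@sin0 R) -sin_pihalf !ssin//; rewrite (le_trans xb)// ltW//.
have cG := ge0_nondecreasing_set_cvg_integral (mu := mu) GF (fun=> measurable_itv _) mG.
have cH := ge0_nondecreasing_set_cvg_integral (mu := mu) HF (fun=> measurable_itv _) mH.
rewrite -integral_itv_bndo_bndc; last by rewrite U2; apply/measurable_fun_bigcup.
rewrite -[RHS]integral_itv_bndo_bndc; last by rewrite U1; apply/measurable_fun_bigcup.
rewrite U1 U2.
have {}cG := cG _; have {}cH := cH _.
rewrite -(cvg_lim _ (cG _))//; last first.
  move=> n x /=; rewrite in_itv/= => /andP[x0 xb]; rewrite lee_fin divr_ge0 ?sqrtr_ge0// g0// x0.
  by rewrite ltW// (le_lt_trans xb).
rewrite -(cvg_lim _ (cH _))//; last first.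
  move=> n x /=; rewrite in_itv/= => /andP[x0 xb]; rewrite lee_fin g0//.
  by rewrite -{1}(@sin0 R) -sin_pihalf !ssin// (le_trans xb)// ltW.
congr (limn _); apply/funext => n.
by apply: sin_subst_lt; rewrite ?b0 ?b1.
Qed.

Definition legendre_delta k t : R := Num.sqrt (1 - k ^+ 2 * sin t ^+ 2).

Lemma ellE_trig k : 0 < k < 1 -> ellE k = \int[mu]_(t in `[0, pi / 2]) legendre_delta k t.
Proof.
move=> /andP[k0 k1]; rewrite /ellE (@sin_subst (fun x => Num.sqrt (1 - k ^+ 2 * x ^+ 2)))//.
move=> x _; apply: (@continuous_comp _ _ _ (fun x => 1 - k ^+ 2 * x ^+ 2) (@Num.sqrt R)); last exact: sqrt_continuous.
  by apply: cvgB; [exact: cvg_cst|apply: cvgMl_tmp; apply: cvgM; exact: cvg_id].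
Qed.

Lemma legendre_arg_ge k v x : 0 <= k <= v -> -1 <= x <= 1 -> 1 - v ^+ 2 <= 1 - k ^+ 2 * x ^+ 2.
Proof.
move=> /andP[k0 kv] /andP[x0 x1]; rewrite lerD2l lerN2 -[leRHS]mulr1 ler_pM ?sqr_ge0//.
  by rewrite ler_sqr ?nnegrE// (le_trans k0).
by rewrite -real_normK ?num_real// expr_le1// ler_norml x0.
Qed.

Lemma ellK_trig k : 0 < k < 1 -> ellK k = \int[mu]_(t in `[0, pi / 2]) (legendre_delta k t)^-1.
Proof.
move=> /andP[k0 k1]; rewrite /ellK.
rewrite (eq_itv_Rintegral (g := fun x => (Num.sqrt (1 - k ^+ 2 * x ^+ 2))^-1 / Num.sqrt (1 - x ^+ 2))); last first.
  by move=> x _; rewrite invfM mulrC.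
rewrite (@sin_subst (fun x => (Num.sqrt (1 - k ^+ 2 * x ^+ 2))^-1))//.
move=> x /andP[x0 x1]; apply: cvgV.
    have x2 : -1 <= x <= 1 by apply/andP; split; lra.
    rewrite gt_eqF// sqrtr_gt0 (lt_le_trans _ (@legendre_arg_ge k k x _ x2))//.
      by rewrite subr_gt0 expr_lt1 ?ltW.
    by rewrite lexx ltW.
  apply: (@continuous_comp _ _ _ (fun x => 1 - k ^+ 2 * x ^+ 2) (@Num.sqrt R)); last exact: sqrt_continuous.
  by apply: cvgB; [exact: cvg_cst|apply: cvgMl_tmp; apply: cvgM; exact: cvg_id].
Qed.

Lemma sin_bound t : -1 <= sin t <= 1.
Proof. by rewrite -ler_norml sin_max. Qed.

Lemma legendre_delta_gt0 k t : 0 <= k < 1 -> 0 < legendre_delta k t.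
Proof.
move=> /andP[k0 k1]; rewrite sqrtr_gt0 (lt_le_trans _ (@legendre_arg_ge k k _ _ (sin_bound t)))//.
  by rewrite subr_gt0 expr_lt1.
by rewrite k0 lexx.
Qed.

Lemma legendre_delta_continuous k : continuous (legendre_delta k).
Proof.
move=> t; apply: (@continuous_comp _ _ _ (fun t => 1 - k ^+ 2 * sin t ^+ 2) (@Num.sqrt R)); last exact: sqrt_continuous.
by apply: cvgB; [exact: cvg_cst|apply: cvgMl_tmp; apply: cvgM; exact: continuous_sin].
Qed.

Lemma is_derive_legendre_delta k t : 0 < k < 1 ->
  is_derive k 1 (fun k => legendre_delta k t) (- (k * sin t ^+ 2) / legendre_delta k t).
Proof.
move=> k01; have [k0 k1] := andP k01.
have d0 : 0 < legendre_delta k t by apply: legendre_delta_gt0; rewrite k1 ltW.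
have a0 : 0 < 1 - k ^+ 2 * sin t ^+ 2 by move: d0; rewrite sqrtr_gt0.
have dk : is_derive k 1 (fun k => 1 - k ^+ 2 * sin t ^+ 2 : R) (- (2 * k * sin t ^+ 2)).
  have := is_deriveB (is_derive_cst (1 : R) k 1)
    (is_deriveM (is_deriveX 2 (is_derive_id k (1 : R))) (is_derive_cst (sin t ^+ 2) k 1)).
  move/is_derive_eq; apply; rewrite /GRing.scale /= expr1; ring.
have := is_derive1_comp (f := Num.sqrt) (g := fun k => 1 - k ^+ 2 * sin t ^+ 2) (is_derive1_sqrt a0) dk.
move/is_derive_eq; apply; rewrite -/(legendre_delta k t).
by field; rewrite gt_eqF.
Qed.

Lemma is_derive_legendre_deltaV k t : 0 < k < 1 ->
  is_derive k 1 (fun k => (legendre_delta k t)^-1) (k * sin t ^+ 2 / legendre_delta k t ^+ 3).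
Proof.
move=> k01; have [k0 k1] := andP k01.
have d0 : 0 < legendre_delta k t by apply: legendre_delta_gt0; rewrite k1 ltW.
have := @is_deriveV R (fun k => legendre_delta k t) k _ 1 (lt0r_neq0 d0) (is_derive_legendre_delta t k01).
move/is_derive_eq; apply; rewrite /GRing.scale /=.
by field; rewrite gt_eqF.
Qed.


(** Differentiation under the integral sign. The derivative of the integrand may blow up as the
    modulus tends to 1, so a bound is required only on each ]0, v[ with v < 1. *)
Lemma elliptic_derive (f df : R -> R -> R) k : 0 < k < 1 ->
  (forall x, 0 < x < 1 -> continuous (f x)) ->
  (forall x t, 0 < x < 1 -> is_derive x 1 (fun x => f x t) (df x t)) ->
  (forall v, 0 < v < 1 -> exists C, forall x t, 0 < x < v -> `|df x t| <= C) ->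
  (fun x => \int[mu]_(t in `[0, pi / 2]) f x t)^`()%classic k =
  \int[mu]_(t in `[0, pi / 2]) df k t.
Proof.
move=> /andP[k0 k1] cf dff dfC.
pose v := (k + 1) / 2.
have v01 : 0 < v < 1 by apply/andP; split; rewrite /v; lra.
have [C HC] := dfC v v01.
have I01 x : x \in `]0, v[ -> 0 < x < 1.
  rewrite in_itv/= => /andP[-> xv]; rewrite (lt_trans xv)//; by case/andP: v01.
have Ik : `]0, v[%classic k by rewrite /= in_itv/= k0 /v; lra.
have d1E x t : 0 < x < 1 -> partial1of2 f x t = df x t.
  by move=> x01; rewrite partial1of2E; case: (dff x t x01).
have C0 : 0 <= C.
  have H : 0 < k < v by rewrite k0 /v; lra.
  exact: le_trans (normr_ge0 _) (HC k 0 H).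
have /= -> := @differentiation_under_integral R _ _ mu f `[0, pi / 2]%classic (measurable_itv _) k 0 v Ik _ _ (cst C).
- by apply: eq_Rintegral => t _; rewrite /= d1E// k0.
- by move=> x /I01 x01; apply: quarter_integrable; exact: cf.
- by move=> x t /I01 x01 _; case: (dff x t x01).
- by [].
- by apply: quarter_integrable => x; exact: cvg_cst.
- move=> x t xv _; rewrite d1E ?I01//; apply: HC.
  by move: xv; rewrite /= in_itv.
Qed.

Lemma near_unit_itv k : 0 < k < 1 -> \forall x \near k, 0 < x < 1.
Proof.
move=> k01; have : k \in `]0, 1[ by rewrite in_itv.
by move/near_in_itvoo; apply: filterS => x; rewrite in_itv.
Qed.

Lemma derive1_ellE k : 0 < k < 1 -> (@ellE R)^`()%classic k =
  - (k * \int[mu]_(t in `[0, pi / 2]) (sin t ^+ 2 / legendre_delta k t)).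
Proof.
move=> k01; have [k0 k1] := andP k01.
rewrite derive1E (@near_eq_derive _ _ _ _ (fun x => \int[mu]_(t in `[0, pi / 2]) legendre_delta x t)); last first.
  by near=> x; apply: ellE_trig; near: x; exact: near_unit_itv.
have dff x t (x01 : 0 < x < 1) := is_derive_legendre_delta t x01.
rewrite -derive1E (@elliptic_derive legendre_delta _ k k01 _ dff)//.
- have cs : continuous (fun t => sin t ^+ 2 / legendre_delta k t).
    move=> t; apply: cvgM; first by apply: cvgM; exact: continuous_sin.
    by apply: cvgV; [rewrite gt_eqF// legendre_delta_gt0// k1 ltW|exact: legendre_delta_continuous].
  rewrite -mulNr -RintegralZl//; last exact: quarter_integrable.
  by apply: eq_Rintegral => t _; ring.
- by move=> x _; exact: legendre_delta_continuous.
- move=> v /andP[v0 v1]; exists (Num.sqrt (1 - v ^+ 2))^-1 => x t /andP[x0 xv].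
  have w0 : 0 < 1 - v ^+ 2 by rewrite subr_gt0 expr_lt1// ltW.
  rewrite normrM normrN normfV -[leRHS]mul1r ler_pM//.
    rewrite normrM mulr_ile1//; first by rewrite gtr0_norm// ltW// (lt_trans xv).
    by rewrite normrX expr_le1// sin_max.
  rewrite ger0_norm ?sqrtr_ge0// lef_pV2 ?posrE ?sqrtr_gt0//.
    by apply: ler_wsqrtr; apply: legendre_arg_ge (sin_bound t); rewrite ltW//= ltW.
  by rewrite (lt_le_trans w0)//; apply: legendre_arg_ge (sin_bound t); rewrite ltW//= ltW.
Unshelve. all: by end_near. Qed.

Lemma derive1_ellK k : 0 < k < 1 -> (@ellK R)^`()%classic k =
  k * \int[mu]_(t in `[0, pi / 2]) (sin t ^+ 2 / legendre_delta k t ^+ 3).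
Proof.
move=> k01; have [k0 k1] := andP k01.
rewrite derive1E (@near_eq_derive _ _ _ _ (fun x => \int[mu]_(t in `[0, pi / 2]) (legendre_delta x t)^-1)); last first.
  by near=> x; apply: ellK_trig; near: x; exact: near_unit_itv.
have dff x t (x01 : 0 < x < 1) := is_derive_legendre_deltaV t x01.
rewrite -derive1E (@elliptic_derive (fun x t => (legendre_delta x t)^-1) _ k k01 _ dff)//.
- have cs : continuous (fun t => sin t ^+ 2 / legendre_delta k t ^+ 3).
    move=> t; apply: cvgM; first by apply: cvgM; exact: continuous_sin.
    apply: cvgV; first by rewrite gt_eqF// exprn_gt0// legendre_delta_gt0// k1 ltW.
    apply: cvgM; first exact: legendre_delta_continuous.
    by apply: cvgM; exact: legendre_delta_continuous.
  rewrite -RintegralZl//; last exact: quarter_integrable.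
  by apply: eq_Rintegral => t _; rewrite mulrA.
- move=> x /andP[x0 x1] t; apply: cvgV; last exact: legendre_delta_continuous.
  by rewrite gt_eqF// legendre_delta_gt0// x1 ltW.
- move=> v /andP[v0 v1]; exists (Num.sqrt (1 - v ^+ 2) ^+ 3)^-1 => x t /andP[x0 xv].
  have w0 : 0 < 1 - v ^+ 2 by rewrite subr_gt0 expr_lt1// ltW.
  have x01 : 0 <= x < 1 by rewrite (ltW x0) (lt_trans xv).
  have d0 := legendre_delta_gt0 t x01.
  rewrite normrM normfV -[leRHS]mul1r ler_pM//.
    rewrite normrM mulr_ile1//; first by rewrite gtr0_norm// ltW// (lt_trans xv).
    by rewrite normrX expr_le1// sin_max.
  rewrite ger0_norm ?exprn_ge0 ?(ltW d0)// lef_pV2 ?posrE ?exprn_gt0 ?sqrtr_gt0//.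
  rewrite ler_pXn2r ?nnegrE ?sqrtr_ge0//.
  by apply: ler_wsqrtr; apply: legendre_arg_ge (sin_bound t); rewrite ltW//= ltW.
  by move: d0; rewrite sqrtr_gt0.
Unshelve. all: by end_near. Qed.

Lemma is_derive_delta m t : 0 < m ->
  is_derive t 1 (delta m) ((m ^+ 2 - 1) * sin t * cos t / delta m t).
Proof.
move=> m0; have d0 : 0 < delta m t by apply: delta_gt0; rewrite gt_eqF.
have a0 : 0 < cos t ^+ 2 + m ^+ 2 * sin t ^+ 2 by move: d0; rewrite sqrtr_gt0.
have dt : is_derive t 1 (fun t => cos t ^+ 2 + m ^+ 2 * sin t ^+ 2 : R) (2 * (m ^+ 2 - 1) * sin t * cos t).
  have := is_deriveD (is_deriveX 2 (is_derive_cos t))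
    (is_deriveM (is_derive_cst (m ^+ 2) t 1) (is_deriveX 2 (is_derive_sin t))).
  move/is_derive_eq; apply; rewrite /GRing.scale /= !expr1; ring.
have := is_derive1_comp (f := Num.sqrt) (g := fun t => cos t ^+ 2 + m ^+ 2 * sin t ^+ 2) (is_derive1_sqrt a0) dt.
move/is_derive_eq; apply; rewrite -/(delta m t).
by field; rewrite gt_eqF.
Qed.

(* [sin * cos / delta] is a primitive of the difference of the two integrands
   and vanishes at both endpoints. *)
Lemma quarter_cos_cube m : 0 < m ->
  quarter_cos m = m ^+ 2 * \int[mu]_(t in `[0, pi / 2]) (sin t ^+ 2 / delta m t ^+ 3).
Proof.
move=> m0; have pi0 := pi_gt0 R.
have d0 t : 0 < delta m t by apply: delta_gt0; rewrite gt_eqF.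
have c3 : continuous (fun t => sin t ^+ 2 / delta m t ^+ 3).
  move=> t; apply: cvgM; first by apply: cvgM; exact: continuous_sin.
  apply: cvgV; first by rewrite gt_eqF// exprn_gt0.
  apply: cvgM; first exact: delta_continuous.
  by apply: cvgM; exact: delta_continuous.
have mc3 : continuous (fun t => m ^+ 2 * (sin t ^+ 2 / delta m t ^+ 3)).
  by move=> t; apply: cvgMl_tmp; exact: c3.
have cc := @cos2_delta_continuous R m.
rewrite -RintegralZl//; last exact: quarter_integrable.
apply/eqP; rewrite -subr_eq0; apply/eqP.
rewrite -(itv_RintegralB (within_continuous cc) (within_continuous mc3)).
have dF t : is_derive t 1 (fun t => sin t * cos t * (delta m t)^-1 : R)
    (cos t ^+ 2 / delta m t - m ^+ 2 * (sin t ^+ 2 / delta m t ^+ 3)).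
  have := is_deriveM (is_deriveM (is_derive_sin t) (is_derive_cos t))
    (is_deriveV (lt0r_neq0 (d0 t)) (is_derive_delta t m0)).
  move/is_derive_eq; apply; rewrite /GRing.scale /=.
  have d2 := delta_sqr m t; have cs := cos2Dsin2 t.
  have dn0 := lt0r_neq0 (d0 t).
  apply: (mulIf (expf_neq0 3 dn0)).
  have -> : (sin t * cos t * (- delta m t ^- 2 * ((m ^+ 2 - 1) * sin t * cos t / delta m t)) +
    (delta m t)^-1 * (sin t * - sin t + cos t * cos t)) * delta m t ^+ 3 =
    (1 - m ^+ 2) * (sin t ^+ 2 * cos t ^+ 2) + (cos t ^+ 2 - sin t ^+ 2) * delta m t ^+ 2 by field.
  have -> : (cos t ^+ 2 / delta m t - m ^+ 2 * (sin t ^+ 2 / delta m t ^+ 3)) * delta m t ^+ 3 =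
    cos t ^+ 2 * delta m t ^+ 2 - m ^+ 2 * sin t ^+ 2 by field.
  by rewrite d2 cos2sin2; ring.
rewrite (@Rintegral_FTC _ (fun t => sin t * cos t * (delta m t)^-1))//.
- by rewrite cos_pihalf sin0 mulr0 !mul0r subrr.
- by rewrite divr_ge0// ltW.
- by apply: within_continuousB; exact: within_continuous.
Qed.

Lemma legendre_delta_tan m t : 0 <= m <= 1 ->
  legendre_delta (Num.sqrt (1 - m ^+ 2)) t = delta m t.
Proof.
move=> /andP[m0 m1]; rewrite /legendre_delta /delta sqr_sqrtr; last first.
  by rewrite subr_ge0 expr_le1.
by congr Num.sqrt; rewrite cos2sin2; ring.
Qed.

(** For k^2 = 1 - tan^2 theta, Legendre's Delta of modulus k is [delta (tan theta)]. Then K'(k) / k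
    and - E'(k) / k are the integrals of sin^2 / Delta^3 and sin^2 / Delta; the second is
    [quarter_sin] up to the factor tan theta, and [quarter_cos_cube] turns the first into
    [quarter_cos]. *)
Lemma ext_elliptic theta : 0 < theta < pi / 4 ->
  let k := Num.sqrt (1 - tan theta ^+ 2) in
  ext_re theta = 4 * tan theta / (pi * k) * ((@ellK R)^`()%classic k * tan theta) /\
  ext_im theta = 4 * tan theta / (pi * k) * - (@ellE R)^`()%classic k.
Proof.
move=> /andP[t0 t1]; have pi0 := pi_gt0 R.
have th : 0 <= theta <= pi / 4 by rewrite !ltW.
have /andP[m0 m1] : 0 < tan theta < 1.
  have I (x : R) : 0 <= x -> x <= pi / 4 -> x \in `](- (pi / 2)), (pi / 2)[.
    by move=> x0 x1; rewrite in_itv/=; apply/andP; split; lra.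
  have p4 : 0 <= pi / 4 :> R by lra.
  apply/andP; split.
    by rewrite -[ltLHS]tan0 ltr_tan// I// ltW.
  by rewrite -[ltRHS]tan_piquarter ltr_tan// I// ltW.
move=> k.
have m01 : 0 <= tan theta <= 1 by rewrite !ltW.
have k2 : k ^+ 2 = 1 - tan theta ^+ 2 by rewrite sqr_sqrtr// subr_ge0 expr_le1// ltW.
have k0 : 0 < k by rewrite sqrtr_gt0 subr_gt0 expr_lt1// ltW.
have k1 : k < 1.
  by rewrite -(@expr_lt1 _ 2) ?(ltW k0)// k2 gtrBl exprn_gt0.
have k01 : 0 < k < 1 by rewrite k0.
have dE t : legendre_delta k t = delta (tan theta) t by exact: legendre_delta_tan.
rewrite ext_reE// ext_imE// derive1_ellK// derive1_ellE//; split.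
- rewrite quarter_cos_cube//.
  rewrite (eq_itv_Rintegral (f := fun t => sin t ^+ 2 / legendre_delta k t ^+ 3) (g := fun t => sin t ^+ 2 / delta (tan theta) t ^+ 3)); last by move=> t _; rewrite dE.
  move: (\int[mu]_(t in _) _) => I.
  move: (lt0r_neq0 pi0) (lt0r_neq0 k0); move: (pi : R) (k) => p q p0 q0.
  by field; rewrite p0 q0.
- rewrite (eq_itv_Rintegral (f := fun t => sin t ^+ 2 / legendre_delta k t) (g := fun t => sin t ^+ 2 / delta (tan theta) t)); last by move=> t _; rewrite dE.
  have -> : quarter_sin (tan theta) = tan theta * \int[mu]_(t in `[0, pi / 2]) (sin t ^+ 2 / delta (tan theta) t).
    rewrite -RintegralZl//; first by apply: eq_Rintegral => t _; rewrite mulrA.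
    apply: quarter_integrable => t; apply: cvgM; first by apply: cvgM; exact: continuous_sin.
    by apply: cvgV; [rewrite gt_eqF// delta_gt0// gt_eqF|exact: delta_continuous].
  move: (\int[mu]_(t in _) _) => I.
  move: (lt0r_neq0 pi0) (lt0r_neq0 k0); move: (pi : R) (k) => p q p0 q0.
  by field; rewrite p0 q0.
Qed.

End Elliptic.

(** * The Kobayashi metric of the tube over the ball *)

Section NormalForm.
Context {R : realType} {n : nat}.
Implicit Types (X Y P Q p q : 'rV[R]_n) (u : R[i]).

Lemma csumE (I : Type) (s : seq I) (A B : I -> R) :
  \sum_(j <- s) (A j +i* B j) = (\sum_(j <- s) A j) +i* (\sum_(j <- s) B j).
Proof.
elim: s => [|j s IH]; first by rewrite !big_nil.
by rewrite !big_cons IH; simpc.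
Qed.

Lemma dot_ge0 X : 0 <= dot X X.
Proof. by apply: sumr_ge0 => j _; rewrite -expr2 sqr_ge0. Qed.

Lemma enorm_sqr X : enorm X ^+ 2 = dot X X.
Proof. by rewrite sqr_sqrtr// dot_ge0. Qed.

Lemma dot_eq0 X : dot X X = 0 -> X = 0.
Proof.
move=> X0; apply/rowP => j; rewrite mxE.
have := psumr_eq0P (P := xpredT) (fun i _ => sqr_ge0 (X 0 i)).
have E : \sum_i X 0 i ^+ 2 = 0 by rewrite -[RHS]X0; apply: eq_bigr => i _; rewrite expr2.
by move=> /(_ E j isT)/eqP; rewrite sqrf_eq0 => /eqP.
Qed.

Lemma dotZl (c : R) X Y : dot (c *: X) Y = c * dot X Y.
Proof. by rewrite /dot mulr_sumr; apply: eq_bigr => j _; rewrite !mxE mulrA. Qed.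

Lemma dotC X Y : dot X Y = dot Y X.
Proof. by apply: eq_bigr => j _; rewrite mulrC. Qed.

Lemma dotDl X Y Z : dot (X + Y) Z = dot X Z + dot Y Z.
Proof. by rewrite /dot -big_split; apply: eq_bigr => j _; rewrite !mxE mulrDl. Qed.

Lemma dot_combo (a b : R) X Y : dot (a *: X + b *: Y) (a *: X + b *: Y) =
  a ^+ 2 * dot X X + 2 * a * b * dot X Y + b ^+ 2 * dot Y Y.
Proof.
rewrite dotDl !dotZl [dot X _]dotC [dot Y (_ + _)]dotC !dotDl !dotZl (dotC Y X); ring.
Qed.

Lemma cauchy_schwarz X Y : dot X Y <= enorm X * enorm Y.
Proof.
apply: (le_trans (ler_norm _)).
rewrite -(@ler_pXn2r _ 2) ?nnegrE ?mulr_ge0 ?sqrtr_ge0// real_normK ?num_real//.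
rewrite exprMn !enorm_sqr.
have [X0|X0] := eqVneq (dot X X) 0.
  rewrite (dot_eq0 X0) -[0 : 'rV_n](scale0r Y) !dotZl !mul0r expr0n //.
have {}X0 : 0 < dot X X by rewrite lt_neqAle eq_sym X0 dot_ge0.
have := dot_ge0 ((- dot X Y) *: X + dot X X *: Y); rewrite dot_combo.
have -> : (- dot X Y) ^+ 2 * dot X X + 2 * - dot X Y * dot X X * dot X Y + dot X X ^+ 2 * dot Y Y
  = dot X X * (dot X X * dot Y Y - dot X Y ^+ 2) by ring.
by rewrite pmulr_rge0// subr_ge0.
Qed.

(** This bilinear square, taken without conjugation, is multiplied by u^2 when the vector is
    multiplied by u; its modulus is the inner square root in [alpha] and [beta]. *)
Lemma sum_sqr_cvec X Y : \sum_j (X 0 j +i* Y 0 j) ^+ 2 =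
  (dot X X - dot Y Y) +i* (2 * dot X Y).
Proof.
have E j : (X 0 j +i* Y 0 j) ^+ 2 = (X 0 j * X 0 j - Y 0 j * Y 0 j) +i* (2 * (X 0 j * Y 0 j)).
  by rewrite expr2; simpc; congr (_ +i* _); ring.
rewrite (eq_bigr _ (fun j _ => E j)) csumE -mulr_sumr; congr (_ +i* _).
by rewrite sumrB.
Qed.

Lemma sum_normc_cvec X Y : \sum_j normc (X 0 j +i* Y 0 j) ^+ 2 = dot X X + dot Y Y.
Proof.
rewrite /dot -big_split; apply: eq_bigr => j _ /=.
by rewrite sqr_sqrtr ?addr_ge0 ?sqr_ge0.
Qed.

(** A square root of s / |s|; for s = 0 any unit number does. *)
Lemma unit_sqrt (s : R[i]) : exists2 u : R[i], normc u = 1 & u ^+ 2 * (normc s)%:C = s.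
Proof.
have [->|s0] := eqVneq s 0.
  by exists 1; rewrite ?Normc.normc1// Normc.normc0 mulr0.
exists (sqrtc (s / (normc s)%:C)).
  apply/eqP; rewrite -(@eqrXn2 _ 2) ?normc_ge0//.
  rewrite expr2 -normcM -expr2 sqr_sqrtc normcM normcV normc_real expr1n ger0_norm ?normc_ge0//.
  by rewrite divff// normc_eq0.
rewrite sqr_sqrtc mulfVK//.
by apply: contra s0 => /eqP[] /eqP; rewrite normc_eq0.
Qed.

Lemma unit_conj u : normc u = 1 -> u * conjc u = 1.
Proof.
case: u => a b /= ab.
have ab2 : a ^+ 2 + b ^+ 2 = 1.
  by rewrite -(sqr_sqrtr (a := a ^+ 2 + b ^+ 2)) ?ab ?expr1n// addr_ge0 ?sqr_ge0.
by apply/eqP; rewrite eq_complex /=; apply/andP; split; apply/eqP; [rewrite -ab2|]; ring.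
Qed.

Lemma normc_conj u : normc (conjc u) = normc u.
Proof. by case: u => a b /=; rewrite sqrrN. Qed.

(* Multiplying [X + iY] by a suitable unit complex number makes the sum of the
   squares of its coordinates nonnegative, i.e., its real and imaginary parts
   orthogonal, the former being the longer one. *)
Lemma normal_form X Y : cvec X Y != 0 -> exists u p q,
  [/\ normc u = 1, dot p p = 1, dot p q = 0,
      dot q q <= 1 /\ beta X Y * dot q q = beta X Y
    & 0 < alpha X Y /\ cvec X Y = u *: cvec (alpha X Y *: p) (beta X Y *: q)].
Proof.
move=> XY0; pose s := \sum_j (X 0 j +i* Y 0 j) ^+ 2.
have [u u1 us] := unit_sqrt s.
have uu := unit_conj u1.
pose w j := conjc u * (X 0 j +i* Y 0 j).
pose P : 'rV[R]_n := \row_j complex.Re (w j).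
pose Q : 'rV[R]_n := \row_j complex.Im (w j).
have PQ j : P 0 j +i* Q 0 j = w j by rewrite !mxE; case: (w j).
have S : \sum_j (P 0 j +i* Q 0 j) ^+ 2 = (normc s)%:C.
  rewrite (eq_bigr (fun j => conjc u ^+ 2 * (X 0 j +i* Y 0 j) ^+ 2)); last first.
    by move=> j _; rewrite PQ exprMn.
  by rewrite -mulr_sumr -/s -[s in LHS]us mulrA -exprMn [_ * u]mulrC uu expr1n mul1r.
have N : dot P P + dot Q Q = dot X X + dot Y Y.
  rewrite -!sum_normc_cvec; apply: eq_bigr => j _.
  by rewrite PQ normcM normc_conj u1 mul1r.
(* This reads |P|^2 - |Q|^2 = |s| and <P, Q> = 0; together with [N] it identifies |P| and |Q| with
   [alpha] and [beta]. *)
move: S; rewrite sum_sqr_cvec => -[S1 S2].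
have sE : normc s = Num.sqrt (4 * dot X Y ^+ 2 + (enorm X ^+ 2 - enorm Y ^+ 2) ^+ 2).
  by rewrite /s sum_sqr_cvec /= !enorm_sqr; congr Num.sqrt; ring.
have aE : alpha X Y = enorm P.
  by rewrite /alpha -sE !enorm_sqr -N -S1 /enorm; congr Num.sqrt; field.
have bE : beta X Y = enorm Q.
  by rewrite /beta -sE !enorm_sqr -N -S1 /enorm; congr Num.sqrt; field.
have s0 := normc_ge0 s.
have P0 : 0 < dot P P.
  rewrite lt_neqAle dot_ge0 andbT eq_sym; apply/eqP => P0.
  move/eqP : XY0; apply.
  have Q0 := dot_ge0 Q; have X0 := dot_ge0 X; have Y0 := dot_ge0 Y.
  have XX : dot X X = 0 by lra.
  have YY : dot Y Y = 0 by lra.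
  by apply/rowP => j; rewrite (dot_eq0 XX) (dot_eq0 YY) !mxE.
have nP0 : 0 < enorm P by rewrite sqrtr_gt0.
have wE j : cvec X Y 0 j = u * (P 0 j +i* Q 0 j) by rewrite PQ /w mulrA uu mul1r !mxE.
(* If Q = 0, a unit vector orthogonal to P need not exist; with q = 0 the identity
   [beta X Y * dot q q = beta X Y] survives, as beta is 0 too. *)
exists u, ((enorm P)^-1 *: P), (if enorm Q == 0 then 0 else (enorm Q)^-1 *: Q).
rewrite aE bE.
have pp : dot ((enorm P)^-1 *: P) ((enorm P)^-1 *: P) = 1.
  rewrite dotZl dotC dotZl -enorm_sqr.
  by field; rewrite gt_eqF.
have d0 Z : dot (0 : 'rV[R]_n) Z = 0 by rewrite -(scale0r Z) dotZl mul0r.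
have vE : cvec X Y = u *: cvec (enorm P *: ((enorm P)^-1 *: P)) Q.
  by apply/rowP => j; rewrite wE !mxE; rewrite mulVKf ?gt_eqF.
case: eqP => [Q0|/eqP Q0].
- have QQ : Q = 0 by apply: dot_eq0; rewrite -enorm_sqr Q0 expr0n.
  split => //; [by rewrite dotC d0|by rewrite d0 ler01 mulr0 Q0|].
  by split => //; rewrite vE QQ scaler0.
- have qq : dot ((enorm Q)^-1 *: Q) ((enorm Q)^-1 *: Q) = 1.
    by rewrite dotZl dotC dotZl -enorm_sqr; field.
  split => //.
  + have PQ0 : dot P Q = 0 by lra.
    by rewrite dotZl [dot P _]dotC dotZl [dot Q P]dotC PQ0 !mulr0.
  + by rewrite qq lexx mulr1.
  + have QE : enorm Q *: ((enorm Q)^-1 *: Q) = Q by rewrite scalerA divff// scale1r.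
    by split => //; rewrite QE.
Qed.

End NormalForm.

(** * Upper and lower bounds for the metric *)

Section KobayashiTube.
Context {R : realType}.
Notation mu := (@lebesgue_measure R).
Implicit Types (theta r t : R) (u z w l : R[i]).

Lemma unit_discE z : unit_disc z <-> normc z < 1.
Proof. by rewrite /unit_disc /= normcE -[1](rmorph1 (real_complex R)) ltcR. Qed.

Lemma fext0 theta (j : 'I_2) : 0 <= theta <= pi / 4 -> fext theta 0 0 j = 0.
Proof.
move=> th; rewrite fextE /schwarz.
rewrite (eq_cintegral (g := fun t => (ext_dir theta j t)%:C)); last first.
  by move=> t _; rewrite addr0 subr0 divff ?cis_neq0// mul1r.
rewrite /cintegral /= ext_dir_mean0//.
by rewrite Rintegral_cst// mul0r mulr0.
Qed.

Lemma fext_holo theta (j : 'I_2) z : 0 <= theta <= pi / 4 -> normc z < 1 ->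
  holo (fun w => fext theta w 0 j) z.
Proof.
move=> th z1; rewrite (_ : (fun w => _) = (fun w => ((2 * pi)^-1)%:C * schwarz (ext_dir theta j) w)).
  have D := schwarz_cder (ext_dir_measurable j th) (ext_dir_norm_le1 theta j) z1.
  by eexists; apply: cderZ; exact: D.
by apply/funext => w; rewrite fextE.
Qed.

Lemma fext_cder0 theta : 0 <= theta <= pi / 4 ->
  cder (fun w => fext theta w 0 0) 0 (ext_re theta)%:C /\
  cder (fun w => fext theta w 0 1) 0 ('i%C * (ext_im theta)%:C).
Proof.
move=> /fext_is_derive/(is_derive_mxP (fext theta) 0) H.
by split; [have := H 0 0|have := H 0 1]; rewrite mxE.
Qed.

Lemma fext_Re_le1 theta z : 0 <= theta <= pi / 4 -> normc z < 1 ->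
  complex.Re (fext theta z 0 0) ^+ 2 + complex.Re (fext theta z 0 1) ^+ 2 <= 1.
Proof.
move=> th z1; have pi0 := pi_gt0 R.
have := schwarz_unit_disc (ext_dir_measurable 0 th) (ext_dir_measurable 1 th) (ext_dir_le1 theta) z1.
have ReZ (c : R) w : complex.Re (c%:C * w) = c * complex.Re w.
  by case: w => a b /=; rewrite mul0r subr0.
rewrite !fextE !ReZ !exprMn -mulrDr => H.
have p2 : 0 < (2 * pi : R) ^+ 2 by rewrite exprn_gt0// mulr_gt0.
by rewrite exprVn mulrC ler_pdivrMr// mul1r exprMn.
Qed.

Lemma cder_comp f g z l m : cder f z l -> cder g (f z) m -> cder (g \o f) z (m * l).
Proof.
move=> df dg e e0.
pose M := 1 + normc l.
have M0 : 0 < M by rewrite ltr_wpDr ?normc_ge0.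
have N0 : 0 < 1 + normc m by rewrite ltr_wpDr ?normc_ge0.
have [d1 d10 H1] := dg _ (divr_gt0 e0 (mulr_gt0 (ltr0Sn R 1) M0)).
have [d2 d20 H2] := df _ (divr_gt0 e0 (mulr_gt0 (ltr0Sn R 1) N0)).
have [d3 d30 H3] := df 1 ltr01.
exists (Num.min (Num.min d2 d3) (d1 / M)); first by rewrite !lt_min d20 d30 divr_gt0.
move=> h; rewrite !lt_min => /andP[/andP[hd2 hd3] hd1] /=.
pose k := f (z + h) - f z.
have kM : normc k <= M * normc h.
  rewrite -(subrK (l * h) k) (le_trans (normcD _ _))// /M mulrDl mul1r lerD//; last by rewrite normcM.
  by have := H3 h hd3; rewrite mul1r.
have kd1 : normc k < d1 by rewrite (le_lt_trans kM)// mulrC -ltr_pdivlMr.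
have -> : g (f (z + h)) - g (f z) - m * l * h =
  (g (f z + k) - g (f z) - m * k) + m * (k - l * h).
  by rewrite /k [f z + _]addrC subrK; ring.
rewrite (le_trans (normcD _ _))// (splitr e) mulrDl lerD//.
  apply: (le_trans (H1 _ kd1)).
  apply: (@le_trans _ _ (e / (2 * M) * (M * normc h))).
    by rewrite ler_wpM2l// divr_ge0 ?ltW// mulr_gt0.
  by rewrite le_eqVlt; apply/orP; left; apply/eqP; field; rewrite gt_eqF.
rewrite normcM; apply: (@le_trans _ _ (normc m * (e / (2 * (1 + normc m)) * normc h))).
  by rewrite ler_wpM2l ?normc_ge0//; exact: H2.
have -> : normc m * (e / (2 * (1 + normc m)) * normc h) = (normc m / (1 + normc m)) * (e / 2 * normc h).
  by field; rewrite gt_eqF.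
by rewrite ler_piMl ?mulr_ge0 ?normc_ge0 ?divr_ge0 ?ltW// ltr_pdivrMr// mul1r ltrDr.
Qed.

Lemma cder_mulr u z : cder (fun w => u * w) z u.
Proof.
move=> e e0; exists 1 => // h _.
have -> : u * (z + h) - u * z - u * h = 0 by ring.
by rewrite Normc.normc0 mulr_ge0 ?normc_ge0// ltW.
Qed.

Lemma cderD f g z l m : cder f z l -> cder g z m -> cder (fun w => f w + g w) z (l + m).
Proof.
move=> df dg e e0; have e2 : 0 < e / 2 by rewrite divr_gt0.
have [d1 d10 H1] := df _ e2; have [d2 d20 H2] := dg _ e2.
exists (Num.min d1 d2); first by rewrite lt_min d10.
move=> h; rewrite lt_min => /andP[h1 h2].
have -> : f (z + h) + g (z + h) - (f z + g z) - (l + m) * h =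
  (f (z + h) - f z - l * h) + (g (z + h) - g z - m * h) by ring.
by rewrite (le_trans (normcD _ _))// (splitr e) mulrDl lerD ?H1 ?H2.
Qed.

(* Extremal discs of a tube only have [enorm (re_vec _) <= 1], so they are shrunk
   by a factor [s < 1]. *)
Lemma kobayashi_le n (G : set 'rV[R[i]]_n) (v df : 'rV[R[i]]_n) r
    (f : R -> R[i] -> 'rV[R[i]]_n) :
  0 < r ->
  (forall s, 0 < s < 1 -> [/\ forall w, normc w < 1 -> forall j, holo (fun w => f s w 0 j) w,
     forall w, normc w < 1 -> G (f s w), f s 0 = 0
     & forall j, cder (fun w => f s w 0 j) 0 (s%:C * df 0 j)]) ->
  v = r%:C *: df -> (kobayashi G 0 v <= r%:E)%E.
Proof.
move=> r0 H vE; apply/lee_addgt0Pr => e e0.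
have re0 : 0 < r + e by rewrite addr_gt0.
(* Chosen so that [(r + e) * s = r]: the shrunken disc still has the prescribed derivative for the
   parameter [r + e]. *)
pose s := r / (r + e).
have s0 : 0 < s by rewrite divr_gt0.
have s01 : 0 < s < 1 by rewrite s0 ltr_pdivrMr// mul1r ltrDl.
have [hf Gf f0 dfs] := H s s01.
apply: ereal_inf_lbound; exists (r + e); rewrite ?EFinD//=.
split=> //; exists (f s); split => //.
- move=> z /unit_discE z1.
  have dz j : exists l, cder (fun w => f s w 0 j) z l by exact: hf.
  have [L HL] := choice dz.
  have : is_derive (z : R[i]^o) 1 (f s : R[i]^o -> 'rV[R[i]]_n) (\row_j L j).
    by apply/(is_derive_mxP (f s) z) => i j; rewrite ord1 mxE.
  by case.
- by move=> w /unit_discE; exact: Gf.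
- have : is_derive (0 : R[i]^o) 1 (f s : R[i]^o -> 'rV[R[i]]_n) (s%:C *: df).
    by apply/(is_derive_mxP (f s) 0) => i j; rewrite ord1 mxE.
  case=> _; rewrite /cderive => ->.
  rewrite vE scalerA -rmorphM /= /s.
  by congr (_%:C *: _); field; rewrite gt_eqF.
Qed.

(** The plane map f_theta is carried into C^n by the real vectors p and q, so that taking real parts
    commutes with it, and precomposition with z -> u z puts the factor u on the derivative. *)
Lemma kobayashi_tube_le n (p q : 'rV[R]_n) u theta r : normc u = 1 ->
  dot p p <= 1 -> dot q q <= 1 -> dot p q = 0 -> 0 <= theta <= pi / 4 -> 0 < r ->
  (kobayashi (tube unit_ball) 0
    (u *: cvec ((r * ext_re theta) *: p) ((r * ext_im theta) *: q)) <= r%:E)%E.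
Proof.
move=> u1 p1 q1 pq th r0.
pose F (s : R) (z : R[i]) : 'rV[R[i]]_n := \row_j (s%:C *
  ((p 0 j)%:C * fext theta (u * z) 0 0 + (q 0 j)%:C * fext theta (u * z) 0 1)).
have FE s z j : F s z 0 j = s%:C *
    ((p 0 j)%:C * fext theta (u * z) 0 0 + (q 0 j)%:C * fext theta (u * z) 0 1).
  by rewrite mxE.
pose dF : 'rV[R[i]]_n := u *: cvec (ext_re theta *: p) (ext_im theta *: q).
apply: (@kobayashi_le n _ _ dF r F) => //.
- move=> s /andP[s0 s1]; split.
  + move=> w w1 j; under eq_fun do rewrite FE.
    have uw : normc (u * w) < 1 by rewrite normcM u1 mul1r.
    have [l0 d0] := fext_holo 0 th uw; have [l1 d1] := fext_holo 1 th uw.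
    have du := cder_mulr u w.
    eexists; apply: cderZ; apply: cderD; apply: cderZ.
      exact: cder_comp du d0.
    exact: cder_comp du d1.
  + move=> w w1; have uw : normc (u * w) < 1 by rewrite normcM u1 mul1r.
    have := fext_Re_le1 th uw.
    set A := complex.Re (fext theta (u * w) 0 0); set B := complex.Re (fext theta (u * w) 0 1) => AB.
    have -> : tube unit_ball (F s w) = (enorm (s *: (A *: p + B *: q)) < 1) :> Prop.
      congr (is_true (enorm _ < 1)); apply/rowP => j.
      transitivity (s * (A * p 0 j + B * q 0 j)); last by rewrite !mxE.
      rewrite mxE FE /A /B.
      case: (fext theta (u * w) 0 0) (fext theta (u * w) 0 1) => a b [c d] /=; ring.
    rewrite -(@expr_lt1 _ 2) ?sqrtr_ge0// enorm_sqr dotZl dotC dotZl dot_combo pq mulr0 addr0.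
    apply: (@le_lt_trans _ _ (s * s * 1)).
      rewrite -mulrA !ler_pM2l//.
      apply: le_trans AB; apply: lerD.
        by rewrite -[leRHS]mulr1 ler_wpM2l ?sqr_ge0.
      by rewrite -[leRHS]mulr1 ler_wpM2l ?sqr_ge0.
    by rewrite mulr1 mulr_ilt1// ltW.
  + by apply/rowP => j; rewrite FE [RHS]mxE mulr0 !fext0// !mulr0 addr0 mulr0.
  + move=> j; rewrite (_ : (fun w => F s w 0 j) = fun w => s%:C *
      ((p 0 j)%:C * fext theta (u * w) 0 0 + (q 0 j)%:C * fext theta (u * w) 0 1));
      last by apply/funext => z; rewrite FE.
    apply: cderZ.
    have [d0 d1] := fext_cder0 th.
    have du := cder_mulr u 0.
    have -> : dF 0 j = (p 0 j)%:C * ((ext_re theta)%:C * u) + (q 0 j)%:C * ('i%C * (ext_im theta)%:C * u).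
      rewrite !mxE; case: (u) => a b; simpc; congr (_ +i* _); ring.
    apply: cderD; apply: cderZ.
      by apply: (cder_comp du (g := fun w => fext theta w 0 0)); rewrite mulr0.
    by apply: (cder_comp du (g := fun w => fext theta w 0 1)); rewrite mulr0.
- apply/rowP => j; rewrite !mxE.
  by case: (u) => a b; simpc; congr (_ +i* _); ring.
Qed.

Definition tends0 f l := forall e : R, 0 < e -> exists2 d : R, 0 < d &
  forall z, 0 < normc z < d -> normc (f z - l) <= e.

Lemma tends0D f g l m : tends0 f l -> tends0 g m -> tends0 (fun z => f z + g z) (l + m).
Proof.
move=> fl gm e e0; have e2 : 0 < e / 2 by rewrite divr_gt0.
have [d1 d10 H1] := fl _ e2; have [d2 d20 H2] := gm _ e2.
exists (Num.min d1 d2); first by rewrite lt_min d10.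
move=> z /andP[z0]; rewrite lt_min => /andP[z1 z2].
have -> : f z + g z - (l + m) = (f z - l) + (g z - m) by ring.
by rewrite (le_trans (normcD _ _))// (splitr e) lerD// ?H1 ?H2 ?z0.
Qed.

Lemma tends0_sum (I : Type) (s : seq I) (F : I -> R[i] -> R[i]) (L : I -> R[i]) :
  (forall i, tends0 (F i) (L i)) ->
  tends0 (fun z => \sum_(i <- s) F i z) (\sum_(i <- s) L i).
Proof.
move=> H; elim: s => [|i s IH].
  by move=> e e0; exists 1 => // z _; rewrite !big_nil subrr Normc.normc0 ltW.
rewrite big_cons (_ : (fun _ => _) = fun z => F i z + \sum_(j <- s) F j z).
  exact: tends0D.
by apply/funext => z; rewrite big_cons.
Qed.

(** The zero of [g] at 0 cancels the pole: the first product tends to g'(0) b, the second to 0. *)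
Lemma tends0_slope g l (b c : R[i]) : cder g 0 l -> g 0 = 0 ->
  tends0 (fun z => g z * (b / z + c * z)) (l * b).
Proof.
move=> dg g0.
have H1 : tends0 (fun z => g z * (b / z)) (l * b).
  move=> e e0; have b0 : 0 < 1 + normc b by rewrite ltr_wpDr ?normc_ge0.
  have [d d0 H] := dg _ (divr_gt0 e0 b0); exists d => // z /andP[z0 zd].
  have zn0 : z != 0 by rewrite -normc_gt0.
  have := H z zd; rewrite add0r g0 subr0 => Hz.
  have -> : g z * (b / z) - l * b = (g z - l * z) * (b / z) by field.
  rewrite normcM normcM normcV.
  apply: (@le_trans _ _ (e / (1 + normc b) * normc z * (normc b / normc z))).
    by rewrite ler_wpM2r ?divr_ge0 ?normc_ge0.
  have -> : e / (1 + normc b) * normc z * (normc b / normc z) = e * (normc b / (1 + normc b)).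
    by field; rewrite !gt_eqF.
  by rewrite ler_piMr ?(ltW e0)// ler_pdivrMr// mul1r lerDr.
have H2 : tends0 (fun z => g z * (c * z)) 0.
  have [l' dl'] : holo (fun z => g z * (c * z)) 0.
    apply: holoM; first by exists l.
    by apply: holoM; [exact: holo_cst|exact: holo_id].
  move=> e e0; have [d d0 H] := cder_continuous dl' e0.
  exists d => // z /andP[_ /H]; rewrite add0r g0 mul0r//.
have := tends0D H1 H2; rewrite addr0.
by congr tends0; apply/funext => z; rewrite mulrDr.
Qed.

(** The identity |N| = <N, N / |N|>, integrated. It is the equality case of the Cauchy-Schwarz bound
    used for competitors, and makes the lower bound meet the upper one. *)
Lemma ellipse_int theta : 0 <= theta <= pi / 4 ->
  \int[mu]_(t in `[0, 2 * pi]) ellipse_norm theta t =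
  pi * (cos theta * ext_re theta + sin theta * ext_im theta).
Proof.
move=> th; have pi0 := pi_gt0 R.
have -> : pi * (cos theta * ext_re theta + sin theta * ext_im theta) =
  cos theta * (pi * ext_re theta) + sin theta * (pi * ext_im theta) by ring.
rewrite /ext_re /ext_im !mulVKf ?gt_eqF//.
have [c0 c1] : mu.-integrable `[0, 2 * pi] (EFin \o (fun t => cos theta * cos t ^+ 2 / ellipse_norm theta t)) /\
    mu.-integrable `[0, 2 * pi] (EFin \o (fun t => sin theta * sin t ^+ 2 / ellipse_norm theta t)).
  split.
  - rewrite (_ : _ \o _ = EFin \o (fun t => cos t * ext_dir theta 0 t)).
      by apply: ext_dir_integrable => //; exact: continuous_cos.
    by apply/funext => t; rewrite /= ext_dirE /=; congr EFin; ring.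
  - rewrite (_ : _ \o _ = EFin \o (fun t => - sin t * ext_dir theta 1 t)).
      by apply: ext_dir_integrable => // t; apply: cvgN; exact: continuous_sin.
    by apply/funext => t; rewrite /= ext_dirE /=; congr EFin; ring.
have Z (c : R) (w : R -> R) : mu.-integrable `[0, 2 * pi] (EFin \o w) ->
    mu.-integrable `[0, 2 * pi] (EFin \o (fun t => c * w t)).
  by move=> iw; rewrite (_ : _ \o _ = (fun t => c%:E * (w t)%:E)%E)//; exact: integrableZl.
rewrite -RintegralZl// -RintegralZl// -RintegralD//; [|exact: Z|exact: Z].
apply: eq_Rintegral => t _.
have E := ellipse_norm_sqr theta t.
have [N0|N0] := eqVneq (ellipse_norm theta t) 0; first by rewrite N0 invr0 !mulr0 addr0.
apply: (mulIf N0); rewrite mulrDl !mulrA !mulfVK// -expr2 E; ring.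
Qed.

Lemma Re_circle_pairing n (p q x : 'rV[R]_n) theta t : dot p p <= 1 -> dot q q <= 1 ->
  dot p q = 0 -> enorm x <= 1 ->
  dot x ((cos theta * cos t) *: p - (sin theta * sin t) *: q) <= ellipse_norm theta t.
Proof.
move=> p1 q1 pq x1; apply: (le_trans (cauchy_schwarz _ _)).
apply: (@le_trans _ _ (1 * enorm ((cos theta * cos t) *: p - (sin theta * sin t) *: q))).
  by rewrite ler_wpM2r// sqrtr_ge0.
rewrite mul1r /enorm -scaleNr dot_combo pq mulr0 addr0 sqrrN /ellipse_norm.
apply: ler_wsqrtr; apply: lerD.
  by rewrite -[leRHS]mulr1 ler_wpM2l ?sqr_ge0.
by rewrite -[leRHS]mulr1 ler_wpM2l ?sqr_ge0.
Qed.

Lemma kobayashi_tube_ge n (p q : 'rV[R]_n) u theta r : normc u = 1 ->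
  dot p p = 1 -> dot q q <= 1 -> dot p q = 0 -> 0 <= theta <= pi / 4 -> 0 < r ->
  0 < ext_re theta -> 0 <= ext_im theta ->
  ext_im theta * dot q q = ext_im theta ->
  (r%:E <= kobayashi (tube unit_ball) 0
    (u *: cvec ((r * ext_re theta) *: p) ((r * ext_im theta) *: q)))%E.
Proof.
move=> u1 p1 q1 pq th r0 A0 B0 Bq; have pi0 := pi_gt0 R.
apply: le_ereal_inf_tmp => _ [t [t0 [f [hf Gf f0 df]]] <-]; rewrite lee_fin.
have uJ : normc (conjc u) = 1 by rewrite normc_conj.
have uu := unit_conj u1.
have disc z : normc z < 1 -> normc (conjc u * z) < 1 by rewrite normcM uJ mul1r.
have hfj z j : normc z < 1 -> holo (fun w => f w 0 j) z.
  move=> /unit_discE z1; have := derivableP (hf z z1).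
  by move=> /(is_derive_mxP f z) H; exists (('D_1 (f : R[i]^o -> _) z) 0 j); exact: H.
pose d := cderive f 0.
have df0 j : cder (fun w => f w 0 j) 0 (d 0 j).
  have z1 : unit_disc (0 : R[i]) by apply/unit_discE; rewrite Normc.normc0.
  by have := derivableP (hf 0 z1) => /(is_derive_mxP f 0) H; exact: H.
(* Turning the disc by [conjc u] strips the factor u off the derivative. *)
pose g j z := f (conjc u * z) 0 j.
have dg j : cder (g j) 0 (d 0 j * conjc u).
  apply: (cder_comp (cder_mulr (conjc u) 0) (g := fun w => f w 0 j)).
  by rewrite mulr0; exact: df0.
have g0 j : g j 0 = 0 by rewrite /g mulr0 f0 mxE.
have hg j z : normc z < 1 -> holo (g j) z.
  move=> /disc/(hfj _ j)[l dl].
  by exists (l * conjc u); exact: (cder_comp (cder_mulr (conjc u) z) (g := fun w => f w 0 j)).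
pose b j := (cos theta * p 0 j) -i* (sin theta * q 0 j).
(* By [ellipse_int], [pi * L] is the integral of |N|. This constant appears on both sides of the
   final comparison and is cancelled there, hence its positivity. *)
pose L := cos theta * ext_re theta + sin theta * ext_im theta.
have L0 : 0 < L.
  have c0 := cos_quarter_gt0 th.
  have s0 : 0 <= sin theta by apply: sin_ge0_pi; move: th => /andP[? ?]; apply/andP; split; lra.
  by apply: ltr_wpDr; [exact: mulr_ge0|exact: mulr_gt0].
(* With rho = r / (r + e) the bound becomes r^2 / (r + e) <= t, and r^2 / (r + e) >= r - e. *)
suff H rho : 0 < rho < 1 -> rho * r <= t.
  apply/ler_addgt0Pl => e e0.
  have re0 : 0 < r + e by rewrite addr_gt0.
  pose rho := r / (r + e).
  have rho01 : 0 < rho < 1 by rewrite divr_gt0//= ltr_pdivrMr// mul1r ltrDl.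
  have := H _ rho01; rewrite /rho => K.
  have : r * r / (r + e) <= t by rewrite mulrAC in K *.
  rewrite ler_pdivrMr// => {}K.
  have : r * r - e * e <= r * r by rewrite gerDl oppr_le0 mulr_ge0 ?ltW.
  move=> K2; have : (r - e) * (r + e) <= t * (r + e) by apply: le_trans K; move: K2; lra.
  by rewrite ler_pM2r// lerBlDr addrC.
move=> /andP[rho0 rho1].
(* At z = rho e^(is) the two terms of the second factor are conjugate to each other, so it is the
   real number 2 Re (b_j e^(-is)), which is twice the j-th coordinate of N(s). *)
pose phi z := \sum_(j < n) g j z * ((b j * rho%:C) / z + (conjc (b j) / rho%:C) * z).
pose l := \sum_(j < n) d 0 j * conjc u * (b j * rho%:C).
have M : \int[mu]_(s in `[0, 2 * pi]) complex.Re (phi (rho%:C * cis s)) = 2 * pi * complex.Re l.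
  apply: circle_mean => //; last first.
    by apply: tends0_sum => j; exact: tends0_slope.
  move=> z /andP[z0 zr]; have zn0 : z != 0 by rewrite -normc_gt0.
  apply: holo_sum => j; apply: holoM; first by apply: hg; exact: le_lt_trans rho1.
  apply: holoD.
    by apply: holoM; [exact: holo_cst|apply: holoV => //; exact: holo_id].
  by apply: holoM; [exact: holo_cst|exact: holo_id].
have lE : complex.Re l = rho / t * r * L.
  have dE j : d 0 j = (t^-1)%:C * (u * ((r * ext_re theta * p 0 j) +i* (r * ext_im theta * q 0 j))).
    have := congr1 (fun v : 'rV[R[i]]_n => v 0 j) df; rewrite !mxE -/d => <-.
    by rewrite mulrA -rmorphM /= mulVf ?gt_eqF// mul1r.
  rewrite /l raddf_sum /=.
  have E j : complex.Re (d 0 j * conjc u * (b j * rho%:C)) =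
     rho / t * r * (cos theta * ext_re theta * (p 0 j * p 0 j) + sin theta * ext_im theta * (q 0 j * q 0 j)).
    rewrite dE.
    have -> : (t^-1)%:C * (u * ((r * ext_re theta * p 0 j) +i* (r * ext_im theta * q 0 j))) * conjc u * (b j * rho%:C) =
      (t^-1)%:C * (u * conjc u) * ((r * ext_re theta * p 0 j) +i* (r * ext_im theta * q 0 j)) * (b j * rho%:C) by ring.
    by rewrite uu /b /=; ring.
  rewrite (eq_bigr _ (fun j _ => E j)) -mulr_sumr big_split /= -!mulr_sumr.
  have -> : \sum_i p 0 i * p 0 i = 1 by exact: p1.
  (* If q is not a unit vector, [Bq] forces [ext_im theta] to be 0, so the factor [dot q q]
     disappears in every case. *)
  by rewrite -/(dot q q) -[sin theta * _ * _]mulrA Bq mulr1.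
have N2 : \int[mu]_(s in `[0, 2 * pi]) complex.Re (phi (rho%:C * cis s)) <=
    \int[mu]_(s in `[0, 2 * pi]) (2 * ellipse_norm theta s).
  apply: le_Rintegral => //.
  - apply: itv_integrable; apply: itv_within_continuous => s _.
    have nr : normc (rho%:C * cis s) = rho by rewrite normcM normc_real normc_cis mulr1 gtr0_norm.
    have [l' dl'] : holo phi (rho%:C * cis s).
      apply: holo_sum => j; apply: holoM; first by apply: hg; rewrite nr.
      apply: holoD.
        apply: holoM; first exact: holo_cst.
        by apply: holoV; [rewrite -normc_gt0 nr|exact: holo_id].
      by apply: holoM; [exact: holo_cst|exact: holo_id].
    have [] // := cder_path_continuous (p := fun s => rho%:C * cis s) dl'.
    + rewrite (_ : (fun _ => _) = (fun t => rho * cos t)).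
        by apply: cvgMl_tmp; exact: continuous_cos.
      by apply/funext => x; rewrite /cis /= mul0r subr0.
    + rewrite (_ : (fun _ => _) = (fun t => rho * sin t)).
        by apply: cvgMl_tmp; exact: continuous_sin.
      by apply/funext => x; rewrite /cis /= mul0r addr0.
  - apply: itv_integrable; apply: within_continuous => s; apply: cvgMl_tmp.
    exact: ellipse_norm_continuous.
  move=> s _; pose x := re_vec (f (conjc u * (rho%:C * cis s))).
  have x1 : enorm x <= 1.
    apply: ltW; have := Gf (conjc u * (rho%:C * cis s)).
    by apply; apply/unit_discE/disc; rewrite normcM normc_real normc_cis mulr1 gtr0_norm.
  apply: (@le_trans _ _ (2 * dot x ((cos theta * cos s) *: p - (sin theta * sin s) *: q))); last first.
    by rewrite ler_pM2l//; apply: Re_circle_pairing => //; rewrite p1.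
  rewrite le_eqVlt; apply/orP; left; apply/eqP.
  rewrite /phi raddf_sum /= /dot mulr_sumr; apply: eq_bigr => j _.
  have rn0 : (rho%:C : R[i]) != 0 by rewrite -normc_gt0 normc_real normr_gt0 gt_eqF.
  have -> : b j * rho%:C / (rho%:C * cis s) + conjc (b j) / rho%:C * (rho%:C * cis s) =
     (2 * (cos theta * cos s * p 0 j - sin theta * sin s * q 0 j))%:C.
    have -> : b j * rho%:C / (rho%:C * cis s) = b j * conjc (cis s).
      have c0 := cis_neq0 s.
      have -> : conjc (cis s) = (cis s)^-1 by apply: (mulfI c0); rewrite cis_conj mulfV.
      by rewrite [rho%:C * cis s]mulrC -mulf_div divff // mulr1.
    have -> : conjc (b j) / rho%:C * (rho%:C * cis s) = conjc (b j) * cis s.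
      by rewrite mulrA divfK.
    by rewrite /b /cis; apply/eqP; rewrite eq_complex; apply/andP; split; apply/eqP => /=; ring.
  rewrite /g /x !mxE; case: (f _ 0 j) => a c /=; ring.
move: N2; rewrite M lE RintegralZl//; last first.
  by apply: itv_integrable; apply: within_continuous; exact: ellipse_norm_continuous.
rewrite ellipse_int// -/L.
have -> : 2 * pi * (rho / t * r * L) = (2 * pi * L) * (rho * r / t) by ring.
have -> : 2 * (pi * L) = (2 * pi * L) * 1 by ring.
have piL : 0 < 2 * pi * L by rewrite !mulr_gt0.
by rewrite (ler_pM2l piL) ler_pdivrMr// mul1r.
Qed.

End KobayashiTube.

(** * From the vector equation to two real equations *)

Section MainReduction.
Context {R : realType}.
Implicit Types (theta r x y : R).

Lemma cderive_fext theta : 0 <= theta <= pi / 4 ->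
  cderive (fext theta) 0 = cpair (ext_re theta)%:C ('i%C * (ext_im theta)%:C).
Proof. by move=> /fext_is_derive[]. Qed.

Lemma scale_cpair r x y : r%:C *: cpair x%:C ('i%C * y%:C) =
  cpair (r * x)%:C ('i%C * (r * y)%:C).
Proof. by apply/rowP => j; rewrite !mxE; case: ifP => _; rewrite rmorphM//= mulrCA. Qed.

Lemma cpair_inj x y x' y' : cpair x%:C ('i%C * y%:C) = cpair x'%:C ('i%C * y'%:C) ->
  x = x' /\ y = y'.
Proof.
move=> /rowP E; have := E 0; have := E 1; rewrite !mxE /= => -[].
by rewrite !mul0r !mul1r !add0r => _ -> -[].
Qed.

Lemma beta_le_alpha n (X Y : 'rV[R]_n) : beta X Y <= alpha X Y.
Proof. by apply: ler_wsqrtr; rewrite lerD2r ge0_cp// mulr_ge0 ?invr_ge0 ?sqrtr_ge0. Qed.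

Lemma solution_ext n (X Y : 'rV[R]_n) r theta : 0 <= theta <= pi / 4 ->
  (r%:C *: cderive (fext theta) 0 = cpair (alpha X Y)%:C ('i%C * (beta X Y)%:C))
  <-> r * ext_re theta = alpha X Y /\ r * ext_im theta = beta X Y.
Proof.
move=> th; rewrite cderive_fext// scale_cpair.
by split=> [/cpair_inj|[-> ->]].
Qed.

End MainReduction.

Theorem theorem15 (R : realType) (n : nat) (X Y : 'rV[R]_n)
    (XY_neq0 : cvec X Y != 0) :
  [/\ forall theta : R, 0 < theta < pi / 4 ->
        let k := Num.sqrt (1 - tan theta ^+ 2) in
        is_derive (0 : R[i]^o) 1 (fext theta : R[i]^o -> 'rV[R[i]]_2)
          ((4 * tan theta / (pi * k))%:C *:
             cpair (derive1 ellK k * tan theta)%:C (- 'i%C * (derive1 ellE k)%:C)),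
      is_derive (0 : R[i]^o) 1 (fext 0 : R[i]^o -> 'rV[R[i]]_2)
        (cpair (4 / pi)%:C 0),
      is_derive (0 : R[i]^o) 1 (fext (pi / 4) : R[i]^o -> 'rV[R[i]]_2)
        (cpair 1 'i%C),
      exists! p : R * R,
        [/\ 0 < p.1, 0 <= p.2 <= pi / 4
          & p.1%:C *: cderive (fext p.2) 0
            = cpair (alpha X Y)%:C ('i%C * (beta X Y)%:C)]
    & forall r theta : R, 0 < r -> 0 <= theta <= pi / 4 ->
        r%:C *: cderive (fext theta) 0
          = cpair (alpha X Y)%:C ('i%C * (beta X Y)%:C) ->
        kobayashi (tube unit_ball) 0 (cvec X Y) = r%:E].
Proof.
have [u [p [q [u1 p1 pq [q1 qB] [a0 XYE]]]]] := normal_form XY_neq0.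
have pi0 : 0 <= pi / 4 :> R by rewrite divr_ge0// pi_ge0.
split.
- move=> theta th k.
  have th' : 0 <= theta <= pi / 4 by case/andP: th => ? ?; rewrite !ltW.
  have [E1 E2] := ext_elliptic th.
  have := fext_is_derive th'; rewrite E1 E2 -/k.
  by rewrite -scale_cpair rmorphN mulrN mulNr.
- have th0 : 0 <= (0 : R) <= pi / 4 by rewrite lexx.
  by have := fext_is_derive th0; rewrite ext_re0 ext_im0 mulr0.
- have th1 : 0 <= (pi / 4 : R) <= pi / 4 by rewrite lexx andbT.
  by have := fext_is_derive th1; rewrite ext_re_piquarter ext_im_piquarter mulr1.
- have b0 : 0 <= beta X Y <= alpha X Y by rewrite sqrtr_ge0 beta_le_alpha.
  have [r [theta [r0 th E1 E2]]] := ext_solution_exists a0 b0.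
  exists (r, theta); split; first by split=> //; apply/(solution_ext X Y r th).
  move=> [r' theta'] /= [r0' th' /(solution_ext X Y r' th')[E1' E2']].
  by have [-> ->] := ext_solution_unique a0 r0 r0' th th' E1 E2 E1' E2'.
- move=> r theta r0 th /(solution_ext X Y r th)[E1 E2].
  have A0 : 0 < ext_re theta by rewrite -(pmulr_rgt0 _ r0) E1.
  have B0 : 0 <= ext_im theta by rewrite -(pmulr_rge0 _ r0) E2 sqrtr_ge0.
  (* Division by r carries [beta X Y * dot q q = beta X Y] over to [ext_im theta]. *)
  have Bq : ext_im theta * dot q q = ext_im theta.
    by apply: (mulfI (lt0r_neq0 r0)); rewrite mulrA E2.
  rewrite XYE -E1 -E2; apply/le_anti/andP; split.
    by apply: kobayashi_tube_le; rewrite ?p1.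
  exact: kobayashi_tube_ge.
Qed.
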